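(* (1) Let $f(x_1,\dots,x_n)$ be a reduced homogeneous polynomial of degree $d$ over $k$. Then for every integer $m\ge 0$, $(f)^{m\text{-}jsc}=(f)+\mathfrak m^{m+1}$ in $k[[x_1,\dots,x_n]]$, where $\mathfrak m$ is the maximal ideal. (2) Let $f\in R=k[[x,y]]$ be a weighted homogeneous polynomial in which $x$ has weight $a$ and $y$ has weight $b$, where $a,b$ are positive integers with $\gcd(a,b)=1$. Write $f(x,y)=\sum_{l=1}^{s}c_l x^{i_l}y^{j_l}$ with distinct exponent pairs $(i_l,j_l)$, where $ai_l+bj_l=d$ and $c_l\in k\setminus\{0\}$ for every $l$. For an integer $m\ge 0$ let $$A_m:=\{(u,v)\in\mathbb Z_{>0}^2:\ ui_l+vj_l\ge m+1 \text{ for all } l=1,\dots,s\}.$$ (a) If $m<d$, then $(f)^{m\text{-}jsc}$ is the ideal generated by all monomials $x^py^q$ such that $pu+qv\ge m+1$ for all $(u,v)\in A_m$. (b) If $m\ge d$ and $f$ is reduced, then $(f)^{m\text{-}jsc}=J_1\cap J_2$, where $J_1$ is the ideal generated by $f$ and all monomials $x^{p_1}y^{q_1}$ with $ap_1+bq_1\ge m+1$, and $J_2$ is the ideal generated by all monomials $x^{p_2}y^{q_2}$ such that $up_2+vq_2\ge m+1$ for all $(u,v)\in A_m$ with $u\le a$ or $v\le b$. (3) Let $R=k[[x,y]]$, and let $R/I_1$ and $R/I_2$ be two simple curve singularities. Set $M:=\max\{\mu(R/I_1),\mu(R/I_2)\}$, the maximum of their Milnor numbers. Then $R/I_1\cong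 R/I_2$ if and only if $R/I_1^{m\text{-}jsc}\cong R/I_2^{m\text{-}jsc}$ for all $m\le M+1$.
   Context: $k$ is an algebraically closed field of characteristic $0$. Jet support closure: let $R=k[[x_1,\dots,x_n]]$ (for $n=2$ the variables are written $x,y$) with maximal ideal $\mathfrak m$. For an integer $m\ge 0$ put $P_m=k[x_i^{(j)}: 1\le i\le n,\ 1\le j\le m]$. For $g\in R$ define $D_0(g),\dots,D_m(g)\in P_m$ by $$g\Big(\sum_{j=1}^m x_1^{(j)}t^j,\dots,\sum_{j=1}^m x_n^{(j)}t^j\Big)\equiv\sum_{j=0}^m D_j(g)\,t^j \pmod{t^{m+1}}.$$ For an ideal $I\subset R$ let $\overline{I}_m\subset P_m$ be the ideal generated by all $D_j(g)$ with $g\in I$, $0\le j\le m$. (Here $P_m$ is the $m$-th jet ring $R_m$ modulo $\mathfrak m R_m$, and $\overline I_m$ is the image of the $m$-th jet ideal of $I$.) The $m$-th jet support closure of $I$ is $$I^{m\text{-}jsc}=\Big\{f\in R: D_j(f)\in \sqrt{\overline I_m} \text{ for all } 0\le j\le m\Big\}.$$ A polynomial is weighted homogeneous with weights $d_1,\dots,d_n>0$ if there is $d$ such that every monomial $x_1^{a_1}\cdots x_n^{a_n}$ occurring in it satisfies $a_1d_1+\cdots+a_nd_n=d$. A simple curve singularity is $R/I$ with $R=k[[x,y]]$ and $I=(f)$, where $f$ is contact equivalent (i.e. $R/(f)$ is isomorphic as a $k$-algebra) to one of: $A_n$: $x^{n+1}+y^2$ ($n\ge1$); $D_n$: $y(x^2+y^{n-2})$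 ($n\ge4$); $E_6$: $x^3+y^4$; $E_7$: $x(x^2+y^3)$; $E_8$: $x^3+y^5$. The Milnor number is $\mu(R/(f))=\dim_k R/(\partial_x f,\partial_y f)$. Isomorphisms in (3) are isomorphisms of $k$-algebras. *)

(* Defs.v *)
From HB Require Import structures.
From mathcomp Require Import all_boot all_order all_algebra ring_quotient.
From mathcomp Require Import boolp classical_sets.
From mathcomp Require Import mpoly.

Set Implicit Arguments.
Unset Strict Implicit.
Unset Printing Implicit Defensive.

Import GRing.Theory.
Local Open Scope ring_scope.
Local Open Scope classical_set_scope.
Local Open Scope quotient_scope.

Record ideal (A : comNzRingType) := Ideal {
  ideal_set :> A -> Prop;
  ideal0 : ideal_set 0;
  idealD : forall x y, ideal_set x -> ideal_set y -> ideal_set (x + y);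
  idealM : forall a x, ideal_set x -> ideal_set (a * x) }.

Section IdealOperations.
Variable A : comNzRingType.
Implicit Types (S : set A) (I J : ideal A).

Definition gen_set S : set A :=
  [set x | exists2 s : seq (A * A),
     (forall p, p \in s -> S p.2) & x = \sum_(p <- s) p.1 * p.2].

Lemma gen_set0 S : gen_set S 0.
Proof. by exists [::]; rewrite ?big_nil. Qed.

Lemma gen_setD S x y : gen_set S x -> gen_set S y -> gen_set S (x + y).
Proof.
move=> [s Ss ->] [t St ->]; exists (s ++ t); last by rewrite big_cat.
by move=> p; rewrite mem_cat => /orP[/Ss|/St].
Qed.

Lemma gen_setM S a x : gen_set S x -> gen_set S (a * x).
Proof.
move=> [s Ss ->]; exists [seq (a * p.1, p.2) | p <- s].
  by move=> _ /mapP[p /Ss Sp ->].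
by rewrite big_map mulr_sumr; apply: eq_bigr => p _; rewrite mulrA.
Qed.

Definition gen S : ideal A := Ideal (@gen_set0 S) (@gen_setD S) (@gen_setM S).

Definition principal (a : A) : ideal A := gen [set a].

Definition ideal_add I J : ideal A := gen (ideal_set I `|` ideal_set J).

Definition ideal_pow I (n : nat) : ideal A :=
  gen [set x | exists2 a : 'I_n -> A, (forall i, I (a i)) & x = \prod_i a i].

Definition radical_set I : set A := [set x | exists r, I (x ^+ r)].

Lemma radical_set0 I : radical_set I 0.
Proof. by exists 1%N; rewrite expr1; apply: ideal0. Qed.

Lemma radical_setM I a x : radical_set I x -> radical_set I (a * x).
Proof. by case=> r Ir; exists r; rewrite exprMn; apply: idealM. Qed.

Lemma ideal_sum I (T : Type) (r : seq T) (P : pred T) (F : T -> A) :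
  (forall i, P i -> I (F i)) -> I (\sum_(i <- r | P i) F i).
Proof. by move=> IF; apply: big_ind => //; [apply: ideal0 | apply: idealD]. Qed.

Lemma radical_setD I x y :
  radical_set I x -> radical_set I y -> radical_set I (x + y).
Proof.
move=> [r Ir] [s Is]; exists (r + s)%N; rewrite exprDn.
apply: ideal_sum => i _; rewrite -mulr_natl; apply: idealM.
have [le_si|/ltnW lt_is] := leqP s i.
  by rewrite -(subnK le_si) exprD mulrA; apply: idealM.
have -> : (r + s - i = s - i + r)%N.
  by move: (val i) lt_is => j lt_js; rewrite addnC addnBAC.
by rewrite mulrC exprD mulrA; apply: idealM.
Qed.

Definition radical I : ideal A :=
  Ideal (radical_set0 I) (@radical_setD I) (@radical_setM I).

Definition is_radical I : Prop := ideal_set (radical I) `<=` ideal_set I.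

End IdealOperations.

(* The quotient of A by (a) is a reduced ring. *)
Definition reduced (A : comNzRingType) (a : A) : Prop := is_radical (principal a).

(* The quotient may be the zero ring, which excludes the canonical quotient
   rings of ring_quotient and the structure algType. It carries the
   structures comPzRingType and lmodType. *)

Section QuotientAlgebra.
Variables (k : comNzRingType) (A : comAlgType k) (I : ideal A).

Definition ideal_pred : {pred A} := fun x => `[< I x >].

Fact ideal_pred_zmod : zmod_closed ideal_pred.
Proof.
split=> [|x y /asboolP Ix /asboolP Iy]; apply/asboolP; first exact: ideal0.
by apply: idealD => //; rewrite -mulN1r; apply: idealM.
Qed.

HB.instance Definition _ := GRing.isZmodClosed.Build A ideal_pred ideal_pred_zmod.

Definition quot_alg : Type := Quotient.quot ideal_pred.
HB.instance Definition _ := GRing.Zmodule.on quot_alg.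
HB.instance Definition _ := EqQuotient.on quot_alg.

Definition qpi (x : A) : quot_alg := \pi_quot_alg x.

Lemma qpi_repr (x : quot_alg) : qpi (repr x) = x.
Proof. exact: reprK. Qed.

Lemma qpi_eq x y : (qpi x = qpi y) <-> I (x - y).
Proof.
split=> [/eqP|H]; first by rewrite /qpi -Quotient.idealrBE => /asboolP.
by apply/eqP; rewrite /qpi -Quotient.idealrBE; apply/asboolP.
Qed.

Lemma qpiD x y : qpi (x + y) = qpi x + qpi y.
Proof. exact: (Quotient.pi_add ideal_pred). Qed.

Definition qone : quot_alg := qpi 1.
Definition qmul (x y : quot_alg) : quot_alg := qpi (repr x * repr y).
Definition qscale (c : k) (x : quot_alg) : quot_alg := qpi (c *: repr x).

Lemma repr_qpi x : I (repr (qpi x) - x).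
Proof. by apply/qpi_eq; rewrite qpi_repr. Qed.

Lemma qpiM x y : qpi (x * y) = qmul (qpi x) (qpi y).
Proof.
apply/esym/qpi_eq.
set x' := repr _; set y' := repr _.
have -> : x' * y' - x * y = y' * (x' - x) + x * (y' - y).
  by rewrite !mulrBr [y' * x']mulrC [y' * x]mulrC addrA subrK.
by apply: idealD; apply: idealM; apply: repr_qpi.
Qed.

Lemma qpiZ c x : qpi (c *: x) = qscale c (qpi x).
Proof.
apply/esym/qpi_eq; rewrite -scalerBr -mulr_algl.
by apply: idealM; apply: repr_qpi.
Qed.

Lemma qpi_ind (P : quot_alg -> Prop) : (forall x, P (qpi x)) -> forall x, P x.
Proof. by move=> H x; rewrite -(qpi_repr x). Qed.

Fact qmulA : associative qmul.
Proof.
by do 3!elim/qpi_ind=> ?; rewrite -!qpiM mulrA.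
Qed.
Fact qmulC : commutative qmul.
Proof. by do 2!elim/qpi_ind=> ?; rewrite -!qpiM mulrC. Qed.
Fact qmul1 : left_id qone qmul.
Proof. by elim/qpi_ind=> ?; rewrite -!qpiM mul1r. Qed.
Fact qmulDl : left_distributive qmul +%R.
Proof. by do 3!elim/qpi_ind=> ?; rewrite -!(qpiM, qpiD) mulrDl. Qed.

HB.instance Definition _ :=
  GRing.Zmodule_isComPzRing.Build quot_alg qmulA qmulC qmul1 qmulDl.

Fact qscaleA a b x : qscale a (qscale b x) = qscale (a * b) x.
Proof. by elim/qpi_ind: x => x; rewrite -!qpiZ scalerA. Qed.
Fact qscale1 : left_id 1 qscale.
Proof. by elim/qpi_ind=> x; rewrite -!qpiZ scale1r. Qed.
Fact qscaleDr : right_distributive qscale +%R.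
Proof. by move=> a; do 2!elim/qpi_ind=> ?; rewrite -!(qpiD, qpiZ) scalerDr. Qed.
Fact qscaleDl x : {morph qscale^~ x : a b / a + b}.
Proof. by elim/qpi_ind: x => x a b; rewrite -!(qpiD, qpiZ) scalerDl. Qed.

HB.instance Definition _ :=
  GRing.Zmodule_isLmodule.Build k quot_alg qscaleA qscale1 qscaleDr qscaleDl.

End QuotientAlgebra.

Definition quot_iso (k : comNzRingType) (A B : comAlgType k)
    (I : ideal A) (J : ideal B) : Prop :=
  exists phi : {linear quot_alg I -> quot_alg J},
    monoid_morphism phi /\ bijective phi.

Definition has_dim (k : nzRingType) (V : lmodType k) : set nat :=
  [set d | exists phi : {linear V -> 'rV[k]_d}, bijective phi].

(* Equal to 0 on spaces of infinite dimension. *)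
Definition dimk (k : nzRingType) (V : lmodType k) : nat := xget 0%N (has_dim V).

Record mpseries (n : nat) (R : Type) := MPSeries {
  mpscoef :> 'X_{1..n} -> R }.

HB.instance Definition _ n R := [isNew for @mpscoef n R].
HB.instance Definition _ n (R : choiceType) := [Choice of mpseries n R by <:].

Section PowerSeriesRing.
Variables (n : nat) (R : comNzRingType).
Implicit Types (f g h : mpseries n R).
Local Notation series := (mpseries n R).

Lemma mpseriesP f g : (forall m, f m = g m) -> f = g.
Proof. by case: f g => [f] [g] /= /funext ->. Qed.

Definition series0 : series := MPSeries (fun _ => 0).
Definition series_opp f : series := MPSeries (fun m => - f m).
Definition series_add f g : series := MPSeries (fun m => f m + g m).

Fact series_addA : associative series_add.
Proof. by move=> f g h; apply: mpseriesP => m /=; rewrite addrA. Qed.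
Fact series_addC : commutative series_add.
Proof. by move=> f g; apply: mpseriesP => m /=; rewrite addrC. Qed.
Fact series_add0 : left_id series0 series_add.
Proof. by move=> f; apply: mpseriesP => m /=; rewrite add0r. Qed.
Fact series_addN : left_inverse series0 series_opp series_add.
Proof. by move=> f; apply: mpseriesP => m /=; rewrite addNr. Qed.

HB.instance Definition _ := GRing.isZmodule.Build series
  series_addA series_addC series_add0 series_addN.

Definition series_of_mpoly (p : {mpoly R[n]}) : series :=
  MPSeries (fun m => p@_m).

(* Keeps the terms of total degree < d. *)
Definition series_trunc (d : nat) f : {mpoly R[n]} :=
  \sum_(m : 'X_{1..n < d}) f m *: 'X_[m].

Lemma mcoeff_trunc d f m :
  (series_trunc d f)@_m = if (mdeg m < d)%N then f m else 0.
Proof.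
case: ltnP => [/mcoeff_mpoly -> // | le_dm].
rewrite /series_trunc raddf_sum big1 //= => i _; rewrite mcoeffZ mcoeffX.
case: eqP => [im|_]; last by rewrite mulr0.
by have := bmdeg i; rewrite im ltnNge le_dm.
Qed.

Definition series1 : series := series_of_mpoly 1.
Definition series_mul f g : series := MPSeries (fun m =>
  \sum_(p : 'X_{1..n < (mdeg m).+1, (mdeg m).+1} | m == (p.1 + p.2)%MM)
     f p.1 * g p.2).

Lemma mcoeffM_local (p q p' q' : {mpoly R[n]}) d :
    (forall m, (mdeg m < d)%N -> p@_m = p'@_m) ->
    (forall m, (mdeg m < d)%N -> q@_m = q'@_m) ->
  forall m, (mdeg m < d)%N -> (p * q)@_m = (p' * q')@_m.
Proof.
move=> ep eq m lt_md; rewrite !mcoeffM; apply: eq_bigr => -[a b] /= /eqP Em.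
by rewrite ep ?eq //; apply: leq_trans lt_md; apply: bmdeg.
Qed.

Lemma series_mulE d f g m : (mdeg m < d)%N ->
  series_mul f g m = (series_trunc d f * series_trunc d g)@_m.
Proof.
move=> lt_md; rewrite mcoeffM /=; apply: eq_bigr => -[a b] /= _.
by rewrite !mcoeff_trunc !ifT //; apply: leq_trans lt_md; apply: bmdeg.
Qed.

Lemma trunc_mul d f g m : (mdeg m < d)%N ->
  (series_trunc d (series_mul f g))@_m
    = (series_trunc d f * series_trunc d g)@_m.
Proof. by move=> lt_md; rewrite mcoeff_trunc lt_md; apply: series_mulE. Qed.

Fact series_mulC : commutative series_mul.
Proof.
by move=> f g; apply: mpseriesP => m; rewrite !(series_mulE _ _ (ltnSn _)) mulrC.
Qed.

Fact series_mulA : associative series_mul.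
Proof.
move=> f g h; apply: mpseriesP => m; rewrite !(series_mulE _ _ (ltnSn _)).
set d := (mdeg m).+1; have lt_md : (mdeg m < d)%N by [].
rewrite (mcoeffM_local (fun _ _ => erefl) (@trunc_mul d g h) lt_md).
by rewrite mulrA (mcoeffM_local (@trunc_mul d f g) (fun _ _ => erefl) lt_md).
Qed.

Fact series_mul1 : left_id series1 series_mul.
Proof.
move=> f; apply: mpseriesP => m; rewrite (series_mulE _ _ (ltnSn _)).
set d := (mdeg m).+1; have lt_md : (mdeg m < d)%N by [].
have e1 a : (mdeg a < d)%N -> (series_trunc d series1)@_a = 1@_a.
  by move=> lt_ad; rewrite mcoeff_trunc lt_ad.
by rewrite (mcoeffM_local e1 (fun _ _ => erefl) lt_md) mul1r mcoeff_trunc lt_md.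
Qed.

Fact series_mulDl : left_distributive series_mul +%R.
Proof.
move=> f g h; apply: mpseriesP => m /=; rewrite -big_split /=.
by apply: eq_bigr => i _; rewrite mulrDl.
Qed.

Fact series1_neq0 : series1 != 0.
Proof.
apply/eqP => /(congr1 (fun f : series => f 0%MM)) /=.
by move/eqP; rewrite mcoeff1 eqxx oner_eq0.
Qed.

HB.instance Definition _ := GRing.Zmodule_isComNzRing.Build series
  series_mulA series_mulC series_mul1 series_mulDl series1_neq0.

Definition series_scale (c : R) f : series := MPSeries (fun m => c * f m).

Fact series_scaleA a b f :
  series_scale a (series_scale b f) = series_scale (a * b) f.
Proof. by apply: mpseriesP => m /=; rewrite mulrA. Qed.
Fact series_scale1 : left_id 1 series_scale.
Proof. by move=> f; apply: mpseriesP => m /=; rewrite mul1r. Qed.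
Fact series_scaleDr : right_distributive series_scale +%R.
Proof. by move=> a f g; apply: mpseriesP => m /=; rewrite mulrDr. Qed.
Fact series_scaleDl f : {morph series_scale^~ f : a b / a + b}.
Proof. by move=> a b; apply: mpseriesP => m /=; rewrite mulrDl. Qed.

HB.instance Definition _ := GRing.Zmodule_isLmodule.Build R series
  series_scaleA series_scale1 series_scaleDr series_scaleDl.

Fact series_scaleAl (a : R) (f g : series) : a *: (f * g) = (a *: f) * g.
Proof.
apply: mpseriesP => m /=; rewrite mulr_sumr.
by apply: eq_bigr => i _; rewrite mulrA.
Qed.

HB.instance Definition _ := GRing.Lmodule_isLalgebra.Build R series series_scaleAl.
HB.instance Definition _ := GRing.Lalgebra_isComAlgebra.Build R series.

Definition seriesX (i : 'I_n) : series := series_of_mpoly 'X_i.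

Definition maximal_ideal : ideal series := gen (range seriesX).

Definition series_deriv (i : 'I_n) f : series :=
  MPSeries (fun m => f (m + U_(i))%MM *+ (m i).+1).

Definition jacobian_ideal f : ideal series :=
  gen [set series_deriv i f | i in [set: 'I_n]].

Definition milnor_number f : nat := dimk (quot_alg (jacobian_ideal f)).

End PowerSeriesRing.

Notation "{ 'mpseries' R [ n ] }" := (mpseries n R)
  (at level 0, R, n at level 2, format "{ 'mpseries'  R [ n ] }") : type_scope.

Section Jets.
Variables (n : nat) (R : comNzRingType) (m : nat).

(* The variable x_i^(l), for 1 <= l <= m, has index mxvec_index i (l - 1). *)
Definition jet_ring : comNzRingType := {mpoly R[n * m]}.

Definition arc (i : 'I_n) : {poly jet_ring} :=
  \sum_(l < m) ('X_(mxvec_index i l) : jet_ring)%:P * 'X^(l.+1).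

Definition jet_const (c : R) : {poly jet_ring} := (c%:MP : jet_ring)%:P.

(* As t divides every arc i, the terms of g of degree > m contribute nothing
   modulo t^(m+1). *)
Definition jet_coef (j : nat) (g : {mpseries R[n]}) : jet_ring :=
  (mmap jet_const arc (series_trunc m.+1 g))`_j.

Definition jet_ideal (I : ideal {mpseries R[n]}) : ideal jet_ring :=
  gen [set p | exists j g, [/\ (j <= m)%N, I g & p = jet_coef j g]].

Definition jsc_set (I : ideal {mpseries R[n]}) : set {mpseries R[n]} :=
  [set f | forall j, (j <= m)%N -> radical (jet_ideal I) (jet_coef j f)].

Fact jet_const_is_additive : zmod_morphism jet_const.
Proof. by move=> a b; rewrite /jet_const !raddfB. Qed.
Fact jet_const_is_multiplicative : monoid_morphism jet_const.
Proof. by split=> [|a b]; rewrite /jet_const ?rmorph1 // !rmorphM. Qed.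
HB.instance Definition _ :=
  GRing.isZmodMorphism.Build R {poly jet_ring} jet_const jet_const_is_additive.
HB.instance Definition _ :=
  GRing.isMonoidMorphism.Build R {poly jet_ring} jet_const
    jet_const_is_multiplicative.

Lemma jet_coefD j f g : jet_coef j (f + g) = jet_coef j f + jet_coef j g.
Proof.
rewrite /jet_coef.
suff -> : series_trunc m.+1 (f + g) = series_trunc m.+1 f + series_trunc m.+1 g.
  by rewrite mmapD coefD.
apply/mpolyP => a; rewrite mcoeffD !mcoeff_trunc.
by case: ifP; rewrite ?addr0.
Qed.

Lemma arc_dvd i : exists q : {poly jet_ring}, arc i = q * 'X.
Proof.
exists (\sum_(l < m) ('X_(mxvec_index i l) : jet_ring)%:P * 'X^l)%R.
by rewrite mulr_suml; apply: eq_bigr => l _; rewrite -mulrA -exprSr.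
Qed.

Lemma mmap1_arc_dvd (a : 'X_{1..n}) : exists q : {poly jet_ring}, mmap1 arc a = q * 'X^(mdeg a).
Proof.
rewrite /mmap1 mdegE; elim/big_rec2: _ => [|i x y _ [q ->]].
  by exists 1; rewrite expr0 mulr1.
have [r ->] := arc_dvd i; exists (r ^+ a i * q).
by rewrite exprMn exprD mulrACA.
Qed.

Lemma mmap_arc_local (p q : {mpoly R[n]}) j :
    (forall a, (mdeg a <= j)%N -> p@_a = q@_a) ->
  (mmap jet_const arc p)`_j = (mmap jet_const arc q)`_j.
Proof.
move=> pq; apply/eqP; rewrite -subr_eq0 -coefB -raddfB; apply/eqP.
rewrite /mmap coef_sum big1 // => a _.
have [le_aj|lt_ja] := leqP (mdeg a) j.
  by rewrite mcoeffB pq // subrr raddf0 mul0r coef0.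
by have [r ->] := mmap1_arc_dvd a; rewrite mulrA coefMXn lt_ja.
Qed.

Lemma jet_coefM j f g : (j <= m)%N ->
  jet_coef j (f * g) = \sum_(i < j.+1) jet_coef i f * jet_coef (j - i) g.
Proof.
move=> le_jm; rewrite /jet_coef -coefM -rmorphM; apply: mmap_arc_local => a le_aj.
by apply: trunc_mul; rewrite ltnS (leq_trans le_aj).
Qed.

Lemma jet_coef0 j : jet_coef j 0 = 0.
Proof.
rewrite /jet_coef (_ : series_trunc _ _ = 0) ?raddf0 ?coef0 //.
by rewrite /series_trunc big1 // => i _; rewrite scale0r.
Qed.

Fact jsc_set0 I : jsc_set I 0.
Proof. by move=> j _; rewrite jet_coef0; apply: ideal0. Qed.
Fact jsc_setD I f g : jsc_set I f -> jsc_set I g -> jsc_set I (f + g).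
Proof. by move=> If Ig j le_jm; rewrite jet_coefD; apply: idealD; auto. Qed.
Fact jsc_setM I f g : jsc_set I g -> jsc_set I (f * g).
Proof.
move=> Ig j le_jm; rewrite jet_coefM //; apply: ideal_sum => i _.
by apply: idealM; apply: Ig; rewrite (leq_trans (leq_subr _ _)).
Qed.

Definition jsc (I : ideal {mpseries R[n]}) : ideal {mpseries R[n]} :=
  Ideal (jsc_set0 I) (@jsc_setD I) (@jsc_setM I).

End Jets.

Definition weighted_homog (n : nat) (R : nzRingType) (w : 'I_n -> nat) (d : nat)
    (f : {mpoly R[n]}) : Prop :=
  {in msupp f, forall e : 'X_{1..n}, \sum_i e i * w i = d}%N.

Section Plane.
Variable k : comNzRingType.

Definition varx : {mpseries k[2]} := seriesX k ord0.
Definition vary : {mpseries k[2]} := seriesX k ord_max.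

Definition weights2 (a b : nat) : 'I_2 -> nat := tnth [tuple a; b].

Definition monomials (P : nat -> nat -> Prop) : set {mpseries k[2]} :=
  [set h | exists p q, P p q /\ h = varx ^+ p * vary ^+ q].

(* The positive weights (u, v) for which every monomial of f has weight > m. *)
Definition order_pairs (m : nat) (f : {mpoly k[2]}) (u v : nat) : Prop :=
  [/\ (0 < u)%N, (0 < v)%N &
    {in msupp f, forall e : 'X_{1..2},
       (m.+1 <= u * e ord0 + v * e ord_max)%N}].

Inductive simple_normal_form : {mpseries k[2]} -> Prop :=
| NormalA n of (1 <= n)%N : simple_normal_form (varx ^+ n.+1 + vary ^+ 2)
| NormalD n of (4 <= n)%N :
    simple_normal_form (vary * (varx ^+ 2 + vary ^+ (n - 2)))
| NormalE6 : simple_normal_form (varx ^+ 3 + vary ^+ 4)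
| NormalE7 : simple_normal_form (varx * (varx ^+ 2 + vary ^+ 3))
| NormalE8 : simple_normal_form (varx ^+ 3 + vary ^+ 5).

Definition simple_curve (f : {mpseries k[2]}) : Prop :=
  exists2 g, simple_normal_form g & quot_iso (principal f) (principal g).

End Plane.

(* Main.v *)
Require Import Defs.
From HB Require Import structures.
From mathcomp Require Import all_boot all_order all_algebra.
From mathcomp Require Import boolp classical_sets.
From mathcomp Require Import mpoly.
From mathcomp Require Import zify ring.

(** The jet support closure of an ideal I consists of the series that vanish to
    order m+1 along all m-jets of arcs contained in the scheme of I, where arcs
    have coefficients in arbitrary domains over k (a radical is an intersection
    of primes, [radical_prime]).

    Lower bounds on what vanishes come from explicit arcs over k. Let f be
    weighted homogeneous with positive weights w. If f(x) = 0, the arc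
    x_i t^(w_i) lies on f, and the coefficient of t^j of a series g along it is
    the value at x of the component of g of weight j. So, for g in the closure
    and j <= m, this component vanishes on the hypersurface f = 0; by the
    Nullstellensatz for a hypersurface ([hypersurface_nullstellensatz]), which
    has a short proof by division with remainder, it is a multiple of f if f is
    reduced. This gives (1), with weights 1, and the ideal J1 of (2b). If all
    monomials of f have weight above m for the weights (u, v), all arcs
    (x t^u, y t^v) are jets of f, and every monomial of g has weight above m;
    this gives the monomial ideals of (2).

    Conversely, take a prime P over the jet ideal of f in the plane, and let
    u and v be the orders modulo P of the two coordinates of the universal arc.
    Either all monomials of f have order above m along the arc, or the least
    order is attained twice, since otherwise it would be the order of f. In the
    latter case (u, v) is a multiple of (a, b), because a and b are coprime, and
    d <= m ([prime_order_pair]). Both cases are covered by the ideals of (2).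

    For (3), an isomorphism of quotients is, up to any given order, a
    substitution of power series, which acts on jets; hence it induces
    isomorphisms of the closures ([quot_iso_jsc]). Euler's formula shows that it
    also induces one of the Jacobian algebras if one of the equations is weighted
    homogeneous ([quot_iso_jacobian]), so that Milnor numbers may be bounded on
    the normal forms. Finally two distinct normal forms have closures of
    different codimension for some m <= M + 1. Codimensions are compared by
    counting coefficients: those at exponents below the order pairs of the
    equation ([staircase]) vanish on the closure, and determine it when m < d.
    To separate A_n with n odd, or D_n with n even, from its successors one has
    to take m = d; then the arcs along the branches of the curve give the
    missing conditions ([jsc_A_odd_coef], [jsc_D_even_coef]). *)

Set Implicit Arguments.
Unset Strict Implicit.
Unset Printing Implicit Defensive.

Import GRing.Theory.
Local Open Scope ring_scope.
Local Open Scope classical_set_scope.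

(** * Formal power series *)

Section SeriesBasics.
Variables (n : nat) (R : comNzRingType).
Implicit Types (f g h : {mpseries R[n]}) (e : 'X_{1..n}).

Lemma seriesE_mul f g e :
  (f * g) e = \sum_(p : 'X_{1..n < (mdeg e).+1, (mdeg e).+1} |
                    e == (p.1 + p.2)%MM) f p.1 * g p.2.
Proof. by []. Qed.

Fact series_of_mpoly_zmod : zmod_morphism (@series_of_mpoly n R).
Proof. by move=> p q; apply: mpseriesP => e /=; rewrite mcoeffB. Qed.
Fact series_of_mpoly_monoid : monoid_morphism (@series_of_mpoly n R).
Proof.
split=> [//|p q]; apply: mpseriesP => e /=.
by rewrite mcoeffM; apply: eq_bigr.
Qed.
Fact series_of_mpoly_scalable : scalable (@series_of_mpoly n R).
Proof. by move=> c p; apply: mpseriesP => e /=; rewrite mcoeffZ. Qed.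
HB.instance Definition _ := GRing.isZmodMorphism.Build _ _ (@series_of_mpoly n R)
  series_of_mpoly_zmod.
HB.instance Definition _ := GRing.isMonoidMorphism.Build _ _
  (@series_of_mpoly n R) series_of_mpoly_monoid.
HB.instance Definition _ := GRing.isScalable.Build R _ _ *:%R
  (@series_of_mpoly n R) series_of_mpoly_scalable.

Lemma series_sumE (I : Type) (r : seq I) (P : pred I) (F : I -> {mpseries R[n]}) e :
  (\sum_(i <- r | P i) F i) e = \sum_(i <- r | P i) F i e.
Proof. exact: (big_morph (fun f : {mpseries R[n]} => f e)). Qed.

Lemma seriesDE f g e : (f + g) e = f e + g e. Proof. by []. Qed.
Lemma seriesBE f g e : (f - g) e = f e - g e. Proof. by []. Qed.
Lemma seriesZE c f e : (c *: f) e = c * f e. Proof. by []. Qed.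

Lemma seriesX_mulE a h e :
  (series_of_mpoly 'X_[a] * h) e = if (a <= e)%MM then h (e - a)%MM else 0.
Proof.
rewrite seriesE_mul /=; case: ifP => [le_ae|le_ae].
  have la : (mdeg a < (mdeg e).+1)%N.
    by rewrite ltnS -(submK le_ae) mdegD leq_addl.
  have lb : (mdeg (e - a)%MM < (mdeg e).+1)%N.
    by rewrite ltnS -{2}(submK le_ae) mdegD leq_addr.
  rewrite (bigD1 (BMultinom la, BMultinom lb)) /=; last first.
    by rewrite addmC submK.
  rewrite mcoeffX eqxx mul1r big1 ?addr0 // => -[p q] /= /andP[/eqP E ne].
  rewrite mcoeffX; case: eqP => [Ea|]; last by rewrite mul0r.
  case/eqP: ne; congr (_, _); apply: val_inj => //=.
  by have := congr1 (fun x => (x - a)%MM) E; rewrite -Ea addmC addmK => ->.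
rewrite big1 // => -[p q] /= /eqP E; rewrite mcoeffX.
case: eqP => [Ea|]; last by rewrite mul0r.
by have := lem_addr p q; rewrite -E -Ea le_ae.
Qed.

Lemma series_const_mulE c f : series_of_mpoly c%:MP * f = c *: f.
Proof. by rewrite -[c%:MP]mulr1 mul_mpolyC linearZ /= rmorph1 -scalerAl mul1r. Qed.

Lemma series_truncK d f e : (mdeg e < d)%N ->
  (f - series_of_mpoly (series_trunc d f)) e = 0.
Proof. by move=> led; rewrite /= mcoeff_trunc led subrr. Qed.

(** The filtration by powers of the maximal ideal, read off from coefficients.
    *)
Definition ordge (N : nat) : set {mpseries R[n]} :=
  [set f | forall e, (mdeg e < N)%N -> f e = 0].

Lemma ordge_mul a b f g : ordge a f -> ordge b g -> ordge (a + b) (f * g).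
Proof.
move=> fa gb e lt_e; rewrite seriesE_mul big1 // => -[p q] /= /eqP E.
have lt_pq : (mdeg p + mdeg q < a + b)%N by rewrite -mdegD -E.
have [lt_pa|le_ap] := ltnP (mdeg p) a; first by rewrite fa // mul0r.
by rewrite gb ?mulr0 //; lia.
Qed.

Fact ordge0 N : ordge N 0. Proof. by []. Qed.
Fact ordgeD N f g : ordge N f -> ordge N g -> ordge N (f + g).
Proof. by move=> fN gN e lt; rewrite seriesDE fN // gN // addr0. Qed.
Fact ordgeM N f g : ordge N g -> ordge N (f * g).
Proof. by move=> gN; apply: (@ordge_mul 0 N). Qed.

Definition order_ideal N : ideal {mpseries R[n]} :=
  Ideal (@ordge0 N) (@ordgeD N) (@ordgeM N).

Lemma ordgeW N M f : (M <= N)%N -> ordge N f -> ordge M f.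
Proof. by move=> le fN e lt; apply: fN; apply: leq_trans le. Qed.

Lemma ordge_trunc N f : ordge N (f - series_of_mpoly (series_trunc N f)).
Proof. by move=> e lt; apply: series_truncK. Qed.

Lemma ordge_seriesX i : ordge 1 (seriesX R i : {mpseries R[n]}).
Proof.
move=> e; rewrite ltnS leqn0 mdeg_eq0 => /eqP -> /=.
by rewrite mcoeffX; case: eqP => // /(congr1 mdeg); rewrite mdeg1 mdeg0.
Qed.

Lemma series_prod_ordge (I : Type) (r : seq I) (F : I -> {mpseries R[n]}) :
  (forall i, ordge 1 (F i)) -> ordge (size r) (\prod_(i <- r) F i).
Proof.
move=> F1; elim: r => [|i r IH] /=; first by move=> e.
by rewrite big_cons -add1n; apply: ordge_mul.
Qed.

(** Each exponent other than 0 is charged to its first nonzero entry, so that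
    a series without constant term splits as a sum of multiples of the
    variables without counting any monomial twice. *)
Definition head_part f (i : 'I_n) : {mpseries R[n]} := MPSeries (fun e =>
  if [forall j : 'I_n, (j < i)%N ==> (e j == 0%N)] then f (e + U_(i))%MM else 0).

Lemma head_partE f : ordge 1 f -> f = \sum_i seriesX R i * head_part f i.
Proof.
move=> f1; apply: mpseriesP => e; rewrite series_sumE.
under eq_bigr do rewrite seriesX_mulE /=.
have [->|ne0] := eqVneq e 0%MM.
  rewrite f1 ?mdeg0 // big1 // => i _; case: ifP => // /mnm_lepP/(_ i).
  by rewrite mnm1E eqxx mnm0E.
have /existsP[i0 ei0] : [exists i, e i != 0%N].
  apply: contraNT ne0; rewrite negb_exists => /forallP e0; apply/eqP/mnmP => i.
  by rewrite mnm0E; apply/eqP; have := e0 i; rewrite negbK.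
have [i ei imin] := @arg_minnP _ i0 (fun i => e i != 0%N) (fun i : 'I_n => i : nat) ei0.
rewrite (bigD1 i) //= big1 ?addr0 => [|j ne_ji].
  have le_ie : (U_(i) <= e)%MM.
    by apply/mnm_lepP => j; rewrite mnm1E; case: eqP => // <-; rewrite lt0n.
  rewrite le_ie submK // ifT //; apply/forallP => j; apply/implyP => lt_ji.
  have ne_ij : i != j by apply: contraTneq lt_ji => ->; rewrite ltnn.
  rewrite mnmBE mnm1E (negPf ne_ij) subn0.
  by apply: contraTT lt_ji => /imin; rewrite -leqNgt.
case: ifP => // /mnm_lepP/(_ j); rewrite mnm1E eqxx => le1.
case: forallP => // /(_ i) /implyP.
rewrite ltn_neqAle imin -?lt0n // andbT eq_sym => H.
have /eqP := H ne_ji; rewrite mnmBE mnm1E (negPf ne_ji) subn0 => e0.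
by rewrite e0 in ei.
Qed.

Lemma head_part_ordge N f i : ordge N.+1 f -> ordge N (head_part f i).
Proof.
by move=> fN e lt /=; case: ifP => // _; rewrite fN // mdegD mdeg1 addn1.
Qed.

(** Replaces finite generation of the powers of the maximal ideal: a property
    of series of order N that is stable under sums and is raised by one by a
    variable holds for all of them. *)
Lemma ordge_ind (P : nat -> {mpseries R[n]} -> Prop) :
  (forall f, P 0%N f) ->
  (forall N f, P N f -> forall i, P N.+1 (seriesX R i * f)) ->
  (forall N f g, P N f -> P N g -> P N (f + g)) ->
  (forall N, P N 0) ->
  forall N f, ordge N f -> P N f.
Proof.
move=> P0 PX PD P00; elim=> [|N IH] f fN; first exact: P0.
rewrite (head_partE (ordgeW _ fN)) //.
apply: (big_ind (P N.+1)) => [||i _]; [exact: P00|exact: PD|].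
by apply/PX/IH/head_part_ordge.
Qed.

Definition const_coef f : R := f 0%MM.

Fact const_coef_zmod : zmod_morphism const_coef. Proof. by []. Qed.
Fact const_coef_monoid : monoid_morphism const_coef.
Proof.
split=> [|f g]; first by rewrite /const_coef /= mcoeff1 eqxx.
rewrite /const_coef seriesE_mul.
have l0 : (mdeg (0 : 'X_{1..n})%MM < (mdeg (0 : 'X_{1..n})%MM).+1)%N by [].
rewrite (bigD1 (BMultinom l0, BMultinom l0)) /=; last by rewrite addm0.
rewrite big1 ?addr0 // => -[p q] /= /andP[/eqP E /eqP[]].
have : mdeg p == 0%N /\ mdeg q == 0%N.
  have : (mdeg p + mdeg q <= 0)%N by rewrite -mdegD -E mdeg0.
  by move: (mdeg p) (mdeg q); lia.
by rewrite !mdeg_eq0 => -[/eqP ep /eqP eq]; congr (_, _); apply: val_inj.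
Qed.
HB.instance Definition _ := GRing.isZmodMorphism.Build _ _ const_coef const_coef_zmod.
HB.instance Definition _ := GRing.isMonoidMorphism.Build _ _ const_coef const_coef_monoid.

Lemma ordge1P f : ordge 1 f <-> const_coef f = 0.
Proof.
split=> [f1|f0 e]; first by apply: f1; rewrite mdeg0.
by rewrite ltnS leqn0 mdeg_eq0 => /eqP->.
Qed.

(** The sum of all powers of f; in degree e only the powers up to the degree
    of e contribute when f has no constant term, so that each coefficient is a
    finite sum. *)
Definition geom_inv f : {mpseries R[n]} :=
  MPSeries (fun e => (\sum_(i < (mdeg e).+1) f ^+ i) e).

Lemma geom_invE N f : ordge 1 f -> ordge N (geom_inv f - \sum_(i < N) f ^+ i).
Proof.
move=> f1 e lt; rewrite seriesBE /= -(subnKC lt) big_split_ord seriesDE.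
rewrite [X in _ - (_ + X)](_ : _ = 0) ?addr0 ?subrr // series_sumE big1 // => i _.
have H : ordge ((mdeg e).+1 + i) (f ^+ ((mdeg e).+1 + i)).
  elim: (_ + _)%N => [|j IH]; first by move=> ?.
  by rewrite exprS -add1n; apply: ordge_mul.
by apply: H; lia.
Qed.

Lemma geom_invP f : ordge 1 f -> (1 - f) * geom_inv f = 1.
Proof.
move=> f1; apply: mpseriesP => e; apply/eqP; rewrite -subr_eq0 -seriesBE; apply/eqP.
have -> : (1 - f) * geom_inv f - 1
  = (1 - f) * (geom_inv f - \sum_(i < (mdeg e).+1) f ^+ i) - f ^+ (mdeg e).+1.
  have /(canRL (subrK _)) -> := subrX1 f (mdeg e).+1.
  by ring.
rewrite seriesBE (@ordgeM (mdeg e).+1 _ _ (@geom_invE _ _ f1) _ (ltnSn _)) sub0r.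
suff H j : ordge j (f ^+ j) by rewrite (H (mdeg e).+1 e (ltnSn _)) oppr0.
elim: j => [|j IH]; first by move=> ?.
by rewrite exprS -add1n; apply: ordge_mul.
Qed.

End SeriesBasics.

Lemma series_unit (n : nat) (k : fieldType) (f : {mpseries k[n]}) :
  const_coef f != 0 -> exists g, g * f = 1.
Proof.
move=> f0; set c := const_coef f in f0.
have h1 : ordge 1 (1 - c^-1 *: f).
  apply/ordge1P; rewrite rmorphB rmorph1.
  by rewrite [X in _ - X](_ : _ = c^-1 * c) // mulVf // subrr.
exists (c^-1 *: geom_inv (1 - c^-1 *: f)).
have := geom_invP h1; rewrite subKr => H.
by rewrite -scalerAl mulrC scalerAl.
Qed.

(** * The Nullstellensatz for a hypersurface *)

(** Polynomials are generated, as a ring, by constants and variables; this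
    suits statements about ring morphisms better than induction on the
    support. *)
Lemma mpoly_ring_ind (n : nat) (R : nzRingType) (P : {mpoly R[n]} -> Prop) :
  (forall c, P c%:MP) -> (forall i, P 'X_i) ->
  (forall p q, P p -> P q -> P (p + q)) ->
  (forall p q, P p -> P q -> P (p * q)) -> forall p, P p.
Proof.
move=> PC PX PD PM p; rewrite [p]mpolyE.
apply: big_ind => [||e _]; [by rewrite -mpolyC0|exact: PD|].
rewrite -mul_mpolyC; apply: (PM) => //; rewrite mpolyXE_id.
apply: big_ind => [||i _]; [by rewrite -mpolyC1|exact: PM|].
by elim: (e i) => [|j IH]; rewrite ?expr0 -?mpolyC1 // exprS; apply: PM.
Qed.

Lemma mpoly_rmorph_eq (n : nat) (R : comNzRingType) (S : pzRingType)
    (phi psi : {rmorphism {mpoly R[n]} -> S}) :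
  (forall c, phi c%:MP = psi c%:MP) -> (forall i, phi 'X_i = psi 'X_i) ->
  forall p, phi p = psi p.
Proof.
move=> eC eX; apply: mpoly_ring_ind => // p q ep eq; first by rewrite !rmorphD ep eq.
by rewrite !rmorphM ep eq.
Qed.

Section Vanishing.
Variable (k : fieldType).
Hypothesis k_char0 : [pchar k] =i pred0.

Lemma natr_inj_char0 : injective (fun m : nat => m%:R : k).
Proof.
move=> a b /eqP; wlog le_ab : a b / (a <= b)%N => [H|].
  by case/orP: (leq_total a b) => le E; [|symmetry]; apply: H => //; rewrite eq_sym.
move/pcharf0P: k_char0 => ch; rewrite eq_sym -subr_eq0 -natrB // ch subn_eq0.
by move=> le_ba; apply/eqP; rewrite eqn_leq le_ab.
Qed.

Lemma poly_vanish (p : {poly k}) : (forall x, p.[x] = 0) -> p = 0.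
Proof.
move=> p0; apply: (@roots_geq_poly_eq0 _ p [seq i%:R | i <- iota 0 (size p)]).
- by apply/allP => x _; apply/rootP.
- by rewrite map_inj_uniq ?iota_uniq //; apply: natr_inj_char0.
- by rewrite size_map size_iota.
Qed.

Let wid n (i : 'I_n) : 'I_n.+1 := widen_ord (leqnSn n) i.

Lemma meval_muni n (p : {mpoly k[n.+1]}) (v : 'I_n.+1 -> k) :
  p.@[v] = (map_poly (meval (fun i => v (wid i))) (muni p)).[v ord_max].
Proof.
rewrite muniE mevalE rmorph_sum horner_sum; apply: eq_bigr => e _ /=.
rewrite map_polyZ /= map_polyXn hornerZ hornerXn mevalZ mevalX -mulrA.
congr (_ * _); rewrite big_ord_recr /=; congr (_ * _).
by apply: eq_bigr => i _; rewrite mnmE.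
Qed.

Lemma muni_eq0 n (p : {mpoly k[n.+1]}) : muni p = 0 -> p = 0.
Proof.
move=> p0; apply/mpolyP => e; rewrite mcoeff0.
have := congr1 (fun q : {poly {mpoly k[n]}} =>
  (q`_(e ord_max))@_[multinom (e (wid i)) | i < n]) p0.
rewrite coef0 mcoeff0 muniE coef_sum raddf_sum /= => <-.
rewrite {1}[p]mpolyE raddf_sum /=; apply: eq_bigr => a _.
rewrite coefZ coefXn mcoeffZ mcoeffX.
have [->|ne_ae] := eqVneq a e.
  by rewrite eqxx mulr1 mulr1 mcoeffZ mcoeffX eqxx mulr1.
rewrite mulr0; case: eqP => [e_max|_]; last by rewrite mulr0 mcoeff0.
rewrite mulr1 mcoeffZ mcoeffX; case: eqP => [e_wid|]; last by rewrite mulr0.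
case/eqP: ne_ae; apply/mnmP => i; have [lt_in|] := ltnP i n.
  have -> : i = wid (Ordinal lt_in) by apply: val_inj.
  by have /mnmP/(_ (Ordinal lt_in)) := e_wid; rewrite !mnmE.
move=> le_ni; suff -> : i = ord_max by rewrite e_max.
by apply: val_inj => /=; apply/eqP; rewrite eqn_leq le_ni -ltnS ltn_ord.
Qed.

(** Induction on the number of variables: at a fixed point of the first n
    coordinates, the polynomial in the last one has infinitely many roots,
    hence its coefficients vanish there. *)
Lemma mpoly_vanish n (p : {mpoly k[n]}) : (forall v, p.@[v] = 0) -> p = 0.
Proof.
elim: n p => [|n IH] p p0.
  apply/mpolyP => e; have := p0 (fun=> 0); rewrite mcoeff0 mevalE.
  have all0 (a : 'X_{1..0}) : a = e by apply/mnmP => -[].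
  have [/memN_msupp_eq0 //|ein] := boolP (e \notin msupp p).
  rewrite (bigD1_seq e) ?msupp_uniq //=; last by rewrite negbK in ein.
  rewrite [X in _ + X]big1 => [|a]; last by rewrite (all0 a) eqxx.
  by rewrite big1 ?mulr1 ?addr0 // => -[].
apply: muni_eq0; apply/polyP => i; rewrite coef0; apply: IH => v.
pose V x (j : 'I_n.+1) := if unlift ord_max j is Some j' then v j' else x.
have Vmax x : V x ord_max = x by rewrite /V unlift_none.
have Vwid x : (fun j => V x (wid j)) =1 v.
  move=> j; rewrite /V; case: unliftP => [j'|] /(congr1 val) /=.
    by rewrite /bump leqNgt ltn_ord /= => E; congr v; apply: val_inj.
  by move/eqP; rewrite ltn_eqF.
have /poly_vanish q0 x : (map_poly (meval v) (muni p)).[x] = 0.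
  rewrite -(p0 (V x)) meval_muni Vmax; congr (_.[_]); apply/polyP => j.
  by rewrite !coef_map /=; apply/esym/meval_eq.
by rewrite -(coef_map (meval v)) /= q0 coef0.
Qed.

End Vanishing.

Section TopCoef.
Variable A : comNzRingType.
(** The degree is only bounded by a, and c may be zero: this form is stable
    under products without any condition on the coefficients. *)
Definition topcoef (a : nat) (c : A) (q : {poly A}) :=
  (size q <= a.+1)%N /\ q`_a = c.

Lemma topcoef1 : topcoef 0 1 1.
Proof. by rewrite /topcoef size_poly1 coef1. Qed.

Lemma topcoefM a b c d p q :
  topcoef a c p -> topcoef b d q -> topcoef (a + b) (c * d) (p * q).
Proof.
move=> [sp <-] [sq <-]; split.
  by apply: leq_trans (size_polyMleq _ _) _; lia.
rewrite coefM (bigD1 (inord a)) //= inordK ?ltnS ?leq_addr // addKn.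
rewrite big1 ?addr0 // => i ne_ia.
have : (i : nat) != a.
  by apply: contraNneq ne_ia => E; rewrite -val_eqE /= inordK ?E // ltnS leq_addr.
move: (ltn_ord i); rewrite ltnS => le_i ne.
have [lt_ai|le_ia] := ltnP a i.
  by rewrite [p`_i]nth_default ?mul0r // (leq_trans sp).
by rewrite [q`_(_)]nth_default ?mulr0 // (leq_trans sq) //; lia.
Qed.

Lemma topcoefX a c p i : topcoef a c p -> topcoef (a * i) (c ^+ i) (p ^+ i).
Proof.
move=> tp; elim: i => [|i IH]; first by rewrite muln0 !expr0; apply: topcoef1.
by rewrite mulnS !exprS; apply: topcoefM.
Qed.

Lemma topcoef_prod n (h : 'I_n -> {poly A}) (c : 'I_n -> A) (e : 'X_{1..n}) :
  (forall i, topcoef 1 (c i) (h i)) ->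
  topcoef (mdeg e) (\prod_i c i ^+ e i) (mmap1 h e).
Proof.
move=> hc; rewrite mdegE /mmap1.
elim/big_rec3: _ => [|i x y z _ IH]; first exact: topcoef1.
by apply: topcoefM => //; have := topcoefX (e i) (hc i); rewrite mul1n.
Qed.
End TopCoef.

Section HypersurfaceNullstellensatz.
Variable (k : closedFieldType).
Hypothesis k_char0 : [pchar k] =i pred0.

(** A root of p has multiplicity at most the degree of p, so the power of q
    kills every linear factor of p with its multiplicity. *)
Lemma closed_dvdp_exp (p q : {poly k}) :
  p != 0 -> (forall x, root p x -> root q x) -> p %| q ^+ (size p).-1.
Proof.
move=> p0 pq; have [r Ep] := closed_field_poly_normal p.
have sp : (size p).-1 = size r.
  by rewrite Ep size_scale ?lead_coef_eq0 // size_prod_XsubC.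
rewrite sp [X in X %| _]Ep dvdpZl ?lead_coef_eq0 //.
have : {subset r <= root q}.
  move=> x xr; apply/pq; rewrite Ep rootZ ?lead_coef_eq0 // root_prod_XsubC //.
elim: r {Ep sp} => [|x r IH] rq; first by rewrite big_nil dvd1p.
rewrite big_cons exprS dvdp_mul ?IH //.
  by rewrite dvdp_XsubCl; apply: rq; rewrite inE eqxx.
by move=> y yr; apply: rq; rewrite inE yr orbT.
Qed.

Variables (n : nat) (f : {mpoly k[n]}).

Let A := {mpoly k[n]}.
Let D := (msize f).-1.
Let ftop : A := \sum_(e <- msupp f | mdeg e == D) f@_e *: 'X_[e].
Let cst : {rmorphism k -> {poly A}} := (@polyC A) \o (@mpolyC n k).
Let line (p : 'I_n -> k) (i : 'I_n) : {poly A} := ('X_i : A)%:P + ((p i)%:MP : A)%:P * 'X.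
Let sub p : {rmorphism A -> {poly A}} := mmap cst (line p).

Lemma ftop_neq0 : f != 0 -> ftop != 0.
Proof.
move=> f0; apply/eqP => /(congr1 (mcoeff (mlead f))).
rewrite mcoeff0 raddf_sum /= big_mkcond (bigD1_seq (mlead f)) ?msupp_uniq ?mlead_supp //=.
rewrite big1 => [|e ne]; last first.
  by case: ifP => // _; rewrite mcoeffZ mcoeffX (negPf ne) mulr0.
have -> : mdeg (mlead f) == D by rewrite /D -mlead_deg.
rewrite mcoeffZ mcoeffX eqxx mulr1 addr0 => /eqP.
by rewrite mleadc_eq0 (negPf f0).
Qed.

(** On the line x + s p the polynomial f becomes a polynomial in s whose
    coefficient of degree D is the constant value at p of the leading form of
    f. *)
Lemma sub_topcoef p : topcoef D (ftop.@[p])%:MP (sub p f).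
Proof.
have suppD e : e \in msupp f -> (mdeg e <= D)%N.
  by move=> /msize_mdeg_lt; rewrite /D; lia.
have line1 i : topcoef 1 (p i)%:MP (line p i).
  split; last by rewrite coefD coefC coefMX coefC add0r.
  rewrite (leq_trans (size_polyD _ _)) // geq_max.
  rewrite (leq_trans (size_polyC_leq1 _)) //=.
  by rewrite (leq_trans (size_polyMleq _ _)) // size_polyX addn2 /= ltnS size_polyC_leq1.
have terms e : topcoef (mdeg e) (f@_e * \prod_i p i ^+ e i)%:MP
    (cst f@_e * mmap1 (line p) e).
  rewrite -[mdeg e]add0n mpolyCM rmorph_prod /=; apply: topcoefM.
    by split; rewrite ?size_polyC_leq1 // coefC.
  by under eq_bigr do rewrite rmorphXn; apply: topcoef_prod.
split.
  rewrite /= /mmap big_seq; apply: (big_ind (fun q : {poly A} => (size q <= D.+1)%N)) => [|q r sq sr|e /suppD le_eD].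
  - by rewrite size_poly0.
  - by rewrite (leq_trans (size_polyD _ _)) // geq_max sq.
  - by apply: leq_trans (proj1 (terms e)) _.
have -> : ftop.@[p] = \sum_(e <- msupp f | mdeg e == D) f@_e * \prod_i p i ^+ e i.
  by rewrite /ftop (raddf_sum (meval p)); apply: eq_bigr => e _ /=; rewrite mevalZ mevalX.
rewrite /= /mmap coef_sum (raddf_sum (@mpolyC n k)) [RHS]big_mkcond /=.
rewrite big_seq [RHS]big_seq; apply: eq_bigr => e /suppD le_eD; case: eqP => [Ee|ne_eD].
  by rewrite -[in LHS]Ee (proj2 (terms e)).
by rewrite nth_default // (leq_trans (proj1 (terms e))) //; lia.
Qed.

Lemma sub_eval0 p h : (sub p h).[0] = h.
Proof.
pose phi : {rmorphism A -> A} := horner_eval (0 : A) \o sub p.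
rewrite -[(sub p h).[0]]/(phi h).
apply: (@mpoly_rmorph_eq _ _ _ phi idfun) => [c|i] /=.
  by rewrite horner_evalE mmapC /= hornerC.
by rewrite horner_evalE mmapX mmap1U /line !hornerE ?mulr0 ?addr0.
Qed.

Lemma sub_meval p x h s :
  (map_poly (meval x) (sub p h)).[s] = h.@[fun i => x i + p i * s].
Proof.
pose phi : {rmorphism A -> k} :=
  horner_eval s \o map_poly (meval x) \o sub p.
apply: (@mpoly_rmorph_eq _ _ _ phi (meval (fun i => x i + p i * s))) => [c|i] /=.
  by rewrite horner_evalE mmapC /= map_polyC /= hornerC !mevalC.
rewrite horner_evalE mmapX mmap1U /line mevalXU.
by rewrite rmorphD rmorphM /= !map_polyC /= map_polyX !hornerE /= mevalXU mevalC.
Qed.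

(** Choose p at which the leading form of f does not vanish; then, up to a
    nonzero constant, F(s) = f(x + s p) is monic in s over the ring of
    polynomials in x. Divide the D-th power of h(x + s p) by F. At each point
    x the remainder is zero, since every root of F is a root of h(x + s p);
    so its coefficients are polynomials that vanish at every point, and the
    division is exact. Setting s = 0 gives the claim. The same p serves for
    all x, so no change of coordinates is needed. *)
Theorem hypersurface_nullstellensatz (h : {mpoly k[n]}) :
  (forall x, f.@[x] = 0 -> h.@[x] = 0) -> exists N q, h ^+ N = q * f.
Proof.
move=> fh; have [f0|f_neq0] := eqVneq f 0.
  exists 1%N, 0; rewrite mul0r expr1; apply: mpoly_vanish => // x.
  by apply: fh; rewrite f0 meval0.
have [p p0] : exists p, ftop.@[p] != 0.
  have /negP := ftop_neq0 f_neq0; apply: contra_notP => H; apply/eqP.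
  apply: mpoly_vanish => // p; apply: contra_notP H => /eqP H; by exists p.
set c := ftop.@[p] in p0.
pose F : {poly A} := (c^-1)%:MP%:P * sub p f.
have [sF F_D] : topcoef D 1 F.
  have <- : (c^-1)%:MP * c%:MP = 1 :> A by rewrite -mpolyCM mulVf // mpolyC1.
  rewrite -[D]add0n; apply: topcoefM (sub_topcoef p).
  by split; rewrite ?size_polyC_leq1 // coefC.
have size_F : size F = D.+1.
  apply/eqP; rewrite eqn_leq sF /=.
  by apply: contraT; rewrite -leqNgt => /(nth_default 0)/eqP; rewrite F_D oner_eq0.
have F_monic : F \is monic by rewrite monicE /lead_coef size_F /= F_D.
set G := sub p h ^+ D; set Q := Pdiv.Ring.rdivp G F; set S := Pdiv.Ring.rmodp G F.
have EG : G = Q * F + S := Pdiv.RingMonic.rdivp_eq F_monic G.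
have size_S : (size S < D.+1)%N.
  by rewrite -size_F Pdiv.Ring.ltn_rmodpN0 // monic_neq0.
(* The remainder vanishes at every point x, by uniqueness of the division
   by the monic polynomial F at x. *)
have S0 : S = 0.
  apply/polyP => i; rewrite coef0; apply: mpoly_vanish => // x.
  rewrite -(coef_map (meval x)) /=.
  suff -> : map_poly (meval x) S = 0 by rewrite coef0.
  have size_Fx : size (map_poly (meval x) F) = D.+1.
    by rewrite size_map_poly_id0 ?size_F // (monicP F_monic) meval1 oner_eq0.
  have Fx0 : map_poly (meval x) F != 0 by rewrite -size_poly_eq0 size_Fx.
  have : map_poly (meval x) F %| map_poly (meval x) S.
    have := congr1 (map_poly (meval x)) EG.
    rewrite rmorphD rmorphM /= => /(canLR (addKr _)) <-.
    rewrite dvdp_addr ?dvdp_mull //; last by rewrite dvdpNr dvdp_mull.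
    rewrite rmorphXn /= -[D]/(D.+1.-1) -size_Fx; apply: closed_dvdp_exp => // s.
    have eF : (map_poly (meval x) F).[s] = c^-1 * f.@[fun i => x i + p i * s].
      have eC : map_poly (meval x) (c^-1)%:MP%:P = (c^-1)%:P.
        by rewrite map_polyC /= mevalC.
      rewrite -sub_meval (_ : map_poly _ F = (c^-1)%:P * map_poly (meval x) (sub p f)).
        by rewrite hornerM hornerC.
      by rewrite -eC -rmorphM.
    move=> /rootP; rewrite eF => /eqP; rewrite mulf_eq0 invr_eq0 (negPf p0) /=.
    by move=> /eqP/fh h0; apply/rootP; rewrite sub_meval.
  move=> /dvdp_leq; case: eqP => // _ /(_ isT).
  by rewrite size_Fx leqNgt (leq_ltn_trans (size_poly _ _)).
exists D, (Q.[0] * c^-1%:MP).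
have := congr1 (horner_eval 0) EG.
rewrite S0 addr0 rmorphXn rmorphM /= !horner_evalE sub_eval0 => ->.
by rewrite /F hornerM hornerC sub_eval0 mulrA.
Qed.

End HypersurfaceNullstellensatz.

(** * Jets of power series and their specialisations *)

Section EqModX.
Variable S : comNzRingType.
Implicit Types p q : {poly S}.

(** Congruence of polynomials in the arc parameter t modulo a power of t. *)
Definition eqmodX (N : nat) p q := forall j, (j < N)%N -> p`_j = q`_j.

Lemma eqmodX_trans N q p r : eqmodX N p q -> eqmodX N q r -> eqmodX N p r.
Proof. by move=> E F j lt; rewrite E ?F. Qed.
Lemma eqmodXD N p q p' q' : eqmodX N p p' -> eqmodX N q q' ->
  eqmodX N (p + q) (p' + q').
Proof. by move=> E F j lt; rewrite !coefD E ?F. Qed.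
Lemma eqmodXM N p q p' q' : eqmodX N p p' -> eqmodX N q q' ->
  eqmodX N (p * q) (p' * q').
Proof.
move=> E F j lt; rewrite !coefM; apply: eq_bigr => i _.
by rewrite E ?F //; have := ltn_ord i; lia.
Qed.
Lemma eqmodX_mmap (n : nat) (R : comNzRingType) (c : {rmorphism R -> {poly S}})
    (h h' : 'I_n -> {poly S}) N :
  (forall i, eqmodX N (h i) (h' i)) -> forall p : {mpoly R[n]}, eqmodX N (mmap c h p) (mmap c h' p).
Proof.
move=> E; apply: mpoly_ring_ind => [a|i|p q Ep Eq|p q Ep Eq].
- by rewrite !mmapC.
- by rewrite !mmapX !mmap1U.
- by rewrite !rmorphD; apply: eqmodXD.
- by rewrite !rmorphM; apply: eqmodXM.
Qed.
End EqModX.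

Section JetSeries.
Variables (n : nat) (R : comNzRingType) (m : nat).
Implicit Types (g h : {mpseries R[n]}).
Local Notation J := (jet_ring n R m).

Definition jet_poly g : {poly J} := mmap (@jet_const n R m) (@Defs.arc n R m) (series_trunc m.+1 g).

Lemma jet_polyD g h : jet_poly (g + h) = jet_poly g + jet_poly h.
Proof.
rewrite /jet_poly -rmorphD; congr mmap; apply/mpolyP => a.
by rewrite mcoeffD !mcoeff_trunc; case: ifP; rewrite ?addr0.
Qed.

Lemma jet_polyM g h : eqmodX m.+1 (jet_poly (g * h)) (jet_poly g * jet_poly h).
Proof. by move=> j lt; rewrite coefM; apply: jet_coefM. Qed.

Lemma jet_poly_mpoly (p : {mpoly R[n]}) :
  eqmodX m.+1 (jet_poly (series_of_mpoly p)) (mmap (@jet_const n R m) (@Defs.arc n R m) p).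
Proof.
move=> j lt; apply: mmap_arc_local => a le_aj.
by rewrite mcoeff_trunc ifT // (leq_ltn_trans le_aj).
Qed.

Lemma arc_coef0 (i : 'I_n) : (Defs.arc R m i)`_0 = 0.
Proof. by have [q ->] := arc_dvd R m i; rewrite coefMX. Qed.

Lemma arc_coefS (i : 'I_n) (l : 'I_m) : (Defs.arc R m i)`_l.+1 = 'X_(mxvec_index i l).
Proof.
rewrite /arc coef_sum (bigD1 l) //= coefMXn ltnn subnn coefC eqxx big1 ?addr0 //.
move=> j ne_jl; rewrite coefCM coefXn eqSS (_ : (l == j :> nat) = false) ?mulr0 //.
by apply/negbTE; rewrite eq_sym.
Qed.

Lemma jet_poly_ordge g : ordge m.+1 g -> jet_poly g = 0.
Proof.
move=> gm; rewrite /jet_poly; suff -> : series_trunc m.+1 g = 0 by rewrite rmorph0.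
by apply/mpolyP => a; rewrite mcoeff_trunc mcoeff0; case: ifP => // /gm.
Qed.

Lemma jsc_ordge (I : ideal {mpseries R[n]}) g : ordge m.+1 g -> jsc m I g.
Proof.
by move=> gm j _; exists 1%N; rewrite /jet_coef -/(jet_poly g) jet_poly_ordge //
  coef0 expr1; apply: gen_set0.
Qed.

Lemma jsc_sub (I : ideal {mpseries R[n]}) g : I g -> jsc m I g.
Proof.
move=> Ig j le_jm; exists 1%N; rewrite expr1; exists [:: (1, jet_coef m j g)].
  by move=> p; rewrite inE => /eqP -> /=; exists j, g.
by rewrite big_seq1 mul1r.
Qed.

Variables (S : comNzRingType) (c : {rmorphism R -> S}) (G : 'I_n -> {poly S}).

(** A family of arcs G with coefficients in S is the same as an S-valued point
    of the space of jets; the variable of index (i, l) goes to the coefficient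
    of t^(l+1) of the i-th arc. *)
Definition jet_spec : {rmorphism J -> S} :=
  mmap c (fun s => mxvec (\matrix_(i < n, l < m) (G i)`_l.+1) 0 s).

Let cP : {rmorphism R -> {poly S}} := @polyC S \o c.

Hypothesis G0 : forall i, (G i)`_0 = 0.

Lemma jet_spec_arc i : eqmodX m.+1 (map_poly jet_spec (Defs.arc R m i)) (G i).
Proof.
move=> [_|j]; rewrite coef_map /= ?arc_coef0 ?rmorph0 ?G0 //.
rewrite ltnS => lt_jm; rewrite -[j]/(val (Ordinal lt_jm)) arc_coefS /=.
by rewrite mmapX mmap1U mxvecE mxE.
Qed.

(** Specialising the universal arc and then evaluating a polynomial amounts to
    evaluating it on the given arcs, modulo t^(m+1). *)
Lemma jet_spec_mmap p : eqmodX m.+1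
  (map_poly jet_spec (mmap (@jet_const n R m) (@Defs.arc n R m) p)) (mmap cP G p).
Proof.
pose phi : {rmorphism {mpoly R[n]} -> {poly S}} :=
  map_poly jet_spec \o mmap (@jet_const n R m) (@Defs.arc n R m).
rewrite -[map_poly _ _]/(phi p).
have -> : phi p = mmap cP (fun i => map_poly jet_spec (Defs.arc R m i)) p.
  apply: mpoly_rmorph_eq => [a|i] /=; first by rewrite !mmapC /= map_polyC /= mmapC.
  by rewrite !mmapX !mmap1U.
exact/eqmodX_mmap/jet_spec_arc.
Qed.

Lemma jet_spec_coef j g : (j <= m)%N ->
  jet_spec (jet_coef m j g) = (mmap cP G (series_trunc m.+1 g))`_j.
Proof.
by move=> le_jm; rewrite -jet_spec_mmap // coef_map.
Qed.

End JetSeries.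

(** * Arcs along a system of weights *)

Section WeightedComponents.
Variables (n : nat) (k : idomainType) (w : 'I_n -> nat).

Definition wdeg (e : 'X_{1..n}) : nat := \sum_i e i * w i.

Definition wcomp j (p : {mpoly k[n]}) : {mpoly k[n]} :=
  \sum_(e <- msupp p | wdeg e == j) p@_e *: 'X_[e].

Lemma mcoeff_wcomp j p e : (wcomp j p)@_e = if wdeg e == j then p@_e else 0.
Proof.
rewrite /wcomp raddf_sum /= big_mkcond /=.
have [ein|/[dup] enin /memN_msupp_eq0 ->] := boolP (e \in msupp p).
  rewrite (bigD1_seq e) ?msupp_uniq //= big1 ?addr0 => [|a ne].
    by rewrite mcoeffZ mcoeffX eqxx mulr1.
  by case: ifP => // _; rewrite mcoeffZ mcoeffX (negPf ne) mulr0.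
rewrite if_same big_seq big1 // => a ain; case: ifP => // _.
rewrite mcoeffZ mcoeffX; case: eqP => [Ea|]; last by rewrite mulr0.
by rewrite Ea (negPf enin) in ain.
Qed.

(** The arc x_i t^(w_i), along which the coefficient of t^j of a polynomial is
    the value at x of its component of weight j. *)
Definition warc (x : 'I_n -> k) (i : 'I_n) : {poly k} := (x i)%:P * 'X^(w i).

Let cP : {rmorphism k -> {poly k}} := @polyC k \o idfun.

Lemma mmap_warc p x j : (mmap cP (warc x) p)`_j = (wcomp j p).@[x].
Proof.
have term e : (cP p@_e * mmap1 (warc x) e)`_j =
    if wdeg e == j then p@_e * \prod_i x i ^+ e i else 0.
  have -> : mmap1 (warc x) e = (\prod_i x i ^+ e i)%:P * 'X^(wdeg e).
    rewrite rmorph_prod /= /wdeg expr_sum -big_split /=; apply: eq_bigr => i _.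
    by rewrite /warc exprMn -exprM mulnC rmorphXn.
  rewrite /= mulrA -polyCM coefCM coefXn eq_sym.
  by case: eqP; rewrite ?mulr1 ?mulr0.
rewrite /mmap coef_sum (eq_bigr _ (fun e _ => term e)) -big_mkcond /=.
rewrite /wcomp (raddf_sum (meval x)); apply: eq_bigr => e _ /=.
by rewrite mevalZ mevalX.
Qed.

Hypothesis w_gt0 : forall i, (0 < w i)%N.

Lemma mdeg_le_wdeg e : (mdeg e <= wdeg e)%N.
Proof. by rewrite mdegE; apply: leq_sum => i _; rewrite -{1}[e i]muln1 leq_mul2l w_gt0 orbT. Qed.

(** The arc x_i t^(w_i) is an m-jet of f when the components of f of weight at
    most m vanish at x; an element of the radical of the jet ideal is zero at
    every such point of the jet space. *)
Lemma jsc_principal_arc m (f : {mpoly k[n]}) (g : {mpseries k[n]}) x :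
  (forall j, (j <= m)%N -> (wcomp j f).@[x] = 0) ->
  jsc m (principal (series_of_mpoly f)) g ->
  forall j, (j <= m)%N -> (wcomp j (series_trunc m.+1 g)).@[x] = 0.
Proof.
move=> fx gf j le_jm.
have G0 i : (warc x i)`_0 = 0.
  by rewrite /warc coefCM coefXn eq_sym eqn0Ngt w_gt0 mulr0.
have [th thE] : exists th : {rmorphism jet_ring n k m -> k}, forall i h, (i <= m)%N ->
    th (jet_coef m i h) = (wcomp i (series_trunc m.+1 h)).@[x].
  exists (jet_spec m idfun (warc x)) => i h le_im.
  by rewrite (jet_spec_coef _ G0) // mmap_warc.
rewrite -thE //; have [r] := gf j le_jm; case=> s sP Es.
suff : th (jet_coef m j g) ^+ r = 0 by move/eqP; rewrite expf_eq0 => /andP[_ /eqP].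
rewrite -rmorphXn Es rmorph_sum big1_seq //= => p /sP [i [h [le_im [t tP ->] ->]]].
rewrite rmorphM /=; suff -> : th (jet_coef m i (\sum_(p <- t) p.1 * p.2)) = 0 by rewrite mulr0.
elim: t tP => [|q t IH] tP; first by rewrite big_nil jet_coef0 rmorph0.
rewrite big_cons jet_coefD (rmorphD th) [X in _ + X]IH ?addr0; last first.
  by move=> z zt; apply: tP; rewrite inE zt orbT.
have -> : q.2 = series_of_mpoly f by apply: tP; rewrite inE eqxx.
rewrite jet_coefM // rmorph_sum big1 // => l _; rewrite rmorphM.
set i' := (i - l)%N; have le_i' : (i' <= m)%N by rewrite /i'; lia.
rewrite /= !thE //; last by rewrite (leq_trans _ le_im) // -ltnS.
suff -> : (wcomp i' (series_trunc m.+1 (series_of_mpoly f))).@[x] = (wcomp i' f).@[x].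
  by rewrite fx ?mulr0.
congr meval; apply/mpolyP => e; rewrite !mcoeff_wcomp mcoeff_trunc.
case: eqP => // Ee; rewrite ifT //.
by have := mdeg_le_wdeg e; rewrite Ee; lia.
Qed.

End WeightedComponents.

Section WeightedArcs.
Variables (n : nat) (k : fieldType).
Hypothesis k_char0 : [pchar k] =i pred0.
Variables (w : 'I_n -> nat).
Hypothesis w_gt0 : forall i, (0 < w i)%N.
Variables (m : nat) (f : {mpoly k[n]}) (g : {mpseries k[n]}).
Hypothesis gf : jsc m (principal (series_of_mpoly f)) g.

(** When all monomials of f have weight above m, every arc x_i t^(w_i) is a
    jet of f, so the components of g of weight at most m vanish at every point
    and are zero. *)
Lemma jsc_coef_eq0 : {in msupp f, forall e, (m < wdeg w e)%N} ->
  forall e, (wdeg w e <= m)%N -> g e = 0.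
Proof.
move=> fm e le_em.
have : wcomp w (wdeg w e) (series_trunc m.+1 g) = 0.
  apply: mpoly_vanish => // x; apply: (jsc_principal_arc w_gt0 _ gf) => // j le_jm.
  rewrite (_ : wcomp w j f = 0) ?meval0 //; apply/mpolyP => a.
  rewrite mcoeff_wcomp mcoeff0; case: eqP => // Ea.
  by apply/memN_msupp_eq0/negP => /fm; rewrite Ea; lia.
move/(congr1 (mcoeff e)); rewrite mcoeff_wcomp eqxx mcoeff0 mcoeff_trunc ifT //.
by have := mdeg_le_wdeg w_gt0 e; lia.
Qed.

Lemma jsc_weighted_homog_vanish d x j : weighted_homog w d f -> f.@[x] = 0 ->
  (j <= m)%N -> (wcomp w j (series_trunc m.+1 g)).@[x] = 0.
Proof.
move=> fd fx; apply: (jsc_principal_arc w_gt0 _ gf) => i le_im.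
have [->|ne_id] := eqVneq i d.
  suff -> : wcomp w d f = f by [].
  apply/mpolyP => e; rewrite mcoeff_wcomp; case: eqP => // ne.
  by apply/esym/memN_msupp_eq0/negP => /fd.
suff -> : wcomp w i f = 0 by rewrite meval0.
apply/mpolyP => e; rewrite mcoeff_wcomp mcoeff0; case: eqP => // Ee.
by apply/memN_msupp_eq0/negP => /fd E; case/eqP: ne_id; rewrite -Ee -E.
Qed.

End WeightedArcs.

Section WeightedNullstellensatz.
Variables (n : nat) (k : closedFieldType).
Hypothesis k_char0 : [pchar k] =i pred0.
Variables (w : 'I_n -> nat).
Hypothesis w_gt0 : forall i, (0 < w i)%N.

Lemma principalP (A : comNzRingType) (a x : A) :
  principal a x <-> exists q, x = q * a.
Proof.
split=> [[s sP ->]|[q ->]]; last first.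
  by exists [:: (q, a)]; rewrite ?big_seq1 // => p; rewrite inE => /eqP->.
exists (\sum_(p <- s) p.1); rewrite mulr_suml !big_seq; apply: eq_bigr => p /sP.
by move=> ->.
Qed.

(** The component of g of weight j vanishes on the zero set of f for each j <= m,
    so f divides a power of it, and by reducedness the component itself. The
    hypothesis on radicals is stated so as to cover both a ring of polynomials
    and one of power series as the place where f is reduced. *)
Lemma jsc_weighted_homog_sub m d (f : {mpoly k[n]}) (g : {mpseries k[n]}) :
  weighted_homog w d f ->
  (forall h N q, h ^+ N = q * f ->
      principal (series_of_mpoly f) (series_of_mpoly h)) ->
  jsc m (principal (series_of_mpoly f)) g ->
  exists q, forall e, (wdeg w e <= m)%N -> (g - q * series_of_mpoly f) e = 0.
Proof.
move=> fd fred gf; pose gj j := wcomp w j (series_trunc m.+1 g).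
have ex (j : 'I_m.+1) :
    exists q, series_of_mpoly (gj j) = q * series_of_mpoly f.
  apply/principalP.
  have [|N [q E]] := @hypersurface_nullstellensatz k k_char0 n f (gj j).
    move=> x fx; apply: (jsc_weighted_homog_vanish w_gt0 gf fd fx).
    by rewrite -ltnS ltn_ord.
  exact: fred E.
have [q Eq] := choice ex; exists (\sum_j q j) => e le_em.
rewrite mulr_suml; under eq_bigr do rewrite -Eq.
rewrite -raddf_sum seriesBE /= raddf_sum /=.
rewrite (bigD1 (Ordinal (le_em : (wdeg w e < m.+1)%N))) //= big1 ?addr0.
  rewrite mcoeff_wcomp eqxx mcoeff_trunc ifT ?subrr //.
  by have := mdeg_le_wdeg w_gt0 e; lia.
move=> j ne_j; rewrite mcoeff_wcomp; case: eqP => // E.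
by case/eqP: ne_j; apply: val_inj.
Qed.

End WeightedNullstellensatz.

(** * Prime ideals and orders modulo a prime *)

Section Krull.
Variable A : comNzRingType.

Lemma gen_sub (S : set A) x : S x -> gen S x.
Proof.
by move=> Sx; exists [:: (1, x)]; rewrite ?big_seq1 ?mul1r // => p; rewrite inE => /eqP->.
Qed.

Lemma gen_min (S : set A) (I : ideal A) : S `<=` ideal_set I -> ideal_set (gen S) `<=` ideal_set I.
Proof.
move=> SI x [s sS ->]; rewrite big_seq; apply: ideal_sum => p /sS /SI.
exact: idealM.
Qed.

Definition prime_ideal (P : ideal A) : Prop :=
  ~ P 1 /\ forall a b, P (a * b) -> P a \/ P b.

Lemma prime_idealX (P : ideal A) a N : prime_ideal P -> P (a ^+ N) -> P a.
Proof.
move=> [P1 PM]; elim: N => [/P1//|N IH]; rewrite exprS => /PM[//|/IH//].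
Qed.

(** Krull: a family of elements maximal among those which, together with I, do
    not generate any power of h, generates with I a prime ideal; it exists by
    Zorn's lemma. *)
Lemma radical_prime (I : ideal A) h :
  (forall P : ideal A, prime_ideal P -> ideal_set I `<=` ideal_set P -> P h) ->
  radical I h.
Proof.
apply: contraPP => /= Ih Hh.
pose avoid (S : set A) := forall r, ~ gen (ideal_set I `|` S) (h ^+ r).
have [|M [Mav Mmax]] := @Zorn_bigcup A avoid.
  move=> F Fav Ftot r [s sF Es].
  have [X FX sX] : exists2 X, X = set0 \/ F X &
      forall p, p \in s -> (ideal_set I `|` X) p.2.
    elim: s sF {Es} => [|p s IH] sF; first by exists set0; [left|].
    have [|X FX sX] := IH; first by move=> q qs; apply: sF; rewrite inE qs orbT.
    have [Ip|[Y FY Yp]] := sF p (mem_head _ _).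
      by exists X => // q; rewrite inE => /orP[/eqP ->|/sX //]; left.
    case: FX => [X0|FX].
      exists Y; [by right|move=> q; rewrite inE => /orP[/eqP ->|/sX]; first by right].
      by rewrite X0 => -[]; [left|].
    have [XY|YX] := Ftot _ _ FX FY.
      exists Y; [by right|move=> q; rewrite inE => /orP[/eqP ->|/sX]; first by right].
      by case; [left|right; apply: XY].
    exists X; [by right|move=> q; rewrite inE => /orP[/eqP ->|/sX //]].
    by right; apply: YX.
  have gX : gen (ideal_set I `|` X) (h ^+ r) by exists s.
  case: FX => [X0|/Fav/(_ r)//]; apply: Ih; exists r.
  by apply: gen_min gX => x; rewrite X0 => -[].
pose P := gen (ideal_set I `|` M).
(* By maximality, adding an element outside P produces a power of h. *)
have add_elt a : ~ P a -> exists r p x, P p /\ h ^+ r = p + x * a.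
  move=> Pa; have /Mmax : M `<` (M `|` [set a]).
    split; first by move=> x; left.
    by move=> /(_ a (or_intror erefl)) Ma; apply/Pa/gen_sub; right.
  move=> /existsNP[r /contrapT [s sS Er]]; exists r; rewrite Er.
  elim: s sS {Er} => [|p s IH] sS.
    by exists 0, 0; split; [exact: ideal0|rewrite big_nil mul0r addr0].
  have [|q [x [Pq E]]] := IH; first by move=> z zs; apply: sS; rewrite inE zs orbT.
  rewrite big_cons E; have [Ip|[Mp|->]] := sS p (mem_head _ _).
  - exists (p.1 * p.2 + q), x; rewrite addrA; split=> //; apply: idealD => //.
    by apply: idealM; apply: gen_sub; left.
  - exists (p.1 * p.2 + q), x; rewrite addrA; split=> //; apply: idealD => //.
    by apply: idealM; apply: gen_sub; right.
  - by exists q, (p.1 + x); split=> //; ring.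
have Ppr : prime_ideal P.
  split=> [P1|a b Pab]; first by apply: (Mav 0%N); rewrite expr0.
  apply: contrapT => /not_orP[/add_elt[r [p [x [Pp Er]]]] /add_elt[s [q [y [Pq Es]]]]].
  apply: (Mav (r + s)%N); rewrite exprD Er Es.
  have -> : (p + x * a) * (q + y * b) = (q + y * b) * p + (x * a * q + x * y * (a * b)) by ring.
  by apply: (idealD (i := P)); [exact: idealM|apply: (idealD (i := P)); exact: idealM].
have /Hh : ideal_set I `<=` ideal_set P by move=> x Ix; apply: gen_sub; left.
by move=> /(_ Ppr) Ph; apply: (Mav 1%N); rewrite expr1.
Qed.

Variable P : ideal A.

(** Modulo P, the polynomial p has order at least u and coefficient a at t^u;
    for P prime and a outside P this says that the order is u, without forming
    the quotient ring. *)
Definition lowcoef (u : nat) (a : A) (p : {poly A}) : Prop :=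
  (forall j, (j < u)%N -> P p`_j) /\ P (p`_u - a).

Lemma lowcoef1 : lowcoef 0 1 1.
Proof. by split=> //; rewrite coef1 subrr; apply: ideal0. Qed.

Lemma ideal_trans x y : P x -> P (y - x) -> P y.
Proof. by move=> Px Pyx; rewrite -[y](subrK x); apply: idealD. Qed.

Lemma lowcoefM u a v b p q :
  lowcoef u a p -> lowcoef v b q -> lowcoef (u + v) (a * b) (p * q).
Proof.
move=> [pu pa] [qv qb]; split=> [j lt_j|].
  rewrite coefM; apply: ideal_sum => i _; have [lt_iu|le_ui] := ltnP i u.
    by rewrite mulrC; apply: idealM; apply: pu.
  by apply/idealM/qv; have := ltn_ord i; lia.
rewrite coefM (bigD1 (inord u)) //= inordK ?ltnS ?leq_addr // addKn addrAC.
apply: idealD.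
  have -> : p`_u * q`_v - a * b = q`_v * (p`_u - a) + a * (q`_v - b) by ring.
  by apply: idealD; apply: idealM.
apply: ideal_sum => i ne_iu.
have ne : (i : nat) != u.
  by apply: contraNneq ne_iu => E; rewrite -val_eqE /= inordK ?E // ltnS leq_addr.
have [lt_iu|le_ui] := ltnP i u; first by rewrite mulrC; apply: idealM; apply: pu.
by apply/idealM/qv; have := ltn_ord i; lia.
Qed.

Lemma lowcoefX u a p N : lowcoef u a p -> lowcoef (u * N) (a ^+ N) (p ^+ N).
Proof.
move=> lp; elim: N => [|N IH]; first by rewrite muln0 !expr0; apply: lowcoef1.
by rewrite mulnS !exprS; apply: lowcoefM.
Qed.
End Krull.

Lemma wdeg2 (w : 'I_2 -> nat) (e : 'X_{1..2}) :
  wdeg w e = (e ord0 * w ord0 + e ord_max * w ord_max)%N.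
Proof.
rewrite /wdeg !big_ord_recl big_ord0 addn0; congr (_ * _ + _ * _)%N;
  by congr (_ _); apply: val_inj.
Qed.

Lemma mmap1_2 (S : comNzRingType) (h : 'I_2 -> S) (e : 'X_{1..2}) :
  mmap1 h e = h ord0 ^+ e ord0 * h ord_max ^+ e ord_max.
Proof.
rewrite /mmap1 !big_ord_recl big_ord0 mulr1.
by congr (_ ^+ _ * _ ^+ _); congr (_ _); apply: val_inj.
Qed.

Lemma mnm2_eq (e e' : 'X_{1..2}) : e ord0 = e' ord0 -> e ord_max = e' ord_max -> e = e'.
Proof.
move=> E0 E1; apply/mnmP => i; case: (unliftP ord_max i) => [j|] -> //.
by rewrite (ord1 j) (_ : lift ord_max 0 = ord0) //; apply: val_inj.
Qed.

(** Two distinct exponents on which the weights (a, b) agree span a line;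
    weights (u, v) that also agree on them are proportional to (a, b), and an
    integral multiple because a and b are coprime. *)
Lemma coprime_parallel a b u v (i j i' j' : nat) :
  (0 < a)%N -> (0 < b)%N -> (0 < u)%N -> gcdn a b = 1%N ->
  (i != i') || (j != j') ->
  (a * i + b * j = a * i' + b * j')%N -> (u * i + v * j = u * i' + v * j')%N ->
  exists2 c, (0 < c)%N & u = (c * a)%N /\ v = (c * b)%N.
Proof.
move=> a0 b0 u0 gab ne Eab Euv.
have E : (u * b = v * a)%N.
  have key x y : (0 < y -> a * x = b * y -> u * x = v * y -> u * b = v * a)%N.
    move=> y0 E1 E2; apply/eqP; rewrite -(eqn_pmul2r y0); apply/eqP.
    by rewrite -mulnA -E1 mulnCA E2; ring.
  case: (ltngtP j j') => Hj.
  - by apply: (key (i - i')%N (j' - j)%N); rewrite ?subn_gt0 // !mulnBr; nia.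
  - by apply: (key (i' - i)%N (j - j')%N); rewrite ?subn_gt0 // !mulnBr; nia.
  - by move: ne Eab; rewrite Hj eqxx orbF => ne Eab; nia.
have /dvdnP[c Ec] : (a %| u)%N.
  by rewrite -(Gauss_dvdl u (_ : coprime a b)) ?/coprime ?gab // E dvdn_mull.
exists c; first by move: u0; rewrite Ec muln_gt0 => /andP[].
by split=> //; apply/eqP; rewrite -(eqn_pmul2r a0) -E Ec; apply/eqP; ring.
Qed.

(** * Closures of weighted homogeneous hypersurfaces *)

Section HomogeneousCase.
Variables (n : nat) (k : closedFieldType).
Hypothesis k_char0 : [pchar k] =i pred0.

Lemma ordge_ideal_pow N (g : {mpseries k[n]}) :
  ordge N g -> ideal_pow (maximal_ideal n k) N g.
Proof.
move: N g; apply: (@ordge_ind n k (fun N g => ideal_pow (maximal_ideal n k) N g)).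
- move=> f; rewrite -[f]mulr1; apply: idealM; apply: gen_sub.
  by exists (fun=> 0); [case|rewrite big_ord0].
- move=> N f; elim=> s sP -> i; rewrite mulr_sumr big_seq; apply: ideal_sum => p /sP.
  case=> a aM Ep; rewrite Ep mulrCA; apply: idealM; apply: gen_sub.
  exists (fun j : 'I_N.+1 => if unlift ord0 j is Some j' then a j' else seriesX k i).
    by move=> j; case: unlift => [j'|] //; apply: gen_sub; exists i.
  rewrite big_ord_recl unlift_none; congr (_ * _).
  by apply: eq_bigr => j _; rewrite liftK.
- by move=> N f g; apply: idealD.
- by move=> N; apply: ideal0.
Qed.

Lemma ideal_pow_ordge N (g : {mpseries k[n]}) :
  ideal_pow (maximal_ideal n k) N g -> ordge N g.
Proof.
move: g; apply: (@gen_min _ _ (order_ideal n k N)) => _ [a aM ->] /=.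
have -> : \prod_i a i = \prod_(i <- enum 'I_N) a i by rewrite big_enum.
rewrite -[N in ordge N](size_enum_ord N); apply: series_prod_ordge => i.
have := aM i; move: (a i).
apply: (@gen_min _ _ (order_ideal n k 1)) => _ [j _ <-].
exact: ordge_seriesX.
Qed.

(** With all weights equal to 1 the weight of a monomial is its degree, and
    the terms of weight above m are those of the (m+1)-st power of the maximal
    ideal. *)
Lemma jsc_homogeneous (d : nat) (f : {mpoly k[n]}) (m : nat) (g : {mpseries k[n]}) :
  f \is d.-homog -> reduced f ->
  jsc m (principal (series_of_mpoly f)) g
  <-> ideal_add (principal (series_of_mpoly f)) (ideal_pow (maximal_ideal n k) m.+1) g.
Proof.
move=> fd fred; pose w (i : 'I_n) := 1%N.
have wE e : wdeg w e = mdeg e.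
  by rewrite mdegE; apply: eq_bigr => i _; rewrite muln1.
have wf : weighted_homog w d f by move=> e /(dhomogP _ _ _ fd) <-; apply: wE.
split=> [gf|].
  have [//|h N q E|q Eq] := jsc_weighted_homog_sub k_char0 (w := w) _ wf _ gf.
    have /fred/principalP[r ->] : radical (principal f) h.
      by exists N; apply/principalP; exists q.
    by rewrite rmorphM; apply/principalP; exists (series_of_mpoly r).
  rewrite -[g](subrK (q * series_of_mpoly f)); apply: idealD; apply: gen_sub.
    by right; apply: ordge_ideal_pow => e lt; apply: Eq; rewrite wE.
  by left; apply/principalP; exists q.
move: g; apply: gen_min => h [fh|/ideal_pow_ordge hm]; first exact: jsc_sub.
exact: jsc_ordge.
Qed.

Lemma ideal_trunc (I : ideal {mpseries k[n]}) M (h : {mpseries k[n]}) :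
  (forall g : {mpseries k[n]}, ordge M g -> I g) ->
  (forall e, (mdeg e < M)%N -> h e != 0 -> I (series_of_mpoly 'X_[e])) -> I h.
Proof.
move=> IM Ih; rewrite -[h](subrK (series_of_mpoly (series_trunc M h))).
apply: idealD; first exact/IM/ordge_trunc.
rewrite /series_trunc raddf_sum; apply: ideal_sum => e _ /=.
have [->|he] := eqVneq (h e) 0; first by rewrite scale0r raddf0; apply: ideal0.
rewrite -mul_mpolyC rmorphM; apply: idealM; apply: Ih => //; exact: bmdeg.
Qed.

End HomogeneousCase.

Section PlaneMonomials.
Variable (k : closedFieldType).
Hypothesis k_char0 : [pchar k] =i pred0.

Definition mon2 (p q : nat) : 'X_{1..2} := (U_(ord0) *+ p + U_(ord_max) *+ q)%MM.
Lemma mon2_0 p q : mon2 p q ord0 = p.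
Proof. by rewrite /mon2 mnmDE !mulmnE !mnm1E /= mul1n mul0n addn0. Qed.
Lemma mon2_1 p q : mon2 p q ord_max = q.
Proof. by rewrite /mon2 mnmDE !mulmnE !mnm1E /= mul1n mul0n. Qed.
Lemma mon2K (e : 'X_{1..2}) : mon2 (e ord0) (e ord_max) = e.
Proof. by apply: mnm2_eq; rewrite (mon2_0, mon2_1). Qed.

Lemma monomialE p q :
  varx k ^+ p * vary k ^+ q = series_of_mpoly 'X_[mon2 p q].
Proof. by rewrite /varx /vary /seriesX -!rmorphXn -rmorphM /= /mon2 mpolyXD !mpolyXn. Qed.

(** A monomial of degree 2 N has one of its two exponents at least N. *)
Lemma plane_ideal_ordge (I : ideal {mpseries k[2]}) N :
  I (varx k ^+ N) -> I (vary k ^+ N) ->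
  forall h : {mpseries k[2]}, ordge (N + N) h -> I h.
Proof.
move=> Ix Iy h hN.
suff H : forall p q, (N + N <= p + q + (N + N))%N -> I (varx k ^+ p * vary k ^+ q * h).
  by have := H 0%N 0%N; rewrite !expr0 !mul1r; apply.
apply: (@ordge_ind 2 k (fun t h => forall p q, (N + N <= p + q + t)%N ->
    I (varx k ^+ p * vary k ^+ q * h)) _ _ _ _ (N + N)%N h hN).
- move=> f p q; rewrite addn0 mulrC => le; apply: idealM.
  have [le_Np|lt_pN] := leqP N p.
    by rewrite -(subnK le_Np) exprD -mulrA mulrCA [_ * (_ * _)]mulrC -mulrA mulrC -mulrA;
      apply: idealM; rewrite mulrC; apply: idealM.
  have le_Nq : (N <= q)%N by lia.
  by rewrite -(subnK le_Nq) exprD mulrA; apply: idealM.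
- move=> t f IH i p q le; have [j|] := unliftP ord_max i => [|] ->.
    rewrite (ord1 j) (_ : lift ord_max 0 = ord0); last exact: val_inj.
    have -> : varx k ^+ p * vary k ^+ q * (seriesX k ord0 * f)
            = varx k ^+ p.+1 * vary k ^+ q * f by rewrite exprS /varx; ring.
    by apply: IH; lia.
  have -> : varx k ^+ p * vary k ^+ q * (seriesX k ord_max * f)
          = varx k ^+ p * vary k ^+ q.+1 * f by rewrite exprS /vary; ring.
  by apply: IH; lia.
- by move=> t f g If Ig p q le; rewrite mulrDr; apply: idealD; auto.
- by move=> t p q _; rewrite mulr0; apply: ideal0.
Qed.

(** Membership in an ideal that contains powers of both variables is a finite
    matter; this turns conditions on the coefficients of a power series into a
    finite combination of generators. *)
Lemma plane_ideal_mem (I : ideal {mpseries k[2]}) N (h : {mpseries k[2]}) :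
  I (varx k ^+ N) -> I (vary k ^+ N) ->
  (forall p q, h (mon2 p q) != 0 -> I (varx k ^+ p * vary k ^+ q)) -> I h.
Proof.
move=> Ix Iy Ih; apply: (@ideal_trunc _ _ I (N + N)%N).
  by move=> g; apply: plane_ideal_ordge.
by move=> e _; rewrite -[e]mon2K -monomialE; apply: Ih.
Qed.

Lemma wdeg_weights2 a b e :
  wdeg (weights2 a b) e = (e ord0 * a + e ord_max * b)%N.
Proof. by rewrite wdeg2. Qed.

Lemma weights2_gt0 a b : (0 < a)%N -> (0 < b)%N -> forall i, (0 < weights2 a b i)%N.
Proof.
by move=> a0 b0 i; case: (unliftP ord_max i) => [j|] -> //; rewrite (ord1 j).
Qed.

Lemma jsc_order_pairs m (f : {mpoly k[2]}) (g : {mpseries k[2]}) u v :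
  order_pairs m f u v -> jsc m (principal (series_of_mpoly f)) g ->
  forall e, g e != 0 -> (m.+1 <= e ord0 * u + e ord_max * v)%N.
Proof.
move=> [u0 v0 fuv] gf e; rewrite ltnNge; apply: contra => le.
rewrite (jsc_coef_eq0 k_char0 (weights2_gt0 u0 v0) gf) //; last by rewrite wdeg_weights2.
by move=> e' /fuv; rewrite wdeg_weights2 mulnC [(v * _)%N]mulnC.
Qed.

Section Prime.
Variables (m : nat) (f : {mpoly k[2]}) (P : ideal (jet_ring 2 k m)).
Hypothesis P_prime : prime_ideal P.
Hypothesis fP : ideal_set (jet_ideal m (principal (series_of_mpoly f))) `<=` ideal_set P.

Local Notation arc i := (Defs.arc k m i).

Lemma arc_coef_gt (i : 'I_2) j : (m < j)%N -> (arc i)`_j = 0.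
Proof.
move=> lt_mj; rewrite /Defs.arc coef_sum big1 // => l _.
rewrite coefCM coefXn; case: eqP => [E|]; last by rewrite mulr0.
by have := ltn_ord l; lia.
Qed.

Let farc (i : 'I_2) := arc i + 'X^(m.+1).

(** Adding t^(m+1) to the universal arc changes nothing modulo t^(m+1), and
    guarantees a coefficient outside P; thus arcs that vanish modulo P have
    order m+1 and need no separate treatment. *)
Lemma arc_order (i : 'I_2) : exists u, [/\ (0 < u)%N, ~ P (farc i)`_u &
  forall j, (j < u)%N -> P (farc i)`_j /\ P (arc i)`_j].
Proof.
have ex : exists u, `[< ~ P (farc i)`_u >].
  exists m.+1; apply/asboolP; rewrite coefD arc_coef_gt // coefXn eqxx add0r.
  by case: P_prime.
case: (ex_minnP ex) => u /asboolP Pu umin.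
have low j : (j < u)%N -> P (farc i)`_j.
  by move=> lt; apply: contrapT => /asboolP /umin; rewrite leqNgt lt.
exists u; split=> // [|j lt_ju].
  rewrite lt0n; apply/eqP => u0; apply: Pu; rewrite u0 coefD arc_coef0 coefXn add0r.
  exact: ideal0.
split; first exact: low.
have [le_jm|lt_mj] := leqP j m; last by rewrite arc_coef_gt //; apply: ideal0.
by have := low j lt_ju; rewrite coefD coefXn ltn_eqF ?addr0.
Qed.

(** The heart of the description of the jets of f. Let u and v be the orders of
    the two coordinates of the universal arc modulo P. If a monomial of f has
    order at most m along the arc, take one of least order. Were it the only
    one, its leading coefficient, a product of elements outside P, would be the
    leading coefficient of f along the arc, which lies in P. Hence two monomials
    have the same order, (u, v) is a multiple of (a, b), and the least order is
    a multiple of d. *)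
Lemma prime_order_pair a b d : (0 < a)%N -> (0 < b)%N -> gcdn a b = 1%N ->
  weighted_homog (weights2 a b) d f ->
  exists u v,
    [/\ forall j, (j < u)%N -> P (arc ord0)`_j,
        forall j, (j < v)%N -> P (arc ord_max)`_j &
        order_pairs m f u v \/ [/\ (0 < u)%N, (0 < v)%N, (d <= m)%N, (a <= u)%N & (b <= v)%N]].
Proof.
move=> a0 b0 gab fd.
have [u [u0 Pu ulow]] := arc_order ord0; have [v [v0 Pv vlow]] := arc_order ord_max.
exists u, v; split; [by move=> j /ulow[]|by move=> j /vlow[]|].
apply: contrapT => /not_orP[not_pair not_mult].
pose val (e : 'X_{1..2}) := (u * e ord0 + v * e ord_max)%N.
have [e ein le_em] : exists2 e, e \in msupp f & (val e <= m)%N.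
  apply: contrapT => H; apply: not_pair; split=> // e ein; rewrite ltnNge.
  by apply/negP => le; apply: H; exists e.
have ex : exists M, has (fun e => val e == M) (msupp f).
  by exists (val e); apply/hasP; exists e.
have [M Mex Mmin] := ex_minnP ex.
have le_Mm : (M <= m)%N.
  by apply: leq_trans (Mmin _ _) le_em; apply/hasP; exists e.
have /hasP[e0 e0in /eqP Ee0] := Mex.
(* A second monomial of least order makes (u, v) proportional to (a, b). *)
have uniq_min e1 : e1 \in msupp f -> e1 != e0 -> (M < val e1)%N.
  move=> e1in ne; rewrite ltn_neqAle Mmin ?andbT; last by apply/hasP; exists e1.
  apply/eqP => E; apply: not_mult.
  have ne' : (e0 ord0 != e1 ord0) || (e0 ord_max != e1 ord_max).
    rewrite -negb_and; apply: contraNN ne => /andP[/eqP E0 /eqP E1].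
    by apply/eqP/mnm2_eq.
  have Eab : (a * e0 ord0 + b * e0 ord_max = a * e1 ord0 + b * e1 ord_max)%N.
    have := fd _ e0in; have := fd _ e1in.
    rewrite -!/(wdeg _ _) !wdeg_weights2 => E1 E0.
    by rewrite ![(a * _)%N]mulnC ![(b * _)%N]mulnC E0 E1.
  have Euv : val e0 = val e1 by rewrite Ee0 E.
  have [c c0 [Eu Ev]] := coprime_parallel a0 b0 u0 gab ne' Eab Euv.
  have := fd _ e0in; rewrite -/(wdeg _ _) wdeg_weights2 => Ed.
  split=> //; rewrite ?Eu ?Ev ?leq_pmull //.
  apply: leq_trans le_Mm; rewrite -Ee0 /val Eu Ev -Ed.
  have -> : (c * a * e0 ord0 + c * b * e0 ord_max = c * (e0 ord0 * a + e0 ord_max * b))%N by ring.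
  by rewrite leq_pmull.
have low0 : lowcoef P u (farc ord0)`_u (farc ord0).
  by split=> [j /ulow[]//|]; rewrite subrr; apply: ideal0.
have low1 : lowcoef P v (farc ord_max)`_v (farc ord_max).
  by split=> [j /vlow[]//|]; rewrite subrr; apply: ideal0.
have low e1 : lowcoef P (val e1)
    ((farc ord0)`_u ^+ e1 ord0 * (farc ord_max)`_v ^+ e1 ord_max) (mmap1 farc e1).
  by rewrite mmap1_2; apply: lowcoefM; apply: lowcoefX.
have PM : P (mmap (@jet_const 2 k m) farc f)`_M.
  (* adding t^(m+1) does not change f along the arc modulo t^(m+1) *)
  have farcE i : eqmodX m.+1 (farc i) (arc i).
    by move=> j lt; rewrite coefD coefXn ltn_eqF ?addr0.
  rewrite (eqmodX_mmap (@jet_const 2 k m) farcE) // -(jet_poly_mpoly f) //.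
  apply: fP; apply: gen_sub; exists M, (series_of_mpoly f); split=> //.
  exact: gen_sub.
rewrite /mmap coef_sum (bigD1_seq e0) ?msupp_uniq //= in PM.
have : P ((f@_e0)%:MP * ((farc ord0)`_u ^+ e0 ord0 * (farc ord_max)`_v ^+ e0 ord_max)).
  apply: ideal_trans PM _; rewrite opprD addrA; apply: idealD; last first.
    rewrite -mulN1r; apply: idealM; rewrite big_seq_cond; apply: ideal_sum => e1.
    case/andP => e1in ne; rewrite coefCM; apply: idealM.
    by have [lo _] := low e1; apply: lo; apply: uniq_min.
  rewrite /jet_const coefCM -mulrBr; apply: idealM.
  rewrite -opprB -mulN1r; apply: idealM; have [_] := low e0.
  by rewrite Ee0.
have f0 : f@_e0 != 0 by rewrite -mcoeff_msupp.
case: (P_prime) => P1 PM'; case/PM' => [Pf|/PM'[]/prime_idealX H]; last 2 first.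
- exact/Pu/H.
- exact/Pv/H.
apply: P1; have := idealM ((f@_e0)^-1)%:MP Pf.
by rewrite -mpolyCM mulVf // mpolyC1.
Qed.

Lemma prime_monomial u v p q j :
  (forall j, (j < u)%N -> P (arc ord0)`_j) ->
  (forall j, (j < v)%N -> P (arc ord_max)`_j) ->
  (j <= m)%N -> (j < u * p + v * q)%N ->
  P (jet_coef m j (varx k ^+ p * vary k ^+ q)).
Proof.
move=> ulow vlow le_jm lt_j.
rewrite monomialE /jet_coef -/(jet_poly m _) jet_poly_mpoly // mmapX mmap1_2 mon2_0 mon2_1.
have low0 : lowcoef P u (arc ord0)`_u (arc ord0).
  by split=> //; rewrite subrr; apply: ideal0.
have low1 : lowcoef P v (arc ord_max)`_v (arc ord_max).
  by split=> //; rewrite subrr; apply: ideal0.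
by have [lo _] := lowcoefM (lowcoefX p low0) (lowcoefX q low1); apply: lo.
Qed.

Fact jetP0 : forall j, (j <= m)%N -> P (jet_coef m j 0).
Proof. by move=> j _; rewrite jet_coef0; apply: ideal0. Qed.
Fact jetPD g h : (forall j, (j <= m)%N -> P (jet_coef m j g)) ->
  (forall j, (j <= m)%N -> P (jet_coef m j h)) ->
  forall j, (j <= m)%N -> P (jet_coef m j (g + h)).
Proof. by move=> Pg Ph j le; rewrite jet_coefD; apply: idealD; auto. Qed.
Fact jetPM g h : (forall j, (j <= m)%N -> P (jet_coef m j h)) ->
  forall j, (j <= m)%N -> P (jet_coef m j (g * h)).
Proof.
move=> Ph j le; rewrite jet_coefM //; apply: ideal_sum => i _; apply: idealM.
by apply: Ph; apply: leq_trans (leq_subr _ _) le.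
Qed.
(** The series whose jet coefficients all lie in P; that this is an ideal lets
    one test membership on generators. *)
Definition jet_prime : ideal {mpseries k[2]} :=
  @Ideal _ [set g | forall j, (j <= m)%N -> P (jet_coef m j g)] jetP0 jetPD jetPM.

End Prime.

Lemma jsc_prime m (f : {mpoly k[2]}) g :
  (forall P : ideal (jet_ring 2 k m), prime_ideal P ->
     ideal_set (jet_ideal m (principal (series_of_mpoly f))) `<=` ideal_set P ->
     jet_prime P g) ->
  jsc m (principal (series_of_mpoly f)) g.
Proof. by move=> H j le; apply: radical_prime => P Pp fP; apply: H. Qed.

Section Weighted.
Variables (a b d : nat) (f : {mpoly k[2]}).
Hypotheses (a_gt0 : (0 < a)%N) (b_gt0 : (0 < b)%N) (gab : gcdn a b = 1%N).
Hypothesis fd : weighted_homog (weights2 a b) d f.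

(** Below the degree d the second alternative of the lemma on orders is
    excluded, so the order pair of every prime is among those that define the
    monomial ideal. *)
Lemma jsc_monomials_of_lt m g : (m < d)%N ->
  gen (monomials (fun p q => forall u v : nat,
         order_pairs m f u v -> (m.+1 <= p * u + q * v)%N)) g ->
  jsc m (principal (series_of_mpoly f)) g.
Proof.
move=> lt_md; move: g; apply: gen_min => _ [p [q [pq ->]]].
apply: jsc_prime => P Pp fP j le_jm.
have [u [v [ulow vlow []]]] := prime_order_pair Pp fP a_gt0 b_gt0 gab fd; last first.
  by case=> _ _; lia.
move=> /pq le; apply: (prime_monomial ulow vlow) => //.
by rewrite mulnC [(v * _)%N]mulnC; apply: leq_ltn_trans le.
Qed.

Lemma jsc_weighted_lt m g : (m < d)%N ->
  jsc m (principal (series_of_mpoly f)) g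
  <-> gen (monomials (fun p q => forall u v : nat,
         order_pairs m f u v -> (m.+1 <= p * u + q * v)%N)) g.
Proof.
move=> lt_md; split; last exact: jsc_monomials_of_lt.
move=> gf; apply: (@plane_ideal_mem _ m.+1).
- apply: gen_sub; exists m.+1, 0%N; rewrite expr0 mulr1; split=> // u v [u0 _ _].
  by rewrite addn0 leq_pmulr.
- apply: gen_sub; exists 0%N, m.+1; rewrite expr0 mul1r; split=> // u v [_ v0 _].
  by rewrite leq_pmulr.
move=> p q gpq; apply: gen_sub; exists p, q; split=> // u v fuv.
by have := jsc_order_pairs fuv gf gpq; rewrite mon2_0 mon2_1.
Qed.

(** A prime whose orders (u, v) satisfy a <= u and b <= v is controlled by J1,
    every other one by J2: proportional weights fall in the first class, and
    the pairs of the second class that are not order pairs of f do not occur. *)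
Lemma jsc_weighted_ge m g : (d <= m)%N -> reduced (series_of_mpoly f) ->
  jsc m (principal (series_of_mpoly f)) g
  <-> gen ([set series_of_mpoly f]
           `|` monomials (fun p q => (m.+1 <= a * p + b * q)%N)) g
      /\ gen (monomials (fun p q => forall u v : nat,
                order_pairs m f u v -> (u <= a)%N \/ (v <= b)%N ->
                (m.+1 <= u * p + v * q)%N)) g.
Proof.
move=> le_dm fred; split=> [gf|[gJ1 gJ2]].
  split.
    have [|h N q E|q Eq] := jsc_weighted_homog_sub k_char0 _ fd _ gf.
    - exact: weights2_gt0.
    - apply: fred; exists N; apply/principalP; exists (series_of_mpoly q).
      by rewrite -rmorphXn E rmorphM.
    rewrite -[g](subrK (q * series_of_mpoly f)); apply: idealD; last first.
      by apply: idealM; apply: gen_sub; left.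
    apply: (@plane_ideal_mem _ m.+1).
    - apply: gen_sub; right; exists m.+1, 0%N; rewrite expr0 mulr1; split=> //.
      by rewrite muln0 addn0 leq_pmull.
    - apply: gen_sub; right; exists 0%N, m.+1; rewrite expr0 mul1r; split=> //.
      by rewrite muln0 leq_pmull.
    move=> p r; have [le|lt] := leqP m.+1 (a * p + b * r)%N => ne.
      by apply: gen_sub; right; exists p, r.
    case/eqP: ne; apply: Eq; rewrite wdeg_weights2 mon2_0 mon2_1.
    by rewrite mulnC [(r * _)%N]mulnC.
  apply: (@plane_ideal_mem _ m.+1).
  - apply: gen_sub; exists m.+1, 0%N; rewrite expr0 mulr1; split=> // u v [u0 _ _] _.
    by rewrite muln0 addn0 leq_pmull.
  - apply: gen_sub; exists 0%N, m.+1; rewrite expr0 mul1r; split=> // u v [_ v0 _] _.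
    by rewrite muln0 leq_pmull.
  move=> p q gpq; apply: gen_sub; exists p, q; split=> // u v fuv _.
  by have := jsc_order_pairs fuv gf gpq; rewrite mon2_0 mon2_1 mulnC [(q * _)%N]mulnC.
apply: jsc_prime => P Pp fP.
have [u [v [ulow vlow H]]] := prime_order_pair Pp fP a_gt0 b_gt0 gab fd.
have [[fuv uv]|[le_au le_bv]] :
    (order_pairs m f u v /\ ((u <= a)%N \/ (v <= b)%N)) \/ (a <= u /\ b <= v)%N.
  case: H => [fuv|[_ _ _ le_au le_bv]]; last by right.
  have [le_ua|lt_au] := leqP u a; first by left; split; [|left].
  have [le_vb|lt_bv] := leqP v b; first by left; split; [|right].
  by right; split; apply: ltnW.
- apply: gen_min gJ2 => _ [p [q [pq ->]]] j le_jm.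
  by apply: (prime_monomial ulow vlow) => //; apply: leq_ltn_trans (pq u v fuv uv).
apply: gen_min gJ1 => _ [->|[p [q [pq ->]]]] j le_jm.
  apply: fP; apply: gen_sub; exists j, (series_of_mpoly f); split=> //.
  exact: gen_sub.
apply: (prime_monomial ulow vlow) => //; apply: leq_ltn_trans (le_jm) _.
by apply: leq_trans pq _; rewrite leq_add // leq_mul2r ?le_au ?le_bv orbT.
Qed.
End Weighted.
End PlaneMonomials.

(** * Isomorphisms of quotient algebras *)

Section QuotMap.
Variables (k : comNzRingType).
Implicit Types (A B : comAlgType k).

Lemma qpi_is_zmod A (I : ideal A) : zmod_morphism (qpi I).
Proof.
move=> x y; apply/eqP; rewrite eq_sym subr_eq; apply/eqP.
by rewrite -qpiD subrK.
Qed.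
Lemma qpi_is_monoid A (I : ideal A) : monoid_morphism (qpi I).
Proof. by split=> // x y; apply: qpiM. Qed.
HB.instance Definition _ A (I : ideal A) :=
  GRing.isZmodMorphism.Build A (quot_alg I) (qpi I) (qpi_is_zmod I).
HB.instance Definition _ A (I : ideal A) :=
  GRing.isMonoidMorphism.Build A (quot_alg I) (qpi I) (qpi_is_monoid I).

Lemma qpi_eq0 A (I : ideal A) x : qpi I x = 0 <-> I x.
Proof. by rewrite -(rmorph0 (qpi I)) qpi_eq subr0. Qed.

(** An isomorphism of quotients, described by the composite with the
    projection on the source: all relations become equations in the target,
    and only one side involves representatives. *)
Definition quot_map A B (I : ideal A) (J : ideal B) (F : {rmorphism A -> quot_alg J}) :=
  [/\ forall c x, F (c *: x) = c *: F x, forall x, F x = 0 <-> I x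
    & forall z, exists x, F x = z].

Lemma quot_iso_map A B (I : ideal A) (J : ideal B) :
  quot_iso I J -> exists F, @quot_map A B I J F.
Proof.
case=> phi [[phi1 phiM] [psi phiK psiK]].
pose F x := phi (qpi I x).
have Fz : zmod_morphism F by move=> x y; rewrite /F !raddfB.
have Fm : monoid_morphism F.
  by split=> [|x y]; rewrite /F ?rmorph1 // rmorphM phiM.
exists (HB.pack_for {rmorphism A -> quot_alg J} F
   (GRing.isZmodMorphism.Build _ _ F Fz) (GRing.isMonoidMorphism.Build _ _ F Fm)).
split=> [c x|x|z] /=.
- by rewrite /F qpiZ -linearZ.
- rewrite /F -(raddf0 phi); split=> [/(can_inj phiK)/qpi_eq0 //|/qpi_eq0 -> //].
- by exists (repr (psi z)); rewrite /F qpi_repr psiK.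
Qed.

Lemma quot_map_eq A B (I : ideal A) (J : ideal B) F : @quot_map A B I J F ->
  forall x y, F x = F y <-> I (x - y).
Proof.
move=> [_ Fker _] x y; rewrite -Fker rmorphB; split=> [->|/eqP]; first exact: subrr.
by rewrite subr_eq0 => /eqP.
Qed.

Lemma quot_map_iso A B (I : ideal A) (J : ideal B) F :
  @quot_map A B I J F -> quot_iso I J.
Proof.
move=> Fq; have [Fz Fker Fsurj] := Fq; have FE := quot_map_eq Fq.
pose phi (z : quot_alg I) := F (repr z).
have phiE x : phi (qpi I x) = F x by apply/FE/repr_qpi.
have phi_lin : linear phi.
  move=> c; elim/qpi_ind=> x; elim/qpi_ind=> y.
  by rewrite -[c *: _]qpiZ -qpiD !phiE rmorphD Fz.
exists (HB.pack_for {linear quot_alg I -> quot_alg J} phi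
  (GRing.isLinear.Build _ _ _ _ phi phi_lin)) => /=; split.
  split=> [|]; first by rewrite -(rmorph1 F) -phiE.
  by elim/qpi_ind=> x; elim/qpi_ind=> y; rewrite -[qpi I x * _]qpiM !phiE rmorphM.
have [psi psiE] := choice Fsurj.
exists (fun z => qpi I (psi z)) => [z|z]; last by rewrite phiE psiE.
rewrite -[z in RHS]qpi_repr; apply/qpi_eq; apply/FE.
by rewrite psiE.
Qed.

Lemma quot_isoP A B (I : ideal A) (J : ideal B) :
  quot_iso I J <-> exists F, @quot_map A B I J F.
Proof. by split=> [/quot_iso_map//|[F]]; apply: quot_map_iso. Qed.

Lemma quot_map_sym A B (I : ideal A) (J : ideal B) F : @quot_map A B I J F ->
  exists2 G, @quot_map B A J I G & forall x y, F x = qpi J y <-> G y = qpi I x.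
Proof.
move=> Fq; have [Fz Fker Fsurj] := Fq; have FE := quot_map_eq Fq.
have [s sE] := choice (fun y => Fsurj (qpi J y)).
pose G y := qpi I (s y).
have GE x y : F x = qpi J y <-> G y = qpi I x.
  rewrite /G; split=> [E|/qpi_eq/FE <-//]; apply/qpi_eq/FE; by rewrite sE.
have G_zmod : zmod_morphism G.
  by move=> x y; rewrite /G -rmorphB; apply/GE; rewrite !rmorphB !sE.
have G_mon : monoid_morphism G.
  split=> [|x y]; first by rewrite -[1 in RHS](rmorph1 (qpi I)); apply/GE; rewrite !rmorph1.
  by rewrite /G -rmorphM; apply/GE; rewrite !rmorphM !sE.
exists (HB.pack_for {rmorphism B -> quot_alg I} G
   (GRing.isZmodMorphism.Build _ _ G G_zmod) (GRing.isMonoidMorphism.Build _ _ G G_mon)) => //.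
split=> [c x|x|z] /=.
- by rewrite /G -[RHS]qpiZ; apply/GE; rewrite Fz sE -[LHS]qpiZ.
- rewrite -(rmorph0 (qpi I)) -GE rmorph0; split=> [/esym/qpi_eq0//|/qpi_eq0 -> //].
- elim/qpi_ind: z => x; have [y Ey] : exists y, F x = qpi J y.
    by exists (repr (F x)); rewrite qpi_repr.
  by exists y; apply/GE.
Qed.

Lemma quot_iso_refl A (I : ideal A) : quot_iso I I.
Proof. by exists idfun; split; [split|exists idfun]. Qed.

Lemma quot_iso_sym A B (I : ideal A) (J : ideal B) : quot_iso I J -> quot_iso J I.
Proof. by move=> /quot_isoP[F /quot_map_sym[G Gq _]]; apply/quot_isoP; exists G. Qed.

Lemma quot_iso_trans A B (C : comAlgType k) (I : ideal A) (J : ideal B) (K : ideal C) :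
  quot_iso I J -> quot_iso J K -> quot_iso I K.
Proof.
case=> phi [[phi1 phiM] phi_bij] [psi [[psi1 psiM] psi_bij]].
exists (psi \o phi); split; last exact: bij_comp.
by split=> [|x y] /=; rewrite ?phi1 ?psi1 ?phiM ?psiM.
Qed.

Lemma quot_iso_enlarge A B (I I' : ideal A) (J J' : ideal B) F :
  @quot_map A B I J F -> ideal_set J `<=` ideal_set J' ->
  (forall x y, F x = qpi J y -> (I' x <-> J' y)) -> quot_iso I' J'.
Proof.
move=> [Fz Fker Fsurj] JJ' IJ'.
pose F' x := qpi J' (repr (F x)).
have F'E x y : F x = qpi J y -> F' x = qpi J' y.
  move=> E; apply/qpi_eq/JJ'/qpi_eq; by rewrite qpi_repr.
have lift x : F x = qpi J (repr (F x)) by rewrite qpi_repr.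
have F'z : zmod_morphism F'.
  move=> x y; rewrite /F' -[RHS](rmorphB (qpi J')); apply: F'E.
  by rewrite !rmorphB; congr (_ - _); apply: lift.
have F'm : monoid_morphism F'.
  split=> [|x y].
    by rewrite -[RHS](rmorph1 (qpi J')); apply: F'E; rewrite !rmorph1.
  by rewrite /F' -[RHS](rmorphM (qpi J')); apply: F'E; rewrite !rmorphM; congr (_ * _); apply: lift.
apply/quot_isoP; exists (HB.pack_for {rmorphism A -> quot_alg J'} F'
   (GRing.isZmodMorphism.Build _ _ F' F'z) (GRing.isMonoidMorphism.Build _ _ F' F'm)).
split=> [c x|x|z] /=.
- by rewrite /F' -[RHS]qpiZ; apply: F'E; rewrite Fz [in LHS](lift x) -[LHS]qpiZ.
- by rewrite (IJ' x _ (lift x)) qpi_eq0.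
- elim/qpi_ind: z => y; have [x Ex] := Fsurj (qpi J y).
  by exists x; apply: F'E.
Qed.

End QuotMap.

(** * Dimensions of quotient algebras *)

Section Dimension.
Variable (k : fieldType).

Definition functional (A : lmodType k) (l : A -> k) := forall c x y, l (c *: x + y) = c * l x + l y.

Lemma functional_sum (A : lmodType k) (l : A -> k) (I : Type) (r : seq I) (c : I -> k) (F : I -> A) :
  functional l -> l (\sum_(i <- r) c i *: F i) = \sum_(i <- r) c i * l (F i).
Proof.
move=> ll; elim: r => [|i r IH]; last by rewrite !big_cons ll IH.
by rewrite !big_nil; have := ll (-1) 0 0; rewrite scaler0 addr0 mulN1r addNr.
Qed.

Lemma wide_kernel D D' (M : 'M[k]_(D, D')) : (D' < D)%N ->
  exists2 c : 'rV[k]_D, c != 0 & c *m M = 0.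
Proof.
move=> lt; have ker0 : kermx M != 0.
  rewrite kermx_eq0 /row_free neq_ltn; apply/orP; left.
  by apply: leq_ltn_trans (rank_leq_col M) lt.
by have /rowV0Pn[c /sub_kermxP cM c0] := ker0; exists c.
Qed.

(** If D' were smaller than D, some nontrivial combination of the images of
    the a_j would be killed by all mu, hence lie in J; by the isomorphism the
    same combination of the a_j lies in I, and the lam_i show that its
    coefficients vanish. *)
Lemma quot_iso_dim_le (A B : comAlgType k) (I : ideal A) (J : ideal B) D D'
    (lam : 'I_D -> A -> k) (a : 'I_D -> A) (mu : 'I_D' -> B -> k) :
  quot_iso I J ->
  (forall i, functional (lam i)) -> (forall j, functional (mu j)) ->
  (forall i x, I x -> lam i x = 0) ->
  (forall i j, lam i (a j) = (i == j)%:R) ->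
  (forall y, (forall j, mu j y = 0) -> J y) ->
  (D <= D')%N.
Proof.
move=> /quot_isoP[F [Fz Fker _]] llam lmu lamI lama muJ.
rewrite leqNgt; apply/negP => lt.
pose b i : B := repr (F (a i)).
have bE i : F (a i) = qpi J (b i) by rewrite qpi_repr.
have [c c0 cM] := @wide_kernel D D' (\matrix_(i, j) mu j (b i)) lt.
case/eqP: c0; apply/rowP => i; rewrite mxE.
have : J (\sum_j c 0 j *: b j).
  apply: muJ => j; rewrite functional_sum //.
  have /rowP/(_ j) := cM; rewrite !mxE => E; rewrite -[RHS]E.
  by apply: eq_bigr => l _; rewrite mxE.
move/qpi_eq0; rewrite raddf_sum /= => sum0.
have : I (\sum_j c 0 j *: a j).
  apply/Fker; rewrite raddf_sum -[RHS]sum0; apply: eq_bigr => j _.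
  by rewrite /= Fz bE -[LHS]qpiZ.
move/(lamI i); rewrite functional_sum // (bigD1 i) //= lama eqxx mulr1 big1 ?addr0 //.
by move=> j ne; rewrite lama eq_sym (negPf ne) mulr0.
Qed.

(** The functionals mu bound the size of families independent modulo I; a
    largest such family is a basis of the quotient. *)
Lemma quot_has_dim (A : comAlgType k) (I : ideal A) D' (mu : 'I_D' -> A -> k) :
  (forall j, functional (mu j)) ->
  (forall y, (forall j, mu j y = 0) -> I y) ->
  exists d, has_dim (quot_alg I) d.
Proof.
move=> lmu muI.
pose indep d (a : 'I_d -> A) := forall c : 'I_d -> k, I (\sum_j c j *: a j) -> forall i, c i = 0.
have ex0 : exists d, `[< exists a, @indep d a >].
  by exists 0%N; apply/asboolP; exists (fun=> 0); move=> c _ [].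
have bound d : `[< exists a, @indep d a >] -> (d <= D')%N.
  move=> /asboolP[a ind]; rewrite leqNgt; apply/negP => lt.
  have [c c0 cM] := @wide_kernel d D' (\matrix_(i, j) mu j (a i)) lt.
  case/eqP: c0; apply/rowP => i; rewrite mxE; apply: (ind (fun j => c 0 j)).
  apply: muI => j; rewrite functional_sum //.
  have /rowP/(_ j) := cM; rewrite !mxE => E; rewrite -[RHS]E.
  by apply: eq_bigr => l _; rewrite mxE.
case: (ex_maxnP ex0 bound) => d /asboolP[a ind] dmax.
have span x : exists c : 'rV[k]_d, I (x - \sum_j c 0 j *: a j).
  apply: contrapT => nx; have := dmax d.+1; rewrite ltnn => H.
  suff : False by []; suff: false by []; apply: H; apply/asboolP.
  exists (fun i => if unlift ord_max i is Some j then a j else x) => c.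
  rewrite (bigD1 ord_max) //= unlift_none.
  have -> : \sum_(i < d.+1 | i != ord_max)
      c i *: (if unlift ord_max i is Some j then a j else x)
    = \sum_(j < d) c (lift ord_max j) *: a j.
    rewrite big_mkcond (bigD1_ord ord_max) //= eqxx add0r; apply: eq_bigr => j _.
    by rewrite liftK eq_sym neq_lift.
  move=> Ic; have cmax0 : c ord_max = 0.
    apply/eqP; apply: contrapT => /negP c0; apply: nx.
    exists (\row_j (- (c ord_max)^-1 * c (lift ord_max j))).
    have := idealM ((c ord_max)^-1%:A) Ic; rewrite mulr_algl scalerDr scalerA mulVf // scale1r.
    congr (I _); congr (_ + _); rewrite scaler_sumr -sumrN; apply: eq_bigr => j _.
    by rewrite mxE scalerA mulNr scaleNr opprK.
  move: Ic; rewrite cmax0 scale0r add0r => /ind cj i.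
  by case: (unliftP ord_max i) => [j|] ->.
have [s sE] := choice span.
exists d; pose phi (z : quot_alg I) := s (repr z).
have uniq_s x (c : 'rV[k]_d) : I (x - \sum_j c 0 j *: a j) -> s x = c.
  move=> Ic; apply/rowP => i; apply/eqP; rewrite -subr_eq0; apply/eqP.
  apply: (ind (fun j => s x 0 j - c 0 j)).
  under eq_bigr do rewrite scalerBl; rewrite sumrB.
  set X := \sum__ _ in Ic *; set Y := \sum__ _.
  have -> : Y - X = (x - X) + (-1) * (x - Y) by ring.
  by apply: idealD => //; apply/idealM/sE.
have phiE x : phi (qpi I x) = s x.
  apply/esym; apply: uniq_s; have := sE (repr (qpi I x)); rewrite -/(phi _).
  set X := \sum__ _; have := repr_qpi I x; set y := repr _ => Iyx IyX.
  have -> : x - X = (y - X) + (-1) * (y - x) by ring.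
  by apply: idealD => //; apply: idealM.
have phi_lin : linear phi.
  move=> c; elim/qpi_ind=> x; elim/qpi_ind=> y.
  rewrite -[c *: _]qpiZ -qpiD !phiE; apply: uniq_s.
  have -> : \sum_j (c *: s x + s y) 0 j *: a j
    = c *: (\sum_j s x 0 j *: a j) + \sum_j s y 0 j *: a j.
    rewrite scaler_sumr -big_split; apply: eq_bigr => j _ /=.
    by rewrite !mxE scalerDl scalerA.
  rewrite opprD addrACA -scalerBr; apply: idealD; last exact: sE.
  by rewrite -mulr_algl; apply/idealM/sE.
exists (HB.pack_for {linear quot_alg I -> 'rV[k]_d} phi
  (GRing.isLinear.Build _ _ _ _ phi phi_lin)) => /=.
exists (fun c : 'rV_d => qpi I (\sum_j c 0 j *: a j)) => [|c].
  elim/qpi_ind => x; rewrite phiE; apply/esym/qpi_eq/sE.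
by rewrite phiE; apply: uniq_s; rewrite subrr; apply: ideal0.
Qed.

Lemma has_dim_ge (A : comAlgType k) (I : ideal A) d D
    (lam : 'I_D -> A -> k) (a : 'I_D -> A) :
  has_dim (quot_alg I) d ->
  (forall i, functional (lam i)) -> (forall i x, I x -> lam i x = 0) ->
  (forall i j, lam i (a j) = (i == j)%:R) -> (D <= d)%N.
Proof.
case=> phi phi_bij llam lamI lama.
apply: (@quot_iso_dim_le A A I I D d lam a (fun j x => phi (qpi I x) 0 j)) => //.
- exact: quot_iso_refl.
- by move=> j c x y; rewrite qpiD qpiZ linearP !mxE.
- move=> y y0; apply/qpi_eq0; apply: (bij_inj phi_bij); rewrite raddf0.
  by apply/rowP => j; rewrite y0 mxE.
Qed.

Lemma dimk_ge (A : comAlgType k) (I : ideal A) D D'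
    (lam : 'I_D -> A -> k) (a : 'I_D -> A) (mu : 'I_D' -> A -> k) :
  (forall i, functional (lam i)) -> (forall i x, I x -> lam i x = 0) ->
  (forall i j, lam i (a j) = (i == j)%:R) ->
  (forall j, functional (mu j)) -> (forall y, (forall j, mu j y = 0) -> I y) ->
  (D <= dimk (quot_alg I))%N.
Proof.
move=> llam lamI lama lmu muI; have [d dP] := quot_has_dim lmu muI.
by apply: (has_dim_ge _ llam lamI lama); apply: xgetI dP.
Qed.

Lemma dimk_iso (A B : comAlgType k) (I : ideal A) (J : ideal B) :
  quot_iso I J -> dimk (quot_alg I) = dimk (quot_alg J).
Proof.
have sub (A' B' : comAlgType k) (I' : ideal A') (J' : ideal B') d :
    quot_iso I' J' -> has_dim (quot_alg J') d -> has_dim (quot_alg I') d.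
  by case=> phi [_ phi_bij] [psi psi_bij]; exists (psi \o phi); apply: bij_comp.
move=> IJ; rewrite /dimk; congr (xget _ _); apply/predeqP => d.
by split; apply: sub => //; apply: quot_iso_sym.
Qed.

End Dimension.

(** * Dimensions read off from coefficients in the plane *)

Section PlaneDimension.
Variable (k : fieldType).
Implicit Types (h : {mpseries k[2]}) (e : nat * nat).

Definition cf h e : k := h (mon2 e.1 e.2).

Lemma mon2_inj e e' : mon2 e.1 e.2 = mon2 e'.1 e'.2 -> e = e'.
Proof.
case: e e' => [p q] [p' q'] /= E.
by rewrite -(mon2_0 p q) -{2}(mon2_1 p q) E mon2_0 mon2_1.
Qed.

Lemma cf_monomial e e' :
  cf (series_of_mpoly 'X_[mon2 e.1 e.2]) e' = (e == e')%:R.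
Proof.
rewrite /cf /= mcoeffX; congr (_%:R); congr nat_of_bool.
by apply/eqP/eqP => [/mon2_inj|->].
Qed.

(** The correction accounts for a relation between two coefficients, as
    created by the curve itself: along y^2 + x^n the monomials y^2 and x^n are
    proportional. *)
Definition twisted (e0 e1 : nat * nat) (c : k) e h : k :=
  cf h e - (if e == e0 then c * cf h e1 else 0).

Lemma twisted_functional e0 e1 c e : functional (twisted e0 e1 c e).
Proof. by move=> a x y; rewrite /twisted /cf /=; case: eqP => _; ring. Qed.

Lemma twisted_monomial e0 e1 c (S : seq (nat * nat)) (i j : 'I_(size S)) :
  uniq S -> (e1 \in S -> c = 0) ->
  twisted e0 e1 c (tnth (in_tuple S) i)
    (series_of_mpoly 'X_[mon2 (tnth (in_tuple S) j).1 (tnth (in_tuple S) j).2]) = (i == j)%:R.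
Proof.
move=> uS e1S; rewrite /twisted !cf_monomial.
have -> : c * (tnth (in_tuple S) j == e1)%:R = 0.
  by case: eqP => [E|_]; rewrite ?mulr0 // e1S ?mul0r // -E mem_tnth.
rewrite if_same subr0 eq_sym; congr (_%:R); congr nat_of_bool.
by apply/eqP/eqP => [|->] //; apply: (tuple_uniqP (in_tuple S) uS).
Qed.

(** The form in which dimensions are compared: twisted coefficients at S
    vanish on the first ideal, and those at S' suffice to detect membership in
    the second. *)
Lemma plane_dim_le (I J : ideal {mpseries k[2]}) (S S' : seq (nat * nat)) e0 e1 c e0' e1' c' :
  quot_iso I J -> uniq S -> (e1 \in S -> c = 0) ->
  (forall h, I h -> {in S, forall e, twisted e0 e1 c e h = 0}) ->
  (forall h, {in S', forall e, twisted e0' e1' c' e h = 0} -> J h) ->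
  (size S <= size S')%N.
Proof.
move=> IJ uS e1S SI S'J.
apply: (quot_iso_dim_le (lam := fun i => twisted e0 e1 c (tnth (in_tuple S) i))
  (a := fun j => series_of_mpoly 'X_[mon2 (tnth (in_tuple S) j).1 (tnth (in_tuple S) j).2])
  (mu := fun i => twisted e0' e1' c' (tnth (in_tuple S') i)) IJ).
- by move=> i; apply: twisted_functional.
- by move=> i; apply: twisted_functional.
- by move=> i x Ix; apply: SI => //; apply: mem_tnth.
- by move=> i j; apply: twisted_monomial.
- move=> y y0; apply: S'J => e /(tnthP (in_tuple S'))[i ->]; exact: y0.
Qed.

Lemma plane_dimk_ge (I : ideal {mpseries k[2]}) (S S' : seq (nat * nat)) :
  uniq S ->
  (forall h, I h -> {in S, forall e, cf h e = 0}) ->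
  (forall h, {in S', forall e, cf h e = 0} -> I h) ->
  (size S <= dimk (quot_alg I))%N.
Proof.
move=> uS SI S'J; pose e0 := (0, 0)%N.
have tw0 e h : twisted e0 e0 0 e h = cf h e.
  by rewrite /twisted mul0r if_same subr0.
apply: (dimk_ge (lam := fun i => twisted e0 e0 0 (tnth (in_tuple S) i))
  (a := fun j => series_of_mpoly 'X_[mon2 (tnth (in_tuple S) j).1 (tnth (in_tuple S) j).2])
  (mu := fun i => twisted e0 e0 0 (tnth (in_tuple S') i))).
- by move=> i; apply: twisted_functional.
- by move=> i x Ix; rewrite tw0; apply: SI => //; apply: mem_tnth.
- by move=> i j; apply: twisted_monomial.
- by move=> i; apply: twisted_functional.
- by move=> y y0; apply: S'J => e /(tnthP (in_tuple S'))[i ->]; rewrite -tw0.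
Qed.

End PlaneDimension.

(** * Invariance of the closure under isomorphism *)

Section Substitution.
Variables (n : nat) (k : fieldType).
Local Notation R := ({mpseries k[n]}).

Definition series_const : {rmorphism k -> R} := @series_of_mpoly n k \o @mpolyC n k.

Definition subst_poly (X : 'I_n -> R) : {rmorphism {mpoly k[n]} -> R} :=
  mmap series_const X.

Lemma subst_polyC X c : subst_poly X c%:MP = c%:A.
Proof.
rewrite /subst_poly /= mmapC; apply/esym.
by rewrite -[LHS]series_const_mulE mulr1.
Qed.
Lemma subst_polyX X i : subst_poly X 'X_i = X i.
Proof. by rewrite /subst_poly /= mmapX mmap1U. Qed.

Section QuotMapSeries.
Variables (I1 I2 : ideal R) (F : {rmorphism R -> quot_alg I2}).
Hypothesis Fq : quot_map I1 F.
Hypothesis I1_proper : ~ I1 1.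

Lemma proper_target : ~ I2 1.
Proof.
move=> I21; have [_ Fker _] := Fq; apply/I1_proper/Fker.
by rewrite rmorph1 -(rmorph1 (qpi I2)); apply/qpi_eq0.
Qed.

(** An element with nonzero constant term would be invertible in the target,
    whereas h is not invertible in the source. *)
Lemma quot_map_ordge1 h y : F h = qpi I2 y -> ordge 1 h -> ordge 1 y.
Proof.
move=> Fh /ordge1P h0; apply/ordge1P/eqP/negP => /negP /series_unit[v vy].
have [_ Fker Fsurj] := Fq; have [a Fa] := Fsurj (qpi I2 v).
have : I1 (a * h - 1).
  by apply/Fker; rewrite rmorphB rmorphM Fa Fh rmorph1 -rmorphM vy rmorph1 subrr.
have [|w wE Iah] := @series_unit n k (a * h - 1).
  by rewrite rmorphB rmorphM rmorph1 [X in _ * X]h0 mulr0 sub0r oppr_eq0 oner_eq0.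
by apply: I1_proper; have := idealM w Iah; rewrite wE.
Qed.

Let X i := repr (F (seriesX k i)) : R.

Lemma subst_var_E i : F (seriesX k i) = qpi I2 (X i).
Proof. by rewrite qpi_repr. Qed.

Lemma subst_var_ordge i : ordge 1 (X i).
Proof. by apply: (quot_map_ordge1 (subst_var_E i)); apply: ordge_seriesX. Qed.

Lemma quot_map_poly p : F (series_of_mpoly p) = qpi I2 (subst_poly X p).
Proof.
pose F1 : {rmorphism {mpoly k[n]} -> quot_alg I2} := F \o @series_of_mpoly n k.
pose F2 : {rmorphism {mpoly k[n]} -> quot_alg I2} := qpi I2 \o subst_poly X.
rewrite -[LHS]/(F1 p) -[RHS]/(F2 p); apply: mpoly_rmorph_eq => [c|i].
  rewrite [RHS]/(qpi I2 (subst_poly X c%:MP)) subst_polyC.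
  have -> : F1 c%:MP = F (c *: 1).
    by congr (F _); apply: mpseriesP => e /=; rewrite mcoeffC mcoeff1.
  by have [-> _ _] := Fq; rewrite rmorph1 -[LHS]qpiZ.
rewrite -[LHS]/(F (seriesX k i)) [RHS]/(qpi I2 (subst_poly X 'X_i)).
by rewrite subst_polyX; apply: subst_var_E.
Qed.

Lemma quot_map_ordge N (h : R) : ordge N h -> exists2 y, ordge N y & F h = qpi I2 y.
Proof.
move: N h; apply: (@ordge_ind n k (fun N h => exists2 y, ordge N y & F h = qpi I2 y)).
- by move=> f; exists (repr (F f)); rewrite ?qpi_repr.
- move=> N f [y yN Ef] i; exists (X i * y); last by rewrite !rmorphM Ef subst_var_E.
  by rewrite -add1n; apply: ordge_mul => //; apply: subst_var_ordge.
- move=> N f g [y yN Ef] [z zN Eg]; exists (y + z); first exact: ordgeD.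
  by rewrite !rmorphD Ef Eg.
- by move=> N; exists 0; rewrite ?rmorph0.
Qed.

(** A morphism of quotients need not be a substitution of power series on the
    nose; up to order N it is substitution into a polynomial, which suffices
    as the closure only depends on the series up to degree m. *)
Lemma quot_map_trunc N h y : F h = qpi I2 y ->
  exists2 z, ordge N z & I2 (y - (subst_poly X (series_trunc N h) + z)).
Proof.
move=> Fh; have [z zN Fz] := quot_map_ordge (@ordge_trunc _ _ N h).
exists z => //; apply/qpi_eq; rewrite -Fh qpiD -quot_map_poly -Fz.
by rewrite -rmorphD addrC subrK.
Qed.

Section Jets.
Variable m : nat.

Lemma jet_poly_coef0 (h : R) : ordge 1 h -> (jet_poly m h)`_0 = 0.
Proof.
move=> h1; rewrite /jet_poly (@mmap_arc_local _ _ _ _ 0) ?mmap0 ?coef0 // => a.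
rewrite leqn0 mdeg_eq0 => /eqP ->; rewrite mcoeff_trunc mcoeff0 mdeg0 /=.
by apply: h1; rewrite mdeg0.
Qed.

Lemma jet_poly_rmorph (S : {rmorphism {mpoly k[n]} -> R})
    (T : {rmorphism {mpoly k[n]} -> {poly jet_ring n k m}}) :
  (forall c, eqmodX m.+1 (jet_poly m (S c%:MP)) (T c%:MP)) ->
  (forall i, eqmodX m.+1 (jet_poly m (S 'X_i)) (T 'X_i)) ->
  forall p, eqmodX m.+1 (jet_poly m (S p)) (T p).
Proof.
move=> SC SX; apply: mpoly_ring_ind => // p q Ep Eq.
  by rewrite (rmorphD S) (rmorphD T) jet_polyD; apply: eqmodXD.
rewrite (rmorphM S) (rmorphM T); apply: eqmodX_trans (jet_polyM _ _) _.
exact: eqmodXM.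
Qed.

Lemma jet_poly_subst p : eqmodX m.+1 (jet_poly m (subst_poly X p))
  (mmap (@jet_const n k m) (fun i => jet_poly m (X i)) p).
Proof.
pose T : {rmorphism {mpoly k[n]} -> {poly jet_ring n k m}} :=
  mmap (@jet_const n k m) (fun i => jet_poly m (X i)).
apply: (@jet_poly_rmorph (subst_poly X) T) => [c|i].
  rewrite (_ : subst_poly X c%:MP = series_of_mpoly c%:MP); last exact: mmapC.
  by move=> j lt; rewrite jet_poly_mpoly // mmapC [T _]mmapC.
by rewrite subst_polyX [T _]mmapX mmap1U.
Qed.

Let psi : {rmorphism jet_ring n k m -> jet_ring n k m} :=
  jet_spec m (@mpolyC (n * m) k) (fun i => jet_poly m (X i)).

Lemma psi_jet_coef j (h : R) : (j <= m)%N ->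
  psi (jet_coef m j h) = jet_coef m j (subst_poly X (series_trunc m.+1 h)).
Proof.
move=> le_jm; rewrite /psi jet_spec_coef // => [|i]; last first.
  exact/jet_poly_coef0/subst_var_ordge.
by rewrite [RHS]/jet_coef -/(jet_poly _ _) jet_poly_subst.
Qed.

(** Substitution of the series X_i into the variables lifts to a ring
    endomorphism psi of the jet ring, which sends the jet coefficients of h to
    those of the substituted series; it maps the jet ideal of I1 into that of
    I2, hence radical into radical. *)
Lemma jsc_transport h y : F h = qpi I2 y -> jsc m I1 h -> jsc m I2 y.
Proof.
move=> Fh hI; have [z zN] := quot_map_trunc m.+1 Fh.
set s := subst_poly X _ => Iyz.
suff sI : jsc m I2 s.
  rewrite -[y](subrK (s + z)); apply: idealD; first exact: jsc_sub.
  by apply: (idealD sI); apply: jsc_ordge zN.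
move=> j le_jm; have [r Ir] := hI j le_jm; exists r.
rewrite /s -psi_jet_coef // -rmorphXn; case: Ir => t tP ->.
rewrite rmorph_sum big_seq; apply: ideal_sum => p /tP [l [g [le_lm Ig ->]]].
rewrite rmorphM psi_jet_coef //; apply: idealM.
have Fg : F g = qpi I2 0.
  by rewrite rmorph0; have [_ /(_ g) Fker _] := Fq; apply/Fker.
have [v vN Iv] := quot_map_trunc m.+1 Fg.
set u := subst_poly X _; have Iuv : I2 (u + v).
  by have := idealM (-1) Iv; rewrite sub0r mulN1r opprK.
have v0 : jet_coef m l v = 0 by rewrite /jet_coef -/(jet_poly m v) jet_poly_ordge ?coef0.
have -> : jet_coef m l u = jet_coef m l (u + v) by rewrite jet_coefD v0 addr0.
by apply: gen_sub; exists l, (u + v).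
Qed.
End Jets.
End QuotMapSeries.

Lemma quot_iso_jsc (I1 I2 : ideal R) m : ~ I1 1 ->
  quot_iso I1 I2 -> quot_iso (jsc m I1) (jsc m I2).
Proof.
move=> I1p /quot_isoP[F Fq]; apply: (quot_iso_enlarge Fq).
  exact: jsc_sub.
move=> x y Fxy; split; first exact: jsc_transport Fxy.
have [G Gq FG] := quot_map_sym Fq; have /FG Gyx := Fxy.
exact: (jsc_transport Gq (proper_target Fq I1p) Gyx).
Qed.

End Substitution.

(** * Derivations and linear systems over power series *)

Section Derivations.
Variables (n : nat) (k : fieldType).
Local Notation R := ({mpseries k[n]}).

Lemma series_deriv_trunc i (h : R) d e : (mdeg e < d)%N ->
  series_deriv i h e = ((series_trunc d.+1 h)^`M(i))@_e.
Proof.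
by move=> lt; rewrite mcoeff_mderiv mcoeff_trunc mdegD mdeg1 addn1 ltnS lt.
Qed.

Lemma series_derivD i (g h : R) : series_deriv i (g + h) = series_deriv i g + series_deriv i h.
Proof. by apply: mpseriesP => e /=; rewrite mulrnDl. Qed.

Lemma series_derivM i (g h : R) :
  series_deriv i (g * h) = series_deriv i g * h + g * series_deriv i h.
Proof.
apply: mpseriesP => e; set d := (mdeg e).+1.
have lt_ed : (mdeg e < d)%N by [].
have lt_ed1 : (mdeg e < d.+1)%N by apply: ltnW.
have lt_eid : (mdeg (e + U_(i))%MM < d.+1)%N by rewrite mdegD mdeg1 addn1.
rewrite -[LHS]/((g * h) (e + U_(i))%MM *+ (e i).+1) seriesDE.
have -> : (g * h) (e + U_(i))%MM = (series_trunc d.+1 g * series_trunc d.+1 h)@_(e + U_(i)).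
  exact: series_mulE.
rewrite -mcoeff_mderiv mderivM mcoeffD.
have loc (f : R) a : (mdeg a < d)%N ->
    (series_trunc d (series_deriv i f))@_a = ((series_trunc d.+1 f)^`M(i))@_a.
  by move=> lt; rewrite mcoeff_trunc lt; apply: series_deriv_trunc.
have loc' (f : R) a : (mdeg a < d)%N -> (series_trunc d f)@_a = (series_trunc d.+1 f)@_a.
  by move=> lt; rewrite !mcoeff_trunc lt ltnW.
congr (_ + _); rewrite [RHS](series_mulE _ _ lt_ed); apply: esym.
  exact: (mcoeffM_local (loc g) (loc' h) lt_ed).
exact: (mcoeffM_local (loc' g) (loc h) lt_ed).
Qed.

Lemma series_deriv_mpoly i p : series_deriv i (series_of_mpoly p) = series_of_mpoly p^`M(i) :> R.
Proof. by apply: mpseriesP => e /=; rewrite mcoeff_mderiv. Qed.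

(** The chain rule. *)
Lemma series_deriv_subst (X : 'I_n -> R) i p :
  series_deriv i (subst_poly X p) = \sum_a series_deriv i (X a) * subst_poly X p^`M(a).
Proof.
move: p; apply: mpoly_ring_ind => [c|j|p q Ep Eq|p q Ep Eq].
- rewrite (_ : subst_poly X c%:MP = series_of_mpoly c%:MP); last exact: mmapC.
  rewrite series_deriv_mpoly mderivC raddf0 big1 // => a _.
  by rewrite mderivC raddf0 mulr0.
- rewrite subst_polyX (bigD1 j) //= mderivX mnm1E eqxx scale1r.
  have -> : (U_(j) - U_(j) = 0 :> 'X_{1..n})%MM by apply/mnmP => l; rewrite mnmBE subnn mnm0E.
  rewrite mpolyX0 rmorph1 mulr1 big1 ?addr0 // => a ne.
  by rewrite mderivX mnm1E eq_sym (negPf ne) scale0r raddf0 mulr0.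
- rewrite (rmorphD (subst_poly X)) series_derivD Ep Eq -big_split.
  by apply: eq_bigr => a _; rewrite mderivD (rmorphD (subst_poly X)) mulrDr.
- rewrite (rmorphM (subst_poly X)) series_derivM Ep Eq mulr_suml mulr_sumr -big_split.
  apply: eq_bigr => a _; rewrite mderivM (rmorphD (subst_poly X)) !(rmorphM (subst_poly X)) /=.
  set A := subst_poly X p; set B := subst_poly X q.
  set A' := subst_poly X (mderiv a p); set B' := subst_poly X (mderiv a q).
  by ring.
Qed.

Lemma series_deriv_ordge N i (h : R) : ordge N.+1 h -> ordge N (series_deriv i h).
Proof. by move=> hN e lt /=; rewrite hN ?mul0rn // mdegD mdeg1 addn1. Qed.

Hypothesis k_char0 : [pchar k] =i pred0.

(** In characteristic 0 a coefficient of degree N > 0 is detected by a partial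
    derivative. *)
Lemma ordge_deriv N (h : R) : (0 < N)%N -> ordge N h ->
  (forall i, ordge N (series_deriv i h)) -> ordge N.+1 h.
Proof.
move=> N0 hN h'N e; rewrite ltnS leq_eqVlt => /orP[/eqP eN|]; last exact: hN.
have /existsP[i ei] : [exists i, e i != 0%N].
  apply: contraTT N0; rewrite negb_exists => /forallP e0.
  rewrite -eN -leqNgt leqn0 mdeg_eq0; apply/eqP/mnmP => i; rewrite mnm0E.
  by apply/eqP; have := e0 i; rewrite negbK.
have le_ie : (U_(i) <= e)%MM.
  by apply/mnm_lepP => j; rewrite mnm1E; case: eqP => // <-; rewrite lt0n.
have := h'N i (e - U_(i))%MM; rewrite /= submK //.
have /(congr1 mdeg) := submK le_ie; rewrite mdegD mdeg1 addn1 eN => <-.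
move=> /(_ (ltnSn _)) /eqP; rewrite -mulr_natr mulf_eq0.
by rewrite (proj1 (pcharf0P k) k_char0) orbF => /eqP.
Qed.
End Derivations.

Section UnitMatrix.
Variables (n : nat) (k : fieldType).
Local Notation R := ({mpseries k[n]}).

(** The determinant is a unit of the ring of power series; multiply by the
    adjugate matrix. *)
Lemma linear_system_mem (I : ideal R) N (M : 'M[R]_N) (s v : 'I_N -> R) :
  \det (map_mx (@const_coef n k) M) != 0 ->
  (forall i, \sum_a M i a * s a = v i) -> (forall i, I (v i)) -> forall a, I (s a).
Proof.
rewrite det_map_mx => /series_unit[u uM] Ms Iv a.
pose S : 'cV[R]_N := \col_a s a.
have MS : M *m S = \col_i v i.
  by apply/colP => i; rewrite !mxE -Ms; apply: eq_bigr => b _; rewrite !mxE.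
have : (\adj M *m (M *m S)) a 0 = \det M * s a.
  by rewrite mulmxA mul_adj_mx mul_scalar_mx !mxE.
rewrite MS mxE => E.
have -> : s a = u * (\det M * s a) by rewrite mulrA uM mul1r.
rewrite -E; apply: idealM; apply: ideal_sum => i _; rewrite !mxE.
exact: idealM.
Qed.

End UnitMatrix.

(** Lifting a membership in a generated ideal through an isomorphism of
    quotients, generator by generator. *)
Lemma gen_lift (k : comNzRingType) (A B : comAlgType k) (J : ideal B)
    (F : {rmorphism A -> quot_alg J}) (S : set A) (T : set B) :
  (forall x, S x -> exists2 y, gen T y & F x = qpi J y) ->
  forall x, gen S x -> exists2 y, gen T y & F x = qpi J y.
Proof.
move=> ST x [s sS ->]; elim: s sS => [|p s IH] sS.
  by exists 0; rewrite ?big_nil ?rmorph0 //; apply: gen_set0.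
have [|y Ty Ey] := IH; first by move=> q qs; apply: sS; rewrite inE qs orbT.
have [z Tz Ez] := ST p.2 (sS p (mem_head _ _)).
exists (repr (F p.1) * z + y); first by apply: gen_setD => //; apply: gen_setM.
rewrite big_cons (rmorphD F) (rmorphM F) Ey Ez qpiD; congr (_ + _).
by rewrite -{1}(qpi_repr (F p.1)) -[LHS]qpiM.
Qed.

(** * Invariance of the Jacobian algebra *)

Section MilnorInvariance.
Variables (n : nat) (k : fieldType).
Hypothesis k_char0 : [pchar k] =i pred0.
Local Notation R := ({mpseries k[n]}).

Definition jac (X : 'I_n -> R) : 'M[R]_n := \matrix_(i, a) series_deriv i (X a).
Definition linear_part (X : 'I_n -> R) : 'M[k]_n := map_mx (@const_coef n k) (jac X).

Lemma linear_partE X i a : linear_part X i a = X a U_(i)%MM.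
Proof. by rewrite !mxE /const_coef /= add0m mnm0E. Qed.

Section OneMap.
Variables (I1 I2 : ideal R) (F : {rmorphism R -> quot_alg I2}).
Variables (G : {rmorphism R -> quot_alg I1}).
Hypothesis (Fq : quot_map I1 F) (Gq : quot_map I2 G).
Hypothesis FG : forall x y, F x = qpi I2 y <-> G y = qpi I1 x.
Hypotheses (I1p : ~ I1 1) (I2p : ~ I2 1).

Definition images (J : ideal R) (H : R -> quot_alg J) (a : 'I_n) : R := repr (H (seriesX k a)).
Local Notation X := (images F).
Local Notation Y := (images G).

(** The two isomorphisms are inverse to each other modulo I1, which contains
    no linear terms. *)
Lemma linear_partM : (forall h, I1 h -> ordge 2 h) ->
  linear_part Y *m linear_part X = 1%:M.
Proof.
move=> I1_2; apply/matrixP => j a.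
have X1 : ordge 1 (X a) by apply: (subst_var_ordge Fq I1p a).
pose lin : R := \sum_i X a U_(i)%MM *: seriesX k i.
(* the series X a up to terms of order 2 *)
have [r r2 Er] : exists2 r, ordge 2 r & X a = lin + r.
  exists (X a - lin); last by rewrite addrC subrK.
  move=> e; rewrite leq_eqVlt => /orP[|]; last first.
    rewrite !ltnS leqn0 mdeg_eq0 => /eqP ->; rewrite seriesBE X1 ?mdeg0 //.
    rewrite series_sumE big1 ?subrr // => i _ /=; rewrite mcoeffX.
    by case: eqP => [/(congr1 mdeg)|]; rewrite ?mdeg1 ?mdeg0 // mulr0.
  rewrite eqSS => /mdeg1P[i /eqP ->]; rewrite seriesBE series_sumE.
  rewrite (bigD1 i) //= mcoeffX eqxx mulr1 big1 ?addr0 ?subrr // => b ne.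
  by rewrite mcoeffXU (negPf ne) mulr0.
have [r' r'2 Er'] := quot_map_ordge Gq I2p r2.
have GX : G (X a) = qpi I1 (seriesX k a) by apply/FG; rewrite qpi_repr.
have : I1 (seriesX k a - (\sum_i X a U_(i)%MM *: Y i + r')).
  apply/qpi_eq; rewrite -GX {1}Er (rmorphD G) qpiD Er'; congr (_ + _).
  rewrite (raddf_sum G) (raddf_sum (qpi I1)); apply: eq_bigr => i _ /=.
  have [-> _ _] := Gq; rewrite -[RHS]/(qpi I1 (_ *: _)) qpiZ; congr (_ *: _).
  by rewrite qpi_repr.
move/I1_2/(_ U_(j)%MM); rewrite mdeg1 => /(_ isT).
rewrite seriesBE seriesDE r'2 ?mdeg1 // addr0 series_sumE /= mcoeffXU => /eqP.
rewrite subr_eq0 => /eqP; rewrite eq_sym !mxE => ->.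
apply: eq_bigr => i _.
by rewrite ![linear_part _ _ _]linear_partE mulrC.
Qed.

Hypothesis detL : \det (linear_part X) != 0.

(** Substitution preserves orders: the derivatives of the substituted series
    are combinations of the substituted derivatives with an invertible matrix
    of coefficients, and the inverse isomorphism brings the order of the
    latter back. *)
Lemma subst_poly_ordge r p : (0 < r)%N -> (forall h, I1 h -> ordge r h) ->
  ordge r (series_of_mpoly p) -> ordge r.+1 (subst_poly X p) ->
  ordge r.+1 (series_of_mpoly p).
Proof.
move=> r0 I1r pr sp; apply: ordge_deriv => // a; rewrite series_deriv_mpoly.
have sa : ordge r (subst_poly X p^`M(a)).
  move: a; apply: (@linear_system_mem n k (order_ideal n k r) n (jac X) _
    (fun i => series_deriv i (subst_poly X p)) detL).
    move=> i; rewrite series_deriv_subst; apply: eq_bigr => a _.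
    by congr (_ * _); apply: mxE.
  by move=> i; apply: (series_deriv_ordge i sp).
have [y yr Ey] := quot_map_ordge Gq I2p sa.
have : I1 (series_of_mpoly p^`M(a) - y).
  by apply/qpi_eq; rewrite -Ey; apply/esym/FG; apply: (quot_map_poly Fq).
move=> /I1r H; rewrite -[series_of_mpoly _](subrK y); exact: ordgeD.
Qed.
End OneMap.

Lemma exact_order (h : R) N : h != 0 -> ordge N h ->
  exists s, [/\ (N <= s)%N, ordge s h & ~ ordge s.+1 h].
Proof.
move=> h0 hN; apply: contrapT => H.
have all_s s : ordge (N + s) h.
  elim: s => [|s IH]; first by rewrite addn0.
  rewrite addnS; apply: contrapT => ns; apply: H; exists (N + s)%N.
  by rewrite leq_addr.
case/eqP: h0; apply: mpseriesP => e; apply: (all_s (mdeg e).+1).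
by rewrite addnS ltnS leq_addl.
Qed.

(** Euler's formula. *)
Lemma mpoly_euler w d (p : {mpoly k[n]}) : weighted_homog w d p ->
  d%:R *: p = \sum_a (w a)%:R *: ('X_a * p^`M(a)).
Proof.
move=> pd; apply/mpolyP => e; rewrite mcoeffZ raddf_sum /=.
have term a : ((w a)%:R *: ('X_a * p^`M(a)))@_e = (e a * w a)%:R * p@_e.
  have -> : ((w a)%:R *: ('X_a * p^`M(a)))@_e =
      (w a)%:R * (series_of_mpoly 'X_[U_(a)] * series_of_mpoly p^`M(a)) e.
    by rewrite mcoeffZ -rmorphM.
  rewrite seriesX_mulE /=; case: ifP => [le_ae|/negP le_ae].
    have ea : (0 < e a)%N by move/mnm_lepP/(_ a): le_ae; rewrite mnm1E eqxx.
    rewrite mcoeff_mderiv submK // mnmBE mnm1E eqxx subn1 prednK //.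
    by rewrite -[_ *+ e a]mulr_natl mulrA -natrM mulnC.
  rewrite mulr0 (_ : e a = 0%N) ?mul0r //; apply/eqP; rewrite -leqn0 leqNgt.
  apply/negP => ea; apply: le_ae; apply/mnm_lepP => j.
  by rewrite mnm1E; case: eqP => // <-.
under eq_bigr do rewrite term.
rewrite -mulr_suml -natr_sum.
have [/memN_msupp_eq0 ->|] := boolP (e \notin msupp p); first by rewrite !mulr0.
by rewrite negbK => /pd ->.
Qed.

Section Invariance.
Variables (w : 'I_n -> nat) (d : nat) (p : {mpoly k[n]}) (f : R).
Hypotheses (d_gt0 : (0 < d)%N) (pd : weighted_homog w d p).
Let g : R := series_of_mpoly p.
Hypotheses (g2 : ordge 2 g) (g0 : g != 0).

Lemma euler_decomposition : exists c : 'I_n -> k, p = \sum_a (c a)%:MP * 'X_a * p^`M(a).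
Proof.
have d0 : d%:R != 0 :> k by rewrite (proj1 (pcharf0P k) k_char0) -lt0n.
exists (fun a => (w a)%:R / d%:R).
have dK : cancel ( *:%R d%:R) ( *:%R (d%:R^-1 : k) : {mpoly k[n]} -> {mpoly k[n]}).
  by move=> q; rewrite scalerA mulVf // scale1r.
apply: (can_inj dK); rewrite (mpoly_euler pd) scaler_sumr; apply: eq_bigr => a _.
by rewrite -!mulrA mul_mpolyC scalerA mulrCA mulfV // mulr1.
Qed.

Lemma rmorph_sum_mul3 (S : comNzRingType) (phi : {rmorphism {mpoly k[n]} -> S})
    (c : 'I_n -> {mpoly k[n]}) (q : 'I_n -> {mpoly k[n]}) :
  phi (\sum_a c a * q a) = \sum_a phi (c a) * phi (q a).
Proof. by rewrite raddf_sum; apply: eq_bigr => a _; apply: rmorphM. Qed.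

Lemma principal_ordge N (h : R) : ordge N h -> forall x, principal h x -> ordge N x.
Proof. by move=> hN x /principalP[q ->]; apply: ordgeM. Qed.

Lemma ordge1_proper (h : R) : ordge 1 h -> ~ principal h 1.
Proof.
move=> /principal_ordge H /H /(_ 0%MM); rewrite mdeg0 => /(_ isT) /eqP.
by rewrite /= mcoeff1 eqxx oner_eq0.
Qed.

(** The isomorphism is given modulo (f) by a substitution X, and g(X) = w f. The
    linear part of X is invertible, so orders are preserved in both directions;
    therefore f has the order of g, and w is a unit. By Euler's formula g(X) is a
    combination of the substituted derivatives s_a with coefficients in the
    maximal ideal. Differentiating g(X) = w f then shows that the derivatives
    of f are obtained from the s_a by a matrix with invertible constant part:
    both families generate the same ideal, and the s_a are the images of the
    derivatives of g. *)
Lemma quot_iso_jacobian : quot_iso (principal g) (principal f) ->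
  quot_iso (jacobian_ideal g) (jacobian_ideal f).
Proof.
move=> /quot_isoP[F Fq]; have [G Gq FG] := quot_map_sym Fq.
have GF y x : G y = qpi (principal g) x <-> F x = qpi (principal f) y by split=> /FG.
have gp : ~ principal g 1 by apply: ordge1_proper; apply: ordgeW g2.
have fp : ~ principal f 1 := proper_target Fq gp.
have f1 : ordge 1 f.
  apply/ordge1P/eqP/negP => /negP/series_unit[v vf]; apply: fp.
  by apply/principalP; exists v.
pose X := images F; pose Y := images G.
have LL : linear_part Y *m linear_part X = 1%:M.
  exact: (linear_partM Fq Gq FG gp fp (principal_ordge g2)).
have detX : \det (linear_part X) != 0.
  by apply/eqP => d0; have /eqP := congr1 determinant LL;
    rewrite det_mulmx d0 mulr0 det1 eq_sym oner_eq0.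
have detY : \det (linear_part Y) != 0.
  by apply/eqP => d0; have /eqP := congr1 determinant LL;
    rewrite det_mulmx d0 mul0r det1 eq_sym oner_eq0.
have [s [s2 gs gs1]] := exact_order g0 g2.
(* The order of f is raised step by step: as long as it is below s, the pull-back
   of a truncation of f lies in (g) up to a higher order. *)
have fs : ordge s f.
  have main r : (r.+1 <= s)%N -> ordge r.+1 f.
    elim: r => [//|r IH] lt; have {}IH := IH (ltnW lt).
    have := ordge_trunc (N := r.+2) f; set t := series_trunc r.+2 f => tail.
    have tr : ordge r.+1 (series_of_mpoly t).
      rewrite -[series_of_mpoly t](subKr f); apply: (ordgeD IH).
      by rewrite -mulN1r; apply: ordgeM; apply: ordgeW tail.
    suff : ordge r.+2 (series_of_mpoly t).
      by move=> H; rewrite -[f](subrK (series_of_mpoly t)); apply: ordgeD.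
    apply: (subst_poly_ordge Gq Fq GF gp detY) => //.
      exact: principal_ordge.
    have G0 : G f = qpi (principal g) 0.
      by rewrite rmorph0; have [_ /(_ f) H _] := Gq; apply/H/gen_sub.
    have [z zr] := quot_map_trunc Gq fp r.+2 G0.
    rewrite -/t => /(principal_ordge gs) H.
    rewrite -[subst_poly _ _](addrK z); apply: ordgeD.
      rewrite -[_ + z]opprK -mulN1r; apply: ordgeM.
      by rewrite -[- _]add0r; apply: ordgeW H.
    by rewrite -mulN1r; apply: ordgeM.
  by case: (s) s2 main => [|r] // _; apply.
have [w0 Ew] : exists w0, subst_poly X p = w0 * f.
  apply/principalP/qpi_eq0; rewrite -(quot_map_poly Fq).
  by have [_ /(_ g) H _] := Fq; apply/H/gen_sub.
(* Otherwise g(X), hence g, would have order above s. *)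
have w0_unit : const_coef w0 != 0.
  apply/eqP => /ordge1P w1; apply: gs1.
  apply: (subst_poly_ordge Fq Gq FG fp detX) => //; first exact: ltnW.
    exact: principal_ordge.
  by rewrite -/X Ew -add1n; apply: ordge_mul.
have [v vw] := series_unit w0_unit.
have Ef : f = v * subst_poly X p by rewrite Ew mulrA vw mul1r.
have [c Ec] := euler_decomposition.
pose sg a := subst_poly X p^`M(a).
have Eg : subst_poly X p = \sum_a (c a *: X a) * sg a.
  rewrite {1}Ec rmorph_sum_mul3; apply: eq_bigr => a _; congr (_ * _).
  rewrite (rmorphM (subst_poly X)) subst_polyX.
  by rewrite (_ : subst_poly X (c a)%:MP = series_of_mpoly (c a)%:MP) ?series_const_mulE //;
    apply: mmapC.
pose N : 'M[R]_n := \matrix_(i, a) (series_deriv i (X a) - v * series_deriv i w0 * (c a *: X a)).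
have EN i : \sum_a N i a * sg a = w0 * series_deriv i f.
  have -> : w0 * series_deriv i f = series_deriv i (subst_poly X p) - series_deriv i w0 * f.
    by rewrite Ew series_derivM addrAC subrr add0r.
  rewrite series_deriv_subst [in X in _ - X]Ef Eg mulrCA mulrA mulr_sumr -sumrB.
  by apply: eq_bigr => a _; rewrite mxE mulrBl !mulrA.
have detN : \det (map_mx (@const_coef n k) N) != 0.
  suff -> : map_mx (@const_coef n k) N = linear_part X by [].
  apply/matrixP => i a; rewrite [LHS]mxE [N i a]mxE [RHS]mxE [jac X i a]mxE.
  rewrite rmorphB rmorphM [X in _ - _ * X](_ : _ = 0) ?mulr0 ?subr0 //.
  rewrite [LHS](_ : _ = c a * const_coef (X a)) //.
  by rewrite [const_coef (X a)](_ : _ = 0) ?mulr0 //; apply/ordge1P/(subst_var_ordge Fq gp a).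
have sJ a : jacobian_ideal f (sg a).
  apply: (linear_system_mem detN EN) => i; apply: idealM; apply: gen_sub; by exists i.
have fJ : ideal_set (principal f) `<=` ideal_set (jacobian_ideal f).
  move=> _ /principalP[q ->]; apply: idealM; rewrite {2}Ef; apply: idealM; rewrite Eg.
  by apply: ideal_sum => a _; apply: idealM; apply: sJ.
have gJ : ideal_set (principal g) `<=` ideal_set (jacobian_ideal g).
  have gE : g = \sum_a series_of_mpoly ((c a)%:MP * 'X_a) * series_of_mpoly p^`M(a).
    by rewrite /g {1}Ec rmorph_sum_mul3.
  move=> _ /principalP[q ->]; apply: idealM; rewrite {2}gE.
  apply: ideal_sum => a _; apply: idealM; apply: gen_sub; exists a => //.
  by rewrite series_deriv_mpoly.
have Fsg a : F (series_deriv a g) = qpi (principal f) (sg a).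
  by rewrite series_deriv_mpoly; apply: (quot_map_poly Fq).
apply: (quot_iso_enlarge Fq fJ) => x y Fxy; split=> [Jx|Jy].
  have [|y' Jy' Fy'] := @gen_lift k _ _ _ F _ [set sg a | a in [set: 'I_n]] _ x Jx.
    by move=> _ [a _ <-]; exists (sg a); [apply: gen_sub; exists a|].
  rewrite -[y](subrK y'); apply: idealD; first by apply/fJ/qpi_eq; rewrite -Fxy.
  by move: y' Jy' {Fy'}; apply: gen_min => _ [a _ <-]; apply: sJ.
have Sy : gen [set sg a | a in [set: 'I_n]] y.
  apply: gen_min Jy => _ [i _ <-].
  have -> : series_deriv i f = v * (w0 * series_deriv i f) by rewrite mulrA vw mul1r.
  rewrite -EN; apply: idealM; apply: ideal_sum => a _; apply: idealM.
  by apply: gen_sub; exists a.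
have [|x' Jx' Gx'] := @gen_lift k _ _ _ G [set sg a | a in [set: 'I_n]]
    [set series_deriv a g | a in [set: 'I_n]] _ y Sy.
  move=> _ [a _ <-]; exists (series_deriv a g); first by apply: gen_sub; exists a.
  exact/GF.
rewrite -[x](subrK x'); apply: idealD => //; apply/gJ/qpi_eq.
by rewrite -Gx'; apply/esym/FG.
Qed.

End Invariance.
End MilnorInvariance.

(** * Plane curves with two monomials *)

Section Binomials.
Variable (k : closedFieldType).
Hypothesis k_char0 : [pchar k] =i pred0.
Implicit Types (h : {mpseries k[2]}) (e : nat * nat).

Definition binom (e e' : nat * nat) : {mpoly k[2]} := 'X_[mon2 e.1 e.2] + 'X_[mon2 e'.1 e'.2].

Lemma natr_neq0 N : (0 < N)%N -> N%:R != 0 :> k.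
Proof. by rewrite (proj1 (pcharf0P k) k_char0) lt0n. Qed.

Lemma binom_supp e e' a : a \in msupp (binom e e') -> a = mon2 e.1 e.2 \/ a = mon2 e'.1 e'.2.
Proof.
rewrite mcoeff_msupp mcoeffD !mcoeffX; case: (mon2 e.1 e.2 =P a) => [->|_]; first by left.
by case: (mon2 e'.1 e'.2 =P a) => [->|_]; [right|rewrite addr0 eqxx].
Qed.

Lemma binom_supp_l e e' : mon2 e.1 e.2 \in msupp (binom e e').
Proof.
rewrite mcoeff_msupp mcoeffD !mcoeffX eqxx -natrD; apply: natr_neq0.
by rewrite addn_gt0.
Qed.

Lemma binomC e e' : binom e e' = binom e' e. Proof. exact: addrC. Qed.

Lemma order_pairs_binom m e e' u v : order_pairs m (binom e e') u v <->
  [/\ (0 < u)%N, (0 < v)%N, (m < u * e.1 + v * e.2)%N & (m < u * e'.1 + v * e'.2)%N].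
Proof.
split=> [[u0 v0 fuv]|[u0 v0 le le']].
  split=> //.
    by have := fuv _ (binom_supp_l e e'); rewrite mon2_0 mon2_1.
  by rewrite binomC in fuv; have := fuv _ (binom_supp_l e' e); rewrite mon2_0 mon2_1.
by split=> // a /binom_supp [->|->]; rewrite mon2_0 mon2_1.
Qed.

Lemma weighted_homog_binom a b d e e' :
  (e.1 * a + e.2 * b = d)%N -> (e'.1 * a + e'.2 * b = d)%N ->
  weighted_homog (weights2 a b) d (binom e e').
Proof.
move=> E E' c /binom_supp [->|->]; rewrite -/(wdeg _ _) wdeg_weights2 mon2_0 mon2_1 //.
Qed.

Definition point (x y : k) (i : 'I_2) : k := if i == ord0 then x else y.

Lemma meval_mon2 x y p q : ('X_[mon2 p q] : {mpoly k[2]}).@[point x y] = x ^+ p * y ^+ q.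
Proof. by rewrite mevalX -/(mmap1 _ _) mmap1_2 mon2_0 mon2_1. Qed.

Lemma meval_binom x y e e' :
  (binom e e').@[point x y] = x ^+ e.1 * y ^+ e.2 + x ^+ e'.1 * y ^+ e'.2.
Proof. by rewrite mevalD !meval_mon2. Qed.

Lemma wcomp_eval a b m j h (T : seq (nat * nat)) x y :
  (0 < a)%N -> (0 < b)%N -> (j <= m)%N -> uniq T ->
  {in T, forall e, (e.1 * a + e.2 * b)%N = j} ->
  (forall p q, (p * a + q * b)%N = j -> cf h (p, q) != 0 -> (p, q) \in T) ->
  (wcomp (weights2 a b) j (series_trunc m.+1 h)).@[point x y]
  = \sum_(e <- T) cf h e * (x ^+ e.1 * y ^+ e.2).
Proof.
move=> a0 b0 le_jm uT Tj hT.
have -> : wcomp (weights2 a b) j (series_trunc m.+1 h)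
    = \sum_(e <- T) cf h e *: 'X_[mon2 e.1 e.2].
  apply/mpolyP => c; rewrite mcoeff_wcomp mcoeff_trunc raddf_sum /=.
  pose ec := (c ord0, c ord_max); have cE : mon2 ec.1 ec.2 = c by apply: mon2K.
  have [ecT|ecT] := boolP (ec \in T).
    rewrite (bigD1_seq ec) //= big1 ?addr0 => [|e ne]; last first.
      rewrite mcoeffZ mcoeffX -cE; case: eqP => [/mon2_inj E|]; last by rewrite mulr0.
      by rewrite E eqxx in ne.
    have wj : wdeg (weights2 a b) c = j by rewrite wdeg_weights2; apply: (Tj ec ecT).
    rewrite wj eqxx mcoeffZ mcoeffX cE eqxx mulr1 ifT; first by rewrite /cf cE.
    have := mdeg_le_wdeg (weights2_gt0 a0 b0) c; rewrite wj ltnS => le.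
    exact: leq_trans le le_jm.
  rewrite big1_seq => [|e /= eT]; last first.
    rewrite mcoeffZ mcoeffX -cE; case: eqP => [/mon2_inj E|]; last by rewrite mulr0.
    by rewrite -E eT in ecT.
  case: eqP => // wj; case: ifP => // _; apply/eqP; apply: contraNT ecT => hc.
  by apply: hT; rewrite -?wj ?wdeg_weights2 // /cf cE.
rewrite raddf_sum; apply: eq_bigr => e _ /=.
by rewrite mevalZ meval_mon2.
Qed.

Lemma binom_point_vanish a b d e e' m j h (T : seq (nat * nat)) x y :
  (0 < a)%N -> (0 < b)%N ->
  (e.1 * a + e.2 * b = d)%N -> (e'.1 * a + e'.2 * b = d)%N ->
  jsc m (principal (series_of_mpoly (binom e e'))) h ->
  x ^+ e.1 * y ^+ e.2 + x ^+ e'.1 * y ^+ e'.2 = 0 ->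
  (j <= m)%N -> uniq T ->
  {in T, forall e, (e.1 * a + e.2 * b)%N = j} ->
  (forall p q, (p * a + q * b)%N = j -> cf h (p, q) != 0 -> (p, q) \in T) ->
  \sum_(e <- T) cf h e * (x ^+ e.1 * y ^+ e.2) = 0.
Proof.
move=> a0 b0 E E' hf fxy le_jm uT Tj hT.
rewrite -(wcomp_eval _ _ a0 b0 le_jm uT Tj hT).
apply: (jsc_weighted_homog_vanish (weights2_gt0 a0 b0) hf (weighted_homog_binom E E')) => //.
by rewrite meval_binom.
Qed.

(** The exponents under the Newton boundary defined by the order pairs: those
    of monomials outside the monomial ideal of the closure. *)
Definition staircase m (f : {mpoly k[2]}) : seq (nat * nat) :=
  [seq e <- [seq (p, q) | p <- iota 0 m.+1, q <- iota 0 m.+1] |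
    `[< exists u v, order_pairs m f u v /\ (e.1 * u + e.2 * v <= m)%N >]].

Lemma staircase_uniq m f : uniq (staircase m f).
Proof. by rewrite filter_uniq // allpairs_uniq ?iota_uniq // => -[? ?] [? ?]. Qed.

Lemma staircaseP m f p q : (p, q) \in staircase m f <->
  exists u v, order_pairs m f u v /\ (p * u + q * v <= m)%N.
Proof.
rewrite mem_filter; split=> [/andP[/asboolP //]|/[dup] H [u [v [[u0 v0 _] le]]]].
apply/andP; split; first exact/asboolP.
by apply: allpairs_f; rewrite mem_iota; nia.
Qed.

Lemma jsc_staircase m f h : jsc m (principal (series_of_mpoly f)) h ->
  {in staircase m f, forall e, cf h e = 0}.
Proof.
move=> hf [p q] /staircaseP [u [v [fuv le]]]; apply/eqP; apply: contraTT le => ne.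
by rewrite -ltnNge; have := jsc_order_pairs k_char0 fuv hf ne; rewrite mon2_0 mon2_1.
Qed.

Lemma staircase_jsc a b d m f h : (0 < a)%N -> (0 < b)%N -> gcdn a b = 1%N ->
  weighted_homog (weights2 a b) d f -> (m < d)%N ->
  {in staircase m f, forall e, cf h e = 0} -> jsc m (principal (series_of_mpoly f)) h.
Proof.
move=> a0 b0 gab fd lt_md hS; apply: (jsc_monomials_of_lt a0 b0 gab fd lt_md).
apply: (@plane_ideal_mem _ _ m.+1).
- apply: gen_sub; exists m.+1, 0%N; rewrite expr0 mulr1; split=> // u v [u0 _ _].
  by rewrite addn0 leq_pmulr.
- apply: gen_sub; exists 0%N, m.+1; rewrite expr0 mul1r; split=> // u v [_ v0 _].
  by rewrite leq_pmulr.
move=> p q hpq; apply: gen_sub; exists p, q; split=> // u v fuv; rewrite ltnNge.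
apply: contraNN hpq => le; apply/eqP/(hS (p, q))/staircaseP; by exists u, v.
Qed.

End Binomials.

(** * The simple types and their separation *)

Inductive simple_type := TypeA of nat | TypeD of nat | TypeE6 | TypeE7 | TypeE8.

Definition valid_type t := match t with
  | TypeA n => 0 < n | TypeD n => 3 < n | _ => true end%N.

Definition type_exponents t : (nat * nat) * (nat * nat) := match t with
  | TypeA n => ((n.+1, 0), (0, 2))
  | TypeD n => ((2, 1), (0, n.-1))
  | TypeE6 => ((3, 0), (0, 4))
  | TypeE7 => ((3, 0), (1, 3))
  | TypeE8 => ((3, 0), (0, 5)) end%N.

(** The weights (a, b) and the degree d. *)
Definition type_weights t : nat * nat * nat := match t with
  | TypeA n => if odd n then (1, n.+1./2, n.+1) else (2, n.+1, 2 * n.+1)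
  | TypeD n => if odd n then (n - 2, 2, 2 * n.-1) else (n.-2./2, 1, n.-1)
  | TypeE6 => (4, 3, 12)
  | TypeE7 => (3, 2, 9)
  | TypeE8 => (5, 3, 15) end%N.

Lemma type_weightsP t : valid_type t ->
  let: (a, b, d) := type_weights t in let: (e, e') := type_exponents t in
  [/\ (0 < a)%N, (0 < b)%N, (0 < d)%N, gcdn a b = 1%N &
     (e.1 * a + e.2 * b = d)%N /\ (e'.1 * a + e'.2 * b = d)%N].
Proof.
case: t => [n|n|||] //=; case: ifP => odd_n n0 /=.
- split=> //; first by lia.
  by rewrite gcd1n.
  by split; lia.
- split=> //; [by apply/eqP; rewrite -/(coprime _ _) coprime2n /= odd_n|by split; lia].
- split=> //; [lia|lia|by apply/eqP; rewrite -/(coprime _ _) coprimen2 oddB ?odd_n //; lia|].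
  by split; lia.
- by split=> //; [lia|lia|rewrite gcdn1|split; lia].
Qed.

Section Types.
Variable (k : closedFieldType).
Hypothesis k_char0 : [pchar k] =i pred0.
Implicit Types (h : {mpseries k[2]}) (t : simple_type).

Definition type_poly t : {mpoly k[2]} := binom k (type_exponents t).1 (type_exponents t).2.
Local Notation nf t := (series_of_mpoly (type_poly t)).

Lemma normal_form_type (g : {mpseries k[2]}) : simple_normal_form g ->
  exists2 t, valid_type t & g = nf t.
Proof.
have bE e e' : series_of_mpoly (binom k e e') =
    varx k ^+ e.1 * vary k ^+ e.2 + varx k ^+ e'.1 * vary k ^+ e'.2.
  by rewrite !monomialE -rmorphD.
case=> [n n1|n n4|||].
- by exists (TypeA n) => //; rewrite bE /= !expr0 mulr1 mul1r.
- exists (TypeD n) => //; rewrite bE /= expr0 mul1r expr1 mulrDr mulrC -exprS.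
  by congr (_ + _ ^+ _); lia.
- by exists TypeE6 => //; rewrite bE /= !expr0 mulr1 mul1r.
- by exists TypeE7 => //; rewrite bE /= expr0 mulr1 expr1 mulrDr -exprS.
- by exists TypeE8 => //; rewrite bE /= !expr0 mulr1 mul1r.
Qed.

Lemma cf_binom e e' c :
  cf (series_of_mpoly (binom k e e')) c = (e == c)%:R + (e' == c)%:R.
Proof. by rewrite /binom rmorphD /= -!cf_monomial. Qed.

Lemma type_order_pairs t m u v : order_pairs m (type_poly t) u v <->
  let: (e, e') := type_exponents t in
  [/\ (0 < u)%N, (0 < v)%N, (m < u * e.1 + v * e.2)%N & (m < u * e'.1 + v * e'.2)%N].
Proof. by rewrite (order_pairs_binom k_char0); case: type_exponents. Qed.

Lemma type_lower t m u v h e : order_pairs m (type_poly t) u v ->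
  jsc m (principal (nf t)) h -> (e.1 * u + e.2 * v <= m)%N -> cf h e = 0.
Proof.
move=> fuv hf le; apply: (jsc_staircase k_char0 hf); case: e le => p q le.
by apply/staircaseP; exists u, v.
Qed.

Lemma type_upper t m h : valid_type t -> (m < (type_weights t).2)%N ->
  {in staircase m (type_poly t), forall e, cf h e = 0} -> jsc m (principal (nf t)) h.
Proof.
move=> /type_weightsP; case: type_weights => -[a b] d /=.
rewrite /type_poly; case: type_exponents => e e' [a0 b0 d0 gab [E E']] lt.
apply: (staircase_jsc a0 b0 gab _ lt); exact: weighted_homog_binom.
Qed.

Lemma type_upper_list t m (S : seq (nat * nat)) h : valid_type t ->
  (m < (type_weights t).2)%N ->
  (forall p q u v, order_pairs m (type_poly t) u v -> (p * u + q * v <= m)%N -> (p, q) \in S) ->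
  {in S, forall e, cf h e = 0} -> jsc m (principal (nf t)) h.
Proof.
move=> tv lt tS hS; apply: type_upper => // -[p q] /staircaseP[u [v [fuv le]]].
by apply: hS; apply: tS fuv le.
Qed.

(** The isomorphism would give two quotients of the same dimension, at least
    the size of S and at most that of T. *)
Lemma no_iso_lists m t t' (S T : seq (nat * nat)) :
  (size T < size S)%N -> uniq S ->
  (forall h, jsc m (principal (nf t)) h -> {in S, forall e, cf h e = 0}) ->
  (forall h, {in T, forall e, cf h e = 0} -> jsc m (principal (nf t')) h) ->
  ~ quot_iso (jsc m (principal (nf t))) (jsc m (principal (nf t'))).
Proof.
move=> lt uS St Tt' iso; move: lt; rewrite ltnNge.
have tw0 e h : twisted (0, 0)%N (0, 0)%N 0 e h = cf h e.
  by rewrite /twisted mul0r if_same subr0.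
apply/negP; rewrite negbK.
apply: (plane_dim_le (e0 := (0, 0)%N) (e1 := (0, 0)%N) (c := 0)
  (e0' := (0, 0)%N) (e1' := (0, 0)%N) (c' := 0) iso uS) => // h hS.
  by move=> e eS; rewrite tw0; apply: St.
by apply: Tt' => e eT; rewrite -tw0; apply: hS.
Qed.

(** A lower bound of the Milnor number, exact for A_n, that leaves room for
    all separating orders below. *)
Definition milnor_bound t := match t with TypeA n => n | TypeD n => n.-1 | _ => 5 end%N.

Definition separated t t' := exists2 m, (m <= maxn (milnor_bound t) (milnor_bound t') + 1)%N &
  ~ quot_iso (jsc m (principal (nf t))) (jsc m (principal (nf t'))).

Lemma separated_sym t t' : separated t t' -> separated t' t.
Proof.
by case=> m le H; exists m; [rewrite maxnC|move=> /quot_iso_sym].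
Qed.

Definition is_A t := if t is TypeA _ then true else false.
Definition is_E t := match t with TypeA _ | TypeD _ => false | _ => true end.

(** At m = 2 the closure of a curve of multiplicity 3 is the cube of the
    maximal ideal, of codimension 6, while that of A_n contains the equation
    of the curve, of order 2. *)
Lemma separated_other_A n t : (0 < n)%N -> valid_type t -> ~~ is_A t -> separated t (TypeA n).
Proof.
move=> n0 tv tA; exists 2; first by case: t tv tA => //= [j|||]; lia.
move=> iso.
have pair11 : order_pairs 2 (type_poly t) 1 1.
  by apply/type_order_pairs; case: t tv tA {iso} => //= j j3 _; split=> //; lia.
suff : (6 <= 5)%N by [].
apply: (@plane_dim_le k _ _ [:: (0,0); (1,0); (0,1); (1,1); (2,0); (0,2)]%N
  [:: (0,0); (1,0); (0,1); (1,1); (2,0)]%N (0,0)%N (0,0)%N 0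
  (2,0)%N (0,2)%N (n == 1%N)%:R iso) => // h hI.
  move=> e eS; rewrite /twisted mul0r if_same subr0.
  apply: (type_lower pair11 hI); move: eS; rewrite !inE.
  by do 5?[case/orP]; move/eqP->.
pose f : {mpseries k[2]} := nf (TypeA n).
rewrite -[h](subrK (cf h (0, 2)%N *: f)); apply: idealD; last first.
  by rewrite -mulr_algl; apply/idealM/jsc_sub/gen_sub.
apply: jsc_ordge => e; rewrite -[e]mon2K => lt.
have {lt} : (e ord0 + e ord_max < 3)%N.
  move: lt; rewrite /mon2 mdegD !mdegMn !mdeg1; lia.
move: (e ord0) (e ord_max) => p q lt.
rewrite seriesBE seriesZE -/(cf h (p, q)) -/(cf f (p, q)) cf_binom /=.
have tw e' : e' \in [:: (0,0); (1,0); (0,1); (1,1); (2,0)]%N ->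
  cf h e' = if e' == (2,0)%N then (n == 1%N)%:R * cf h (0,2)%N else 0.
  by move/hI; rewrite /twisted => /eqP; rewrite subr_eq0 => /eqP.
case: n n0 {pair11 f hI iso} tw => // n _ tw.
have h00 := tw (0, 0)%N isT; have h10 := tw (1, 0)%N isT; have h01 := tw (0, 1)%N isT.
have h11 := tw (1, 1)%N isT; have h20 := tw (2, 0)%N isT.
move: (cf h) h00 h10 h01 h11 h20 => {tw} c /= h00 h10 h01 h11 h20.
case: p q lt => [|[|[|p]]] [|[|[|q]]] lt; try (exfalso; lia);
  rewrite ?h00 ?h10 ?h01 ?h11 ?h20 !xpair_eqE ?eqSS /= ?andbF ?andbT ?addr0 ?add0r;
  by rewrite ?mulr0 ?mulr1 ?subrr ?oppr0 // [_ * c _]mulrC subrr.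
Qed.

Lemma sqrtN1 : exists i : k, i ^+ 2 = -1.
Proof.
have [x Ex] := @solve_monicpoly k 2 (fun i => if i == 0%N then -1 else 0) isT.
by exists x; rewrite Ex !big_ord_recl big_ord0 /= expr0 mulr1 mul0r !addr0.
Qed.

(** At m = 3 the six exponents with 2 p + q <= 3 bound the dimension for the E
    types, whose cube of x forces u >= 2; D_n has at least seven, coming from
    the weights (1, 2) and one more coefficient. *)
Lemma separated_D_E n t : (3 < n)%N -> is_E t -> separated (TypeD n) t.
Proof.
move=> n3 tE; exists 3; first by case: t tE => //= _; lia.
apply: (@no_iso_lists _ _ _
  [:: (0,0); (1,0); (2,0); (3,0); (0,1); (1,1); (0,2)]%N
  [:: (0,0); (0,1); (0,2); (0,3); (1,0); (1,1)]%N) => // h hI.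
  have pair12 : order_pairs 3 (type_poly (TypeD n)) 1 2.
    by apply/type_order_pairs => /=; split=> //; lia.
  have low e : (e.1 * 1 + e.2 * 2 <= 3)%N -> cf h e = 0.
    exact: (type_lower pair12 hI).
  suff h02 : cf h (0, 2)%N = 0.
    by move=> e; rewrite !inE; do 6?[case/orP]; move/eqP-> => //; apply: low.
  have [n4|lt4n] : n = 4 \/ (4 < n)%N by lia.
    have [i i2] := sqrtN1; rewrite n4 in hI.
    have := @binom_point_vanish k 1 1 3 (2, 1)%N (0, 3)%N 3 2 h
      [:: (2,0); (1,1); (0,2)]%N i 1 isT isT erefl erefl hI _ isT isT.
    rewrite !expr1n i2 mulr1 expr0 mulr1 addNr => /(_ erefl) H.
    have {H} := H _ _.
    rewrite !big_cons big_nil !(low (2,0)%N, low (1,1)%N) // !mul0r !add0r addr0.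
    rewrite expr0 mul1r expr1n mulr1; apply.
      by move=> e; rewrite !inE; do 2?[case/orP]; move/eqP->.
    by move=> p q Epq _; rewrite !inE !xpair_eqE; lia.
  have pair21 : order_pairs 3 (type_poly (TypeD n)) 2 1.
    by apply/type_order_pairs => /=; split=> //; lia.
  exact: (type_lower pair21 hI).
move: hI; apply: type_upper_list; [by case: t tE|by case: t tE|].
move=> p q u v /type_order_pairs; rewrite !inE !xpair_eqE.
by case: t tE => //= _ [u0 v0 lt1 lt2] le; have u2 : (2 <= u)%N by [lia]; nia.
Qed.

(** At m = 4 the term y^4 forces v >= 2 for E_6, but not for the other two. *)
Lemma separated_E_E6 t : t = TypeE7 \/ t = TypeE8 -> separated t TypeE6.
Proof.
move=> tE; exists 4; first by case: tE => ->.
have tv : valid_type t by case: tE => ->.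
apply: (@no_iso_lists _ _ _
  [:: (0,0); (0,1); (0,2); (0,3); (0,4); (1,0); (1,1)]%N
  [:: (0,0); (0,1); (0,2); (1,0); (1,1); (2,0)]%N) => // h hI.
  have pair21 : order_pairs 4 (type_poly t) 2 1.
    by apply/type_order_pairs; case: tE => -> /=; split.
  move=> e eS; apply: (type_lower pair21 hI); move: eS.
  by rewrite !inE; do 6?[case/orP]; move/eqP->.
move: hI; apply: type_upper_list => // p q u v /type_order_pairs /=.
rewrite !inE !xpair_eqE => -[u0 v0 lt1 lt2] le.
by have u2 : (2 <= u)%N by [lia]; have v2 : (2 <= v)%N by [lia]; nia.
Qed.

(** At m = 5 the term y^5 forces v >= 2 for E_8, while E_7 admits the weights
    (3, 1). *)
Lemma separated_E7_E8 : separated TypeE7 TypeE8.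
Proof.
exists 5 => //.
apply: (@no_iso_lists _ _ _
  [:: (0,0); (0,1); (0,2); (0,3); (0,4); (0,5); (1,0)]%N
  [:: (0,0); (0,1); (0,2); (1,0); (1,1); (2,0)]%N) => // h hI.
  have pair31 : order_pairs 5 (type_poly TypeE7) 3 1.
    by apply/type_order_pairs => /=; split.
  move=> e eS; apply: (type_lower pair31 hI); move: eS.
  by rewrite !inE; do 6?[case/orP]; move/eqP->.
move: hI; apply: type_upper_list => // p q u v /type_order_pairs /=.
rewrite !inE !xpair_eqE => -[u0 v0 lt1 lt2] le.
by have u2 : (2 <= u)%N by [lia]; have v2 : (2 <= v)%N by [lia]; nia.
Qed.

(** Fewer order pairs mean a smaller staircase; the exponent e makes the
    inclusion strict. *)
Lemma no_iso_staircase m t t' e : valid_type t' -> (m < (type_weights t').2)%N ->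
  (forall u v, order_pairs m (type_poly t') u v -> order_pairs m (type_poly t) u v) ->
  e \in staircase m (type_poly t) -> e \notin staircase m (type_poly t') ->
  ~ quot_iso (jsc m (principal (nf t))) (jsc m (principal (nf t'))).
Proof.
move=> tv lt sub et et'.
apply: (@no_iso_lists _ _ _ (staircase m (type_poly t)) (staircase m (type_poly t'))).
- rewrite -[(size _).+1]/(size (e :: staircase m (type_poly t'))).
  apply: uniq_leq_size; first by rewrite /= et' staircase_uniq.
  move=> e'; rewrite inE => /orP[/eqP-> //|]; case: e' => p q.
  by move=> /staircaseP[u [v [/sub uv le]]]; apply/staircaseP; exists u, v.
- exact: staircase_uniq.
- by move=> h; apply: jsc_staircase.
- by move=> h; apply: type_upper.
Qed.

(** At m = n + 1 the curve A_n no longer admits the weight u = 1, which A_n'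
    does; both closures are monomial, as the degree of A_n is 2 n + 2. *)
Lemma separated_A_even n n' : (0 < n)%N -> (n < n')%N -> ~~ odd n ->
  separated (TypeA n') (TypeA n).
Proof.
move=> n0 lt odd_n; exists n.+1; first by rewrite /=; lia.
apply: (@no_iso_staircase _ _ _ (n.+1, 0)%N) => //=.
- by rewrite (negPf odd_n) /=; lia.
- move=> u v /type_order_pairs /= [u0 v0 lt1 lt2]; apply/type_order_pairs => /=.
  by split=> //; nia.
- apply/staircaseP; exists 1%N, n.+2; split; last by rewrite /=; lia.
  by apply/type_order_pairs => /=; split=> //; lia.
- apply/negP => /staircaseP[u [v [/type_order_pairs /= [u0 v0 lt1 lt2] le]]].
  by nia.
Qed.

(** At m = n - 1 the curve D_n no longer admits the weight v = 1, which D_n'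
    does; both closures are monomial, as the degree of D_n is 2 n - 2. *)
Lemma separated_D_odd n n' : (3 < n)%N -> (n < n')%N -> odd n ->
  separated (TypeD n') (TypeD n).
Proof.
move=> n3 lt odd_n; exists n.-1; first by rewrite /=; lia.
apply: (@no_iso_staircase _ _ _ (0, n.-1)%N) => //=.
- by rewrite odd_n /=; lia.
- move=> u v /type_order_pairs /= [u0 v0 lt1 lt2]; apply/type_order_pairs => /=.
  by split=> //; nia.
- apply/staircaseP; exists n, 1%N; split; last by rewrite /=; lia.
  by apply/type_order_pairs => /=; split=> //; lia.
- apply/negP => /staircaseP[u [v [/type_order_pairs /= [u0 v0 lt1 lt2] le]]].
  by nia.
Qed.

End Types.

(** * Types whose degree equals the separating order *)

Section TwistedTypes.
Variable (k : closedFieldType).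
Hypothesis k_char0 : [pchar k] =i pred0.
Implicit Types (h : {mpseries k[2]}) (t : simple_type).
Local Notation nf t := (series_of_mpoly (type_poly k t)).

(** The two choices of a square root of -1 are the two branches of the curve;
    adding and subtracting the resulting equations separates the coefficients.
    *)
Lemma plus_minus_eq0 (i c0 c1 : k) : i ^+ 2 = -1 ->
  c0 + i * c1 = 0 -> c0 - i * c1 = 0 -> c0 = 0 /\ c1 = 0.
Proof.
move=> i2 E1 E2; have two0 : (2%:R : k) != 0 by apply: natr_neq0.
have c0_0 : c0 = 0.
  apply/eqP; have /eqP : 2%:R * c0 = 0 by rewrite -[RHS](addr0 0) -{1}E1 -E2; ring.
  by rewrite mulf_eq0 (negPf two0).
split=> //; apply/eqP; have /eqP : i ^+ 2 * c1 = 0.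
  by rewrite expr2 -mulrA; move: E1; rewrite c0_0 add0r => ->; rewrite mulr0.
by rewrite i2 mulN1r oppr_eq0.
Qed.

(** For n + 1 = 2 b the branches are parametrised by (t, i t^b); weight p + b
    involves x^(p+b), x^p y and, for p = b, also y^2. *)
Lemma jsc_A_odd_coef b h p : (0 < b)%N -> (p <= b)%N ->
  jsc (b + b) (principal (series_of_mpoly (binom k (b + b, 0)%N (0, 2)%N))) h ->
  cf h (p, 1)%N = 0 /\
  cf h (p + b, 0)%N = if p == b then cf h (0, 2)%N else 0.
Proof.
move=> b0 le_pb hI; have [i i2] := sqrtN1 k.
pose T := [:: (p + b, 0); (p, 1)]%N ++ (if p == b then [:: (0, 2)%N] else [::]).
have T_in u v : (u * 1 + v * b = p + b)%N -> (u, v) \in T.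
  rewrite mem_cat !inE !xpair_eqE => E.
  case: v E => [|[|v]] E; [by apply/orP; left; lia|by apply/orP; left; lia|].
  have v0 : v = 0%N by nia.
  have Ep : p = b by nia.
  by apply/orP; right; rewrite Ep eqxx inE xpair_eqE; apply/andP; split; apply/eqP; nia.
have van y : y ^+ 2 = -1 -> \sum_(e <- T) cf h e * (1 ^+ e.1 * y ^+ e.2) = 0.
  move=> y2; apply: (@binom_point_vanish k 1 b (b + b) _ _ _ (p + b) _ _ 1 y isT b0 _ _ hI).
  - by rewrite /=; lia.
  - by rewrite /=; lia.
  - by rewrite /= expr1n y2 expr0 !mul1r subrr.
  - by rewrite leq_add2r.
  - by rewrite /T; case: eqP => /= _; rewrite !inE !xpair_eqE /= !andbF.
  - move=> e; rewrite mem_cat !inE => /orP[/orP[]/eqP->|] /=; [lia|lia|].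
    by case: eqP => // ->; rewrite inE => /eqP-> /=; lia.
  - by move=> u v E _; apply: T_in.
have main y : y ^+ 2 = -1 ->
    cf h (p + b, 0)%N - (if p == b then cf h (0, 2)%N else 0) + y * cf h (p, 1)%N = 0.
  move=> y2; rewrite -[RHS](van y y2) /T big_cat !big_cons big_nil /= !expr1n expr0 expr1.
  case: eqP => _; rewrite ?big_cons ?big_nil /= ?expr0 ?y2; ring.
have [] := plus_minus_eq0 i2 (main i i2) _.
  by rewrite -mulNr; apply: main; rewrite sqrrN.
by move=> /eqP; rewrite subr_eq0 => /eqP -> ->.
Qed.

(** At m = n + 1, the degree of A_n, the closure of A_n is no longer monomial.
    The relation between x^(n+1) and y^2 restores the coefficient lost in the
    staircase, and x^b y, absent from the staircase of A_n', gives one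
    dimension more. *)
Lemma separated_A_odd n n' : (0 < n)%N -> (n < n')%N -> odd n ->
  separated k (TypeA n) (TypeA n').
Proof.
move=> n0 lt odd_n; exists n.+1; first by rewrite /=; lia.
have [b [b0 En]] : exists b, (0 < b)%N /\ n.+1 = (b + b)%N.
  by exists n.+1./2; lia.
move=> iso; pose m := (b + b)%N; pose S := staircase m (type_poly k (TypeA n')).
have stair p q : (p, q) \in S -> (q = 0 /\ p <= m)%N \/ (q = 1 /\ p < b)%N.
  move=> /staircaseP[u [v [/(type_order_pairs k_char0) /= [u0 v0 lt1 lt2] le]]].
  rewrite /m in le lt1 lt2 *.
  have vb : (b < v)%N by lia.
  case: q le => [|[|q]] le; [left|right|]; first by nia.
    by nia.
  exfalso; nia.
have : (size ((b, 1)%N :: S) <= size S)%N.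
  rewrite En -/m in iso.
  apply: (@plane_dim_le k _ _ _ _ (m, 0)%N (0, 2)%N 1 (0,0)%N (0,0)%N 0 iso).
  - rewrite /= staircase_uniq andbT; apply/negP => /stair []; lia.
  - by rewrite inE xpair_eqE andbF /= => /stair[]; lia.
  - move=> h; rewrite /type_poly /= En => hI e; rewrite /twisted mul1r inE.
    have coefs p le := @jsc_A_odd_coef b h p b0 le hI.
    case/orP=> [/eqP->|].
      by have [-> _] := coefs b (leqnn b); rewrite xpair_eqE andbF subr0.
    case: e => p q /stair [[-> le]|[-> lt_pb]]; last first.
      by have [-> _] := coefs p (ltnW lt_pb); rewrite xpair_eqE andbF subr0.
    rewrite xpair_eqE eqxx andbT; have [le_bp|lt_pb] := leqP b p.
      have le' : (p - b <= b)%N by rewrite /m in le; lia.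
      have [_] := coefs _ le'; rewrite subnK // => ->.
      rewrite (_ : (p - b == b)%N = (p == m)); last by rewrite /m; lia.
      by case: eqP => _; rewrite subrr.
    rewrite (_ : (p == m) = false); last by rewrite /m; lia.
    rewrite subr0; apply: (jsc_staircase k_char0 hI); apply/staircaseP.
    exists 2, b.+1; split; last by lia.
    by apply/(order_pairs_binom k_char0) => /=; split=> //; lia.
  - move=> h hS; apply: type_upper => //=; first by lia.
      by rewrite /m -En; case: ifP => _ /=; lia.
    by move=> e eS; have := hS e eS; rewrite /twisted mul0r if_same subr0.
by rewrite /= ltnn.
Qed.

(** The line y = 0 is a branch of D_n. *)
Lemma jsc_D_even_coef0 a h p : (0 < a)%N -> (p * a <= a + a + 1)%N ->
  jsc (a + a + 1) (principal (series_of_mpoly (binom k (2, 1)%N (0, a + a + 1)%N))) h ->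
  cf h (p, 0)%N = 0.
Proof.
move=> a0 le hI.
pose T := [seq (u, (p - u) * a)%N | u <- iota 0 p.+1].
have : \sum_(e <- T) cf h e * (1 ^+ e.1 * 0 ^+ e.2) = 0.
  apply: (@binom_point_vanish k a 1 (a + a + 1) _ _ _ (p * a) _ _ 1 0 a0 isT _ _ hI).
  - by rewrite /=; lia.
  - by rewrite /=; lia.
  - by rewrite /= expr1 mulr0 addn1 exprS mul0r mulr0 addr0.
  - exact: le.
  - by rewrite map_inj_uniq ?iota_uniq // => ? ? [].
  - move=> e /mapP[u]; rewrite mem_iota => up -> /=; nia.
  - move=> u v E _; apply/mapP; exists u; first by rewrite mem_iota; nia.
    by congr (_, _); nia.
rewrite big_map -[p.+1]addn1 iotaD big_cat /= big_cons big_nil subnn mul0n expr1n expr0.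
rewrite mulr1 mulr1 addr0 big1_seq ?add0r // => u; rewrite mem_iota /= => up.
have : (0 < (p - u) * a)%N by nia.
by case: ((p - u) * a)%N => // j _; rewrite exprS mul0r !mulr0.
Qed.

(** For n = 2 a + 2 the branches other than y = 0 are parametrised by (i t^a,
    t); weight a + q involves y^(a+q), x y^q and, for q = a + 1, also x^2 y.
    *)
Lemma jsc_D_even_coef a h q : (0 < a)%N -> (q <= a.+1)%N ->
  jsc (a + a + 1) (principal (series_of_mpoly (binom k (2, 1)%N (0, a + a + 1)%N))) h ->
  cf h (1, q)%N = 0 /\
  cf h (0, a + q)%N = if q == a.+1 then cf h (2, 1)%N else 0.
Proof.
move=> a0 le_qa hI; have [i i2] := sqrtN1 k.
have h0 p : (p * a <= a + a + 1)%N -> cf h (p, 0)%N = 0.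
  by move=> le; apply: jsc_D_even_coef0 hI.
pose T := [:: (0, a + q); (1, q)]%N ++ (if q == a.+1 then [:: (2, 1)%N] else [::]).
have T_in u v : (u * a + v * 1 = a + q)%N -> cf h (u, v) != 0 -> (u, v) \in T.
  rewrite mem_cat !inE !xpair_eqE => E.
  case: u E => [|[|u]] E ne; [by apply/orP; left; lia|by apply/orP; left; lia|].
  case: v E ne => [|v] E ne.
    by case/eqP: ne; apply: h0; lia.
  have u0 : u = 0%N by nia.
  have Eq : q = a.+1 by nia.
  by apply/orP; right; rewrite Eq eqxx inE xpair_eqE; apply/andP; split; apply/eqP; nia.
have van x : x ^+ 2 = -1 -> \sum_(e <- T) cf h e * (x ^+ e.1 * 1 ^+ e.2) = 0.
  move=> x2; apply: (@binom_point_vanish k a 1 (a + a + 1) _ _ _ (a + q) _ _ x 1 a0 isT _ _ hI).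
  - by rewrite /=; lia.
  - by rewrite /=; lia.
  - by rewrite /= !expr1n x2 expr0 !mulr1 addNr.
  - by lia.
  - by rewrite /T; case: eqP => /= _; rewrite ?inE ?xpair_eqE.
  - move=> e; rewrite mem_cat !inE => /orP[/orP[]/eqP->|] /=; [lia|lia|].
    by case: eqP => // ->; rewrite inE => /eqP-> /=; lia.
  - by move=> u v; apply: T_in.
have main x : x ^+ 2 = -1 ->
    cf h (0, a + q)%N - (if q == a.+1 then cf h (2, 1)%N else 0) + x * cf h (1, q)%N = 0.
  move=> x2; rewrite -[RHS](van x x2) /T big_cat !big_cons big_nil /= !expr1n expr0 expr1.
  case: eqP => _; rewrite ?big_cons ?big_nil /= ?expr1n ?expr0 ?x2; ring.
have [] := plus_minus_eq0 i2 (main i i2) _.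
  by rewrite -mulNr; apply: main; rewrite sqrrN.
by move=> /eqP; rewrite subr_eq0 => /eqP -> ->.
Qed.

(** At m = n - 1, the degree of D_n, the relation between y^(n-1) and x^2 y
    restores the coefficient lost in the staircase, and x y^(a+1), absent from
    the staircase of D_n', gives one dimension more. *)
Lemma separated_D_even n n' : (3 < n)%N -> (n < n')%N -> ~~ odd n ->
  separated k (TypeD n) (TypeD n').
Proof.
move=> n3 lt odd_n; exists n.-1; first by rewrite /=; lia.
have [a [a0 En]] : exists a, (0 < a)%N /\ n.-1 = (a + a + 1)%N.
  by exists (n.-2./2); lia.
move=> iso; pose m := (a + a + 1)%N; pose S := staircase m (type_poly k (TypeD n')).
have stair p q : (p, q) \in S -> exists u v, [/\ (0 < u)%N, (0 < v)%N,
    (m < u * 2 + v)%N & (p * u + q * v <= m)%N].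
  move=> /staircaseP[u [v [/(type_order_pairs k_char0) /= [u0 v0 lt1 lt2] le]]].
  by exists u, v; rewrite muln1 in lt1.
have : (size ((1, a.+1)%N :: S) <= size S)%N.
  rewrite En -/m in iso.
  apply: (@plane_dim_le k _ _ _ _ (0, m)%N (2, 1)%N 1 (0,0)%N (0,0)%N 0 iso).
  - rewrite /= staircase_uniq andbT; apply/negP => /stair [u [v [u0 v0 lt1]]].
    by rewrite /m in lt1 *; case: v v0 lt1 => [|[|v]] // v0 lt1 le; nia.
  - rewrite inE xpair_eqE /= => /stair [u [v [u0 v0 lt1]]]; lia.
  - move=> h; rewrite /type_poly /= En => hI e; rewrite /twisted mul1r inE.
    have coefs q le := @jsc_D_even_coef a h q a0 le hI.
    case/orP=> [/eqP->|].
      by have [-> _] := coefs a.+1 (leqnn _); rewrite xpair_eqE subr0.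
    case: e => p q /stair [u [v [u0 v0 lt1 le]]].
    have [v1|v2] : v = 1%N \/ (1 < v)%N by lia.
      (* The pairs with v = 1 are those that D_n does not admit; here the arcs on
         the branches take over. *)
      have ua : (a < u)%N by rewrite /m v1 in lt1; lia.
      rewrite /m v1 in le.
      case: p le => [|[|p]] le; last by exfalso; nia.
        rewrite xpair_eqE eqxx andTb; have [le_aq|lt_qa] := leqP a q.
          have le' : (q - a <= a.+1)%N by lia.
          have [_] := coefs _ le'; rewrite addnC subnK // => ->.
          rewrite (_ : (q - a == a.+1)%N = (q == m)); last by rewrite /m; lia.
          by case: eqP => _; rewrite subrr.
        rewrite (_ : (q == m) = false); last by rewrite /m; lia.
        rewrite subr0; apply: (jsc_staircase k_char0 hI); apply/staircaseP.
        exists a, 2; split; last by lia.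
        by apply/(order_pairs_binom k_char0) => /=; split=> //; lia.
      have le' : (q <= a.+1)%N by nia.
      by have [-> _] := coefs q le'; rewrite xpair_eqE subr0.
    have e_ne : ((p, q) == (0, m)%N) = false.
      by rewrite xpair_eqE; apply/negP => /andP[/eqP p0 /eqP qm]; rewrite p0 qm in le; nia.
    rewrite e_ne subr0; apply: (jsc_staircase k_char0 hI); apply/staircaseP.
    exists u, v; split=> //.
    by apply/(order_pairs_binom k_char0) => /=; rewrite /m in lt1; split=> //; nia.
  - move=> h hS; apply: type_upper; first by rewrite /=; lia.
      by rewrite /m -En /=; case: ifP => _ /=; lia.
    by move=> e eS; have := hS e eS; rewrite /twisted mul0r if_same subr0.
by rewrite /= ltnn.
Qed.

End TwistedTypes.

(** * Milnor numbers of the simple types *)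

Section VanishIdeal.
Variables (k : fieldType) (S : nat * nat -> Prop).
Hypothesis down : forall p q p' q', S (p, q) -> (p' <= p)%N -> (q' <= q)%N -> S (p', q').
Implicit Types h : {mpseries k[2]}.

Fact vanish0 : forall e, S e -> cf (0 : {mpseries k[2]}) e = 0. Proof. by []. Qed.
Fact vanishD g h : (forall e, S e -> cf g e = 0) -> (forall e, S e -> cf h e = 0) ->
  forall e, S e -> cf (g + h) e = 0.
Proof. by move=> g0 h0 e Se; rewrite /cf seriesDE [X in X + _]g0 // [X in _ + X]h0 // addr0. Qed.
Fact vanishM g h : (forall e, S e -> cf h e = 0) -> forall e, S e -> cf (g * h) e = 0.
Proof.
move=> h0 [p q] Se; rewrite /cf seriesE_mul big1 // => -[a b] /= /eqP E.
rewrite -[h _]/(h (bmnm b)) -(mon2K b) -/(cf h (b ord0, b ord_max)) h0 ?mulr0 //.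
apply: down Se _ _.
  have := leq_addl (a ord0) (b ord0); have /mnmP/(_ ord0) := E.
  by rewrite mon2_0 mnmDE => <-.
have := leq_addl (a ord_max) (b ord_max); have /mnmP/(_ ord_max) := E.
by rewrite mon2_1 mnmDE => <-.
Qed.
(** The monomial ideal spanned by the exponents outside S. *)
Definition vanish_ideal : ideal {mpseries k[2]} :=
  @Ideal _ [set h | forall e, S e -> cf h e = 0] vanish0 vanishD vanishM.
End VanishIdeal.

Section MilnorBound.
Variable (k : closedFieldType).
Hypothesis k_char0 : [pchar k] =i pred0.
Implicit Types (h : {mpseries k[2]}) (t : simple_type).
Local Notation nf t := (series_of_mpoly (type_poly k t)).
Local Notation x := (varx k).
Local Notation y := (vary k).

Lemma deriv0_binom e e' : series_deriv ord0 (series_of_mpoly (binom k e e')) =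
  e.1%:R *: (x ^+ e.1.-1 * y ^+ e.2) + e'.1%:R *: (x ^+ e'.1.-1 * y ^+ e'.2).
Proof.
rewrite series_deriv_mpoly mderivD !mderivX !mon2_0 rmorphD /= !linearZ /= !monomialE.
by congr (_ *: series_of_mpoly 'X_[_] + _ *: series_of_mpoly 'X_[_]);
  apply: mnm2_eq; rewrite mnmBE mnm1E ?(mon2_0, mon2_1) ?subn1 ?subn0.
Qed.

Lemma deriv1_binom e e' : series_deriv ord_max (series_of_mpoly (binom k e e')) =
  e.2%:R *: (x ^+ e.1 * y ^+ e.2.-1) + e'.2%:R *: (x ^+ e'.1 * y ^+ e'.2.-1).
Proof.
rewrite series_deriv_mpoly mderivD !mderivX !mon2_1 rmorphD /= !linearZ /= !monomialE.
by congr (_ *: series_of_mpoly 'X_[_] + _ *: series_of_mpoly 'X_[_]);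
  apply: mnm2_eq; rewrite mnmBE mnm1E ?(mon2_0, mon2_1) ?subn1 ?subn0.
Qed.

Lemma ideal_scale (I : ideal {mpseries k[2]}) N h : (0 < N)%N -> I (N%:R *: h) -> I h.
Proof.
move=> N0 Ih; have := idealM ((N%:R^-1 : k)%:A) Ih.
by rewrite mulr_algl scalerA mulVf ?scale1r //; apply: natr_neq0.
Qed.

Lemma idealB (A : comNzRingType) (I : ideal A) (g h : A) : I g -> I h -> I (g - h).
Proof. by move=> Ig Ih; apply: idealD => //; rewrite -mulN1r; apply: idealM. Qed.

Lemma ideal_exp_le (A : comNzRingType) (I : ideal A) (g : A) M N :
  (M <= N)%N -> I (g ^+ M) -> I (g ^+ N).
Proof. by move=> le IM; rewrite -(subnK le) exprD; apply: idealM. Qed.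

(** Makes the Jacobian algebra finite dimensional, so that its dimension is
    not the default value 0. *)
Lemma jacobian_powers t : valid_type t -> exists N,
  jacobian_ideal (nf t) (x ^+ N) /\ jacobian_ideal (nf t) (y ^+ N).
Proof.
set J := jacobian_ideal (nf t) => tv.
have J0 : J (series_deriv ord0 (nf t)) by apply: gen_sub; exists ord0.
have J1 : J (series_deriv ord_max (nf t)) by apply: gen_sub; exists ord_max.
rewrite deriv0_binom in J0; rewrite deriv1_binom in J1.
move: J J0 J1 => J.
case: t tv => [n|n|||] /= tv.
- rewrite !scale0r addr0 add0r expr0 mul1r mulr1 expr1 => J0 J1.
  have {}J0 := ideal_scale (ltn0Sn n) J0.
  have {}J1 : J y := @ideal_scale J 2 y isT J1.
  exists n; split=> //; apply: (@ideal_exp_le _ _ _ 1) => //; by rewrite expr1.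
- rewrite scale0r addr0 scale1r !expr1 !expr0 mulr1 mul1r => J0 J1.
  have {}J0 : J (x * y) := @ideal_scale J 2 (x * y) isT J0.
  case: n tv J1 => [|[|[|n]]] //= _ J1.
  exists n.+3; split.
    apply: (@ideal_exp_le _ _ _ 3) => //.
    have -> : x ^+ 3 = x * (x ^+ 2 + n.+2%:R *: y ^+ n.+1) - (n.+2%:R *: y ^+ n) * (x * y).
      rewrite mulrDr -scalerAr -scalerAl (_ : y ^+ n * (x * y) = x * y ^+ n.+1).
        by rewrite addrK -exprS.
      by rewrite exprSr mulrCA.
    by apply: idealB; apply: idealM.
  apply: (@ideal_exp_le _ _ _ n.+2) => //.
  apply: (@ideal_scale J n.+2) => //.
  have -> : n.+2%:R *: y ^+ n.+2 = y * (x ^+ 2 + n.+2%:R *: y ^+ n.+1) - x * (x * y).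
    rewrite mulrDr -scalerAr -exprS (_ : y * x ^+ 2 = x * (x * y)).
      by rewrite addrAC subrr add0r.
    by rewrite expr2 mulrA (mulrC y) -mulrA (mulrC y).
  by apply: idealB; apply: idealM.
- rewrite !scale0r addr0 add0r expr0 mul1r mulr1 => J0 J1.
  have {}J0 := @ideal_scale J 3 (x ^+ 2) isT J0.
  have {}J1 := @ideal_scale J 4 (y ^+ 3) isT J1.
  by exists 3; split=> //; apply: ideal_exp_le J0.
- rewrite scale0r add0r scale1r expr0 expr1 mul1r mulr1 => J0 J1.
  have {}J1 := @ideal_scale J 3 (x * y ^+ 2) isT J1.
  exists 5; split.
    apply: (@ideal_exp_le _ _ _ 3) => //; apply: (@ideal_scale J 3) => //.
    have -> : 3%:R *: x ^+ 3 = x * (3%:R *: x ^+ 2 + y ^+ 3) - y * (x * y ^+ 2).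
      by rewrite mulrDr -scalerAr -exprS (mulrCA y) -exprS addrK.
    by apply: idealB; apply: idealM.
  have -> : y ^+ 5 = y ^+ 2 * (3%:R *: x ^+ 2 + y ^+ 3) - (3%:R *: x) * (x * y ^+ 2).
    rewrite mulrDr -scalerAr -scalerAl (_ : y ^+ 2 * x ^+ 2 = x * (x * y ^+ 2)).
      by rewrite addrAC subrr add0r -exprD.
    by rewrite mulrA -expr2 mulrC.
  by apply: idealB; apply: idealM.
- rewrite !scale0r addr0 add0r expr0 mul1r mulr1 => J0 J1.
  have {}J0 := @ideal_scale J 3 (x ^+ 2) isT J0.
  have {}J1 := @ideal_scale J 5 (y ^+ 4) isT J1.
  by exists 4; split=> //; apply: ideal_exp_le J0.
Qed.

Lemma cf_deriv0 h p q : cf (series_deriv ord0 h) (p, q) = cf h (p.+1, q) *+ p.+1.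
Proof.
rewrite /cf /= mon2_0; congr (h _ *+ _).
by apply: mnm2_eq; rewrite mnmDE mnm1E ?(mon2_0, mon2_1) /= ?addn1 ?addn0.
Qed.
Lemma cf_deriv1 h p q : cf (series_deriv ord_max h) (p, q) = cf h (p, q.+1) *+ q.+1.
Proof.
rewrite /cf /= mon2_1; congr (h _ *+ _).
by apply: mnm2_eq; rewrite mnmDE mnm1E ?(mon2_0, mon2_1) /= ?addn1 ?addn0.
Qed.

(** A set of exponents closed under divisors, with no monomial of a partial
    derivative in it: the corresponding monomials are independent in the
    Jacobian algebra. *)
Definition milnor_exponents t : seq (nat * nat) := match t with
  | TypeA n => [seq (p, 0) | p <- iota 0 n]
  | TypeD n => (1, 0) :: [seq (0, q) | q <- iota 0 n.-2]
  | _ => [:: (0, 0); (1, 0); (0, 1); (0, 2); (1, 1)] end%N.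

Lemma milnor_exponents_size t : valid_type t ->
  size (milnor_exponents t) = milnor_bound t /\ uniq (milnor_exponents t).
Proof.
case: t => [n|n|||] //= n0; rewrite ?size_map ?size_iota.
  by rewrite map_inj_uniq ?iota_uniq // => ? ? [].
rewrite map_inj_uniq ?iota_uniq ?andbT; last by move=> ? ? [].
by split; [lia|apply/mapP => -[]].
Qed.

Lemma milnor_exponents_down t p q p' q' : valid_type t ->
  (p, q) \in milnor_exponents t ->
  (p' <= p)%N -> (q' <= q)%N -> (p', q') \in milnor_exponents t.
Proof.
case: t => [n|n|||] /= n0; try by rewrite !inE !xpair_eqE; lia.
  move=> /mapP[u]; rewrite mem_iota => un [-> ->] le; rewrite leqn0 => /eqP->.
  by apply: map_f; rewrite mem_iota; lia.
rewrite inE => pq le_p le_q; rewrite inE; case/orP: pq => [/eqP[Ep Eq]|/mapP[u]].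
  rewrite Ep Eq leqn0 in le_p le_q; move/eqP: le_q => ->.
  case: p' le_p => [|[|//]] _ //; apply/orP; right; apply: map_f.
  by rewrite mem_iota; lia.
rewrite mem_iota => un [Ep Eq]; rewrite Ep Eq leqn0 in le_p le_q.
by move/eqP: le_p => ->; apply/orP; right; apply: map_f; rewrite mem_iota; lia.
Qed.

Lemma jacobian_milnor_exponents t h : valid_type t -> jacobian_ideal (nf t) h ->
  {in milnor_exponents t, forall e, cf h e = 0}.
Proof.
move=> tv; move: h.
apply: (@gen_min _ _ (vanish_ideal k (fun p q p' q' => @milnor_exponents_down t p q p' q' tv))).
move=> _ [i _ <-] [p q] pq; case: (unliftP ord_max i) => [j|] ->.
  rewrite (ord1 j) (_ : lift ord_max 0 = ord0); last exact: val_inj.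
  rewrite cf_deriv0 cf_binom; move: pq; case: t tv => [n|n|||] /= n0.
  - move=> /mapP[u]; rewrite mem_iota => un [-> ->]; rewrite !xpair_eqE eqSS.
    by rewrite (_ : (n == u) = false) /= ?addr0 ?mul0rn //; lia.
  - rewrite inE => /orP[/eqP[-> ->]|/mapP[u]]; first by rewrite /= addr0 mul0rn.
    by rewrite mem_iota => un [-> ->]; rewrite !xpair_eqE /= addr0 mul0rn.
  - by rewrite !inE; do 4?[case/orP]; move=> /eqP[-> ->]; rewrite /= addr0 mul0rn.
  - by rewrite !inE; do 4?[case/orP]; move=> /eqP[-> ->]; rewrite /= addr0 mul0rn.
  - by rewrite !inE; do 4?[case/orP]; move=> /eqP[-> ->]; rewrite /= addr0 mul0rn.
rewrite cf_deriv1 cf_binom; move: pq; case: t tv => [n|n|||] /= n0.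
- move=> /mapP[u]; rewrite mem_iota => un [-> ->]; rewrite !xpair_eqE.
  by rewrite !andbF /= addr0 mul0rn.
- rewrite inE => /orP[/eqP[-> ->]|/mapP[u]]; first by rewrite !xpair_eqE /= addr0 mul0rn.
  rewrite mem_iota => un [-> ->]; rewrite !xpair_eqE /=.
  by rewrite (_ : (n.-1 == u.+1) = false) /= ?addr0 ?mul0rn //; lia.
- by rewrite !inE; do 4?[case/orP]; move=> /eqP[-> ->]; rewrite /= addr0 mul0rn.
- by rewrite !inE; do 4?[case/orP]; move=> /eqP[-> ->]; rewrite /= addr0 mul0rn.
- by rewrite !inE; do 4?[case/orP]; move=> /eqP[-> ->]; rewrite /= addr0 mul0rn.
Qed.

Lemma type_milnor_ge t : valid_type t -> (milnor_bound t <= milnor_number (nf t))%N.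
Proof.
move=> tv; have [<- uS] := milnor_exponents_size tv.
have [N [xN yN]] := jacobian_powers tv.
apply: (@plane_dimk_ge k _ _ [seq (p, q) | p <- iota 0 N, q <- iota 0 N] uS).
  by move=> h; apply: jacobian_milnor_exponents.
move=> h hS; apply: (plane_ideal_mem xN yN) => p q ne.
have [le_Np|lt_pN] := leqP N p; first by rewrite mulrC; apply: idealM; apply: ideal_exp_le xN.
have [le_Nq|lt_qN] := leqP N q; first by apply: idealM; apply: ideal_exp_le yN.
case/eqP: ne; apply: (hS (p, q)); apply: allpairs_f; by rewrite mem_iota.
Qed.

Lemma type_ordge2 t : valid_type t -> ordge 2 (nf t).
Proof.
move=> tv e lt; apply: memN_msupp_eq0; apply/negP => /binom_supp.
case: t tv => [n|n|||] /= n0 [] E; move: lt; rewrite E /mon2 mdegD !mdegMn !mdeg1; lia.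
Qed.

Lemma type_neq0 t : nf t != 0.
Proof.
apply/eqP => /(congr1 (fun h : {mpseries k[2]} => h (mon2 (type_exponents t).1.1 (type_exponents t).1.2))).
by move=> /eqP; apply/negP; rewrite -mcoeff_msupp; apply: binom_supp_l.
Qed.

Lemma type_milnor_eq t (f : {mpseries k[2]}) : valid_type t ->
  quot_iso (principal (nf t)) (principal f) -> milnor_number f = milnor_number (nf t).
Proof.
move=> tv iso; apply/esym/dimk_iso; have := type_weightsP tv.
case Ew : (type_weights t) => [[a b] d]; case Ee : (type_exponents t) => [e e'].
case=> a0 b0 d0 _ [E E'].
apply: (@quot_iso_jacobian _ _ k_char0 (weights2 a b) d _ _ d0 _ _ _ iso).
- by rewrite /type_poly Ee; apply: weighted_homog_binom.
- exact: type_ordge2.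
- exact: type_neq0.
Qed.

Lemma type_proper t : valid_type t -> ~ principal (nf t) 1.
Proof. by move=> tv; apply: ordge1_proper; apply: ordgeW (type_ordge2 tv). Qed.

Lemma types_separated t t' : valid_type t -> valid_type t' -> t <> t' -> separated k t t'.
Proof.
case: t t' => [n|n|||] [n'|n'|||] tv tv' ne //=.
all: try by [apply: separated_other_A | apply/separated_sym/separated_other_A].
all: try by [apply: separated_D_E | apply/separated_sym/separated_D_E].
all: try by case: ne.
- wlog lt : n n' tv tv' {ne} / (n < n')%N.
    move=> H; have [lt|lt|E] := ltngtP n n'; [exact: H|exact/separated_sym/H|].
    by case: ne; rewrite E.
  case: (boolP (odd n)) => odd_n; first exact: separated_A_odd.
  exact/separated_sym/separated_A_even.
- wlog lt : n n' tv tv' {ne} / (n < n')%N.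
    move=> H; have [lt|lt|E] := ltngtP n n'; [exact: H|exact/separated_sym/H|].
    by case: ne; rewrite E.
  case: (boolP (odd n)) => odd_n; last exact: separated_D_even.
  exact/separated_sym/separated_D_odd.
- by apply/separated_sym/(separated_E_E6 k_char0); left.
- by apply/separated_sym/(separated_E_E6 k_char0); right.
- by apply: (separated_E_E6 k_char0); left.
- exact: separated_E7_E8.
- by apply: (separated_E_E6 k_char0); right.
- exact/separated_sym/separated_E7_E8.
Qed.

(** The closures and Milnor numbers only depend on the algebra, so the curves
    may be replaced by their normal forms; distinct normal forms are told
    apart by the dimension of a closure of order at most M + 1. *)
Theorem simple_curve_jsc_iso (f1 f2 : {mpseries k[2]}) :
  simple_curve f1 -> simple_curve f2 ->
  (quot_iso (principal f1) (principal f2)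
   <-> forall m : nat,
         (m <= maxn (milnor_number f1) (milnor_number f2) + 1)%N ->
         quot_iso (jsc m (principal f1)) (jsc m (principal f2))).
Proof.
move=> [_ /normal_form_type[t1 tv1 ->] iso1] [_ /normal_form_type[t2 tv2 ->] iso2].
have proper (f : {mpseries k[2]}) t : valid_type t -> quot_iso (principal f) (principal (nf t)) -> ~ principal f 1.
  move=> tv /quot_iso_sym/quot_isoP[F Fq]; exact: (proper_target Fq (type_proper tv)).
have p1 := proper _ _ tv1 iso1; have p2 := proper _ _ tv2 iso2.
split=> [iso m _|iso]; first exact: quot_iso_jsc.
suff t12 : t1 = t2.
  by apply: quot_iso_trans iso1 _; apply: quot_iso_sym; rewrite t12.
apply: contrapT => ne; have [m le] := types_separated tv1 tv2 ne; apply.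
apply: quot_iso_trans (quot_iso_sym (quot_iso_jsc m p1 iso1)) _.
apply: quot_iso_trans (quot_iso_jsc m p2 iso2); apply: iso.
rewrite (type_milnor_eq tv1 (quot_iso_sym iso1)) (type_milnor_eq tv2 (quot_iso_sym iso2)).
by have := type_milnor_ge tv1; have := type_milnor_ge tv2; lia.
Qed.

End MilnorBound.

(** * Jet support closures of weighted homogeneous and simple curve singularities *)

Theorem theoremD (k : closedFieldType) (k_char0 : [pchar k] =i pred0) :
  [/\
      forall (n d : nat) (f : {mpoly k[n]}),
        f \is d.-homog -> reduced f ->
        forall (m : nat) (g : {mpseries k[n]}),
          jsc m (principal (series_of_mpoly f)) g
          <-> ideal_add (principal (series_of_mpoly f))
                        (ideal_pow (maximal_ideal n k) m.+1) g,
      forall (a b d : nat) (f : {mpoly k[2]}),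
        (0 < a)%N -> (0 < b)%N -> gcdn a b = 1%N ->
        weighted_homog (weights2 a b) d f ->
        forall m : nat,
          ((m < d)%N ->
           forall g : {mpseries k[2]},
             jsc m (principal (series_of_mpoly f)) g
             <-> gen (monomials (fun p q => forall u v : nat,
                        order_pairs m f u v -> (m.+1 <= p * u + q * v)%N)) g)
          /\
          ((d <= m)%N -> reduced (series_of_mpoly f) ->
           forall g : {mpseries k[2]},
             jsc m (principal (series_of_mpoly f)) g
             <-> gen ([set series_of_mpoly f]
                      `|` monomials (fun p q => (m.+1 <= a * p + b * q)%N)) g
              /\ gen (monomials (fun p q => forall u v : nat,
                        order_pairs m f u v -> (u <= a)%N \/ (v <= b)%N ->
                        (m.+1 <= u * p + v * q)%N)) g)
    &
      forall f1 f2 : {mpseries k[2]},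
        simple_curve f1 -> simple_curve f2 ->
        (quot_iso (principal f1) (principal f2)
         <-> forall m : nat,
               (m <= maxn (milnor_number f1) (milnor_number f2) + 1)%N ->
               quot_iso (jsc m (principal f1)) (jsc m (principal f2)))].
Proof.
split.
- by move=> n d f fd fred m g; exact: (jsc_homogeneous k_char0 m g fd fred).
- move=> a b d f a0 b0 gab fd m; split=> [lt g|le fred g].
    exact: (jsc_weighted_lt k_char0 a0 b0 gab fd).
  exact: (jsc_weighted_ge k_char0 a0 b0 gab fd).
- exact: (simple_curve_jsc_iso k_char0).
Qed.
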